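(* Let $p_0,u_0,\rho_0>0$ be constants with $M_0>1$, and let $p_1$ be a constant. Consider Problem A in the finite duct $\mathcal D=\{-1<x<1,\ 0<y<1\}$ with the uniform supersonic data $(p,u,v,\rho)=(p_0,u_0,0,\rho_0)$ on the entry $\{x=-1\}$, slip condition $v=0$ on the walls $\{y=0\}$ and $\{y=1\}$, and $p=p_1$ on the exit $\{x=1\}$. Consider only transonic shock solutions for which the flow behind the shock-front satisfies $u>0$. (a) Problem A has a transonic shock solution if and only if $p_1=p^+$. (b) If $p_1=p^+$ and $U=(p,u,v,\rho)$ is a transonic shock solution to Problem A whose shock-front passes through the point $(t,0)$, then $U$ is the special solution $U_b$: the shock-front is the straight segment $x\equiv t$, $U\equiv(p_0,u_0,0,\rho_0)$ for $x<t$, and $U\equiv(p^+,u^+,0,\rho^+)$ for $x>t$.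
   Context: Fix $\gamma>1$. The steady full compressible Euler system for $(p,u,v,\rho)$ (pressure, velocity components, density; $p,\rho>0$) is $$\partial_x(\rho u)+\partial_y(\rho v)=0,\quad \partial_x(\rho u^2+p)+\partial_y(\rho uv)=0,\quad \partial_x(\rho uv)+\partial_y(\rho v^2+p)=0,\quad \tfrac12(u^2+v^2)+\tfrac{c^2}{\gamma-1}=b_0,$$ where $c=\sqrt{\gamma p/\rho}$ is the sonic speed and $b_0=\tfrac12u_0^2+\frac{\gamma p_0}{(\gamma-1)\rho_0}$ is a constant (the same on both sides of the shock-front). The Mach number is $M=\sqrt{u^2+v^2}/c$; the flow is supersonic if $M>1$ and subsonic if $M<1$. Set $c_0=\sqrt{\gamma p_0/\rho_0}$, $M_0=u_0/c_0$. Transonic shock solution of Problem A: a function $f\in C^2([0,1])$ with $-1<f<1$, shock-front $\mathcal S=\{(f(y),y):0\le y\le 1\}$, $\mathcal D^-=\{(x,y)\in\mathcal D: x<f(y)\}$, $\mathcal D^+=\{(x,y)\in\mathcal D: x>f(y)\}$, and functions $p,u,v,\rho$ that are $C^1$ on $\mathcal D^-$ and on $\mathcal D^+$, in each case up to the boundary (including $\mathcal S$, with one-sided values there), such that: the flow is supersonic in $\mathcal D^-$ and subsonic in $\mathcal D^+$ (including the boundary values on the boundary of $\mathcal D^+$); the Euler system holds pointwise in $\mathcal D^-\cup\mathcal D^+$; the boundary conditions hold pointwise; and across $\mathcal S$ the Rankine–Hugoniot conditions $$[\rho u]-f'(y)[\rho v]=0,\quad [\rho u^2+p]-f'(y)[\rho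 uv]=0,\quad [\rho uv]-f'(y)[\rho v^2+p]=0$$ and the entropy condition $[p]>0$ hold, where $[q]$ denotes the value of $q$ on $\mathcal S$ from $\mathcal D^+$ minus its value from $\mathcal D^-$. ''The flow behind the shock-front satisfies $u>0$'' means $u>0$ on $\mathcal D^+$ including boundary values. ''Passing through $(t,0)$'' means $f(0)=t$, with $-1<t<1$. The constants of the special solution are the state behind a normal shock: $$p^+=p_0\Big(1+\tfrac{2\gamma}{\gamma+1}(M_0^2-1)\Big),\quad u^+=u_0-\frac{p^+-p_0}{\rho_0u_0},\quad \rho^+=\rho_0\frac{(\gamma+1)p^++(\gamma-1)p_0}{(\gamma-1)p^++(\gamma+1)p_0}.$$ *)

(* Defs.v *)
(* Stdlib real numbers, with Coquelicot. *)
From Stdlib Require Import Reals.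
From Coquelicot Require Import Coquelicot.
Open Scope R_scope.

(** * States of the gas *)

Record state := State { pres : R; velx : R; vely : R; dens : R }.

Definition sonic_speed (gamma : R) (s : state) : R :=
  sqrt (gamma * pres s / dens s).

Definition mach (gamma : R) (s : state) : R :=
  sqrt (velx s ^ 2 + vely s ^ 2) / sonic_speed gamma s.

Definition supersonic (gamma : R) (s : state) : Prop := 1 < mach gamma s.
Definition subsonic (gamma : R) (s : state) : Prop := mach gamma s < 1.

(* Left-hand side of the Bernoulli law. *)
Definition bernoulli (gamma : R) (s : state) : R :=
  1 / 2 * (velx s ^ 2 + vely s ^ 2) + sonic_speed gamma s ^ 2 / (gamma - 1).

(** * Fluxes: [(mass_x, mass_y)], [(momx_x, momx_y)], [(momy_x, momy_y)] are the
    fluxes of mass and of the two components of momentum. *)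

Definition mass_x (s : state) : R := dens s * velx s.
Definition mass_y (s : state) : R := dens s * vely s.
Definition momx_x (s : state) : R := dens s * velx s ^ 2 + pres s.
Definition momx_y (s : state) : R := dens s * velx s * vely s.
Definition momy_x (s : state) : R := dens s * velx s * vely s.
Definition momy_y (s : state) : R := dens s * vely s ^ 2 + pres s.

Definition flow := R * R -> state.

(* [Derive] is Coquelicot's total derivative; it is only used at interior points
   of regions where the flow is C^1. *)
Definition divergence (U : flow) (F G : state -> R) (x y : R) : R :=
  Derive (fun s => F (U (s, y))) x + Derive (fun s => G (U (x, s))) y.

Definition euler_at (gamma b0 : R) (U : flow) (x y : R) : Prop :=
  divergence U mass_x mass_y x y = 0 /\
  divergence U momx_x momx_y x y = 0 /\
  divergence U momy_x momy_y x y = 0 /\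
  bernoulli gamma (U (x, y)) = b0.

(** * The duct, cut by the curve [x = f y] *)

Definition unit_itv (y : R) : Prop := 0 <= y <= 1.

Definition duct (z : R * R) : Prop := -1 < fst z < 1 /\ 0 < snd z < 1.

Definition Dminus (f : R -> R) (z : R * R) : Prop := duct z /\ fst z < f (snd z).
Definition Dplus (f : R -> R) (z : R * R) : Prop := duct z /\ f (snd z) < fst z.

(* The closures of [Dminus f] and [Dplus f], written out for [f] continuous on
   [0, 1] with values in (-1, 1). *)
Definition Dminus_bar (f : R -> R) (z : R * R) : Prop :=
  -1 <= fst z <= f (snd z) /\ 0 <= snd z <= 1.
Definition Dplus_bar (f : R -> R) (z : R * R) : Prop :=
  f (snd z) <= fst z <= 1 /\ 0 <= snd z <= 1.

(** * Regularity *)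

(* [f] is C^2 on [0, 1] with derivative [df]; derivatives are taken relatively to
   [0, 1], hence are one-sided at the end points. *)
Definition C2_unit (f df : R -> R) : Prop :=
  (forall y, unit_itv y -> D_in f df unit_itv y) /\
  exists ddf : R -> R,
    (forall y, unit_itv y -> D_in df ddf unit_itv y) /\
    continuous_on unit_itv ddf.

(* [q] is C^1 on the open set [A], up to the boundary: [q] is continuous on the
   closure [Abar] and its partial derivatives in [A] extend continuously to it. *)
Definition C1_up_to (A Abar : R * R -> Prop) (q : R * R -> R) : Prop :=
  continuous_on Abar q /\
  exists qx qy : R * R -> R,
    continuous_on Abar qx /\ continuous_on Abar qy /\
    forall x y, A (x, y) ->
      is_derive (fun s => q (s, y)) x (qx (x, y)) /\
      is_derive (fun s => q (x, s)) y (qy (x, y)).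

Definition C1_flow (A Abar : R * R -> Prop) (U : flow) : Prop :=
  C1_up_to A Abar (fun z => pres (U z)) /\
  C1_up_to A Abar (fun z => velx (U z)) /\
  C1_up_to A Abar (fun z => vely (U z)) /\
  C1_up_to A Abar (fun z => dens (U z)).

Definition positive_state (s : state) : Prop := 0 < pres s /\ 0 < dens s.

(** * Conditions across the shock-front *)

(* [Sm] and [Sp] are the states ahead of and behind the front. *)
Definition jump (q : state -> R) (Sm Sp : state) : R := q Sp - q Sm.

Definition rankine_hugoniot (slope : R) (Sm Sp : state) : Prop :=
  jump mass_x Sm Sp - slope * jump mass_y Sm Sp = 0 /\
  jump momx_x Sm Sp - slope * jump momx_y Sm Sp = 0 /\
  jump momy_x Sm Sp - slope * jump momy_y Sm Sp = 0.

Definition entropy_condition (Sm Sp : state) : Prop := 0 < jump pres Sm Sp.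

(** * Problem A *)

(* The flow is two-valued on the front: [Um] is the flow on the closure of
   [Dminus f], [Up] the flow on the closure of [Dplus f]; the values of [Um] and
   [Up] at the points [(f y, y)] are the one-sided values there. Values of
   [Um], [Up] and [f] outside of these regions and of [0, 1] are irrelevant. *)
Definition transonic_shock_solution (gamma : R) (incoming : state) (p1 : R)
    (f : R -> R) (Um Up : flow) : Prop :=
  exists df : R -> R,
  let b0 := bernoulli gamma incoming in
  (* regularity *)
  C2_unit f df /\
  (forall y, unit_itv y -> -1 < f y < 1) /\
  C1_flow (Dminus f) (Dminus_bar f) Um /\
  C1_flow (Dplus f) (Dplus_bar f) Up /\
  (forall z, Dminus_bar f z -> positive_state (Um z)) /\
  (forall z, Dplus_bar f z -> positive_state (Up z)) /\
  (* type of the flow *)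
  (forall z, Dminus f z -> supersonic gamma (Um z)) /\
  (forall z, Dplus_bar f z -> subsonic gamma (Up z)) /\
  (* Euler system *)
  (forall x y, Dminus f (x, y) -> euler_at gamma b0 Um x y) /\
  (forall x y, Dplus f (x, y) -> euler_at gamma b0 Up x y) /\
  (* entry, walls and exit *)
  (forall y, unit_itv y -> Um (-1, y) = incoming) /\
  (forall x y, y = 0 \/ y = 1 -> Dminus_bar f (x, y) -> vely (Um (x, y)) = 0) /\
  (forall x y, y = 0 \/ y = 1 -> Dplus_bar f (x, y) -> vely (Up (x, y)) = 0) /\
  (forall y, unit_itv y -> pres (Up (1, y)) = p1) /\
  (* shock-front *)
  (forall y, unit_itv y ->
     rankine_hugoniot (df y) (Um (f y, y)) (Up (f y, y)) /\
     entropy_condition (Um (f y, y)) (Up (f y, y))).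

Definition positive_velx_behind (f : R -> R) (Up : flow) : Prop :=
  forall z, Dplus_bar f z -> 0 < velx (Up z).

(** * The special solution *)

Definition p_plus (gamma p0 u0 rho0 : R) : R :=
  let M0 := u0 / sqrt (gamma * p0 / rho0) in
  p0 * (1 + 2 * gamma / (gamma + 1) * (M0 ^ 2 - 1)).

Definition u_plus (gamma p0 u0 rho0 : R) : R :=
  u0 - (p_plus gamma p0 u0 rho0 - p0) / (rho0 * u0).

Definition rho_plus (gamma p0 u0 rho0 : R) : R :=
  let pp := p_plus gamma p0 u0 rho0 in
  rho0 * (((gamma + 1) * pp + (gamma - 1) * p0)
          / ((gamma - 1) * pp + (gamma + 1) * p0)).

Definition state_behind (gamma p0 u0 rho0 : R) : state :=
  State (p_plus gamma p0 u0 rho0) (u_plus gamma p0 u0 rho0) 0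
        (rho_plus gamma p0 u0 rho0).

Definition is_special_solution (gamma p0 u0 rho0 t : R)
    (f : R -> R) (Um Up : flow) : Prop :=
  (forall y, unit_itv y -> f y = t) /\
  (forall z, Dminus_bar f z -> Um z = State p0 u0 0 rho0) /\
  (forall z, Dplus_bar f z -> Up z = state_behind gamma p0 u0 rho0).

(* Main.v *)
From Pilot Require Import Defs.
From Stdlib Require Import Reals Lra Psatz.
From Coquelicot Require Import Coquelicot.
(* [Dminus] is also a lemma of the Reals library. *)
Import Pilot.Defs.
Open Scope R_scope.

(** The flow ahead of the front is uniform because the Euler system is
    hyperbolic there, and the flow behind it is uniform because the system is
    elliptic there. Both halves are integral identities for quantities of class
    C^1 up to the boundary; neither differentiates the flow twice.

    Ahead of the front ([upstream_rigidity]). Smooth solutions transport the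
    entropy, which together with the conservation of mass and the Bernoulli law
    gives a further conservation law, div (p^(1/gamma) (u, v)) = 0. A suitable
    combination of the laws of mass, x-momentum and entropy has a flux
    ([rel_flux_x], [rel_flux_y]) that vanishes to second order at the incoming
    state U0. The quadratic part of the flux through a curve of slope dx/dy = k is
    positive definite exactly when the curve is space-like for U0, that is, when the
    component of U0 normal to it is supersonic. The Rankine-Hugoniot conditions
    and [p] > 0 make the front space-like ([shock_strength]), with a margin that
    is uniform because the front is compact. So the integral of the flux over a
    curve that follows the front where the front is already known to border states
    close to U0, and is vertical elsewhere, is zero, whereas its integrand is non-negative:
    the flow equals U0 on that curve. This advances the region where the flow
    equals U0 by a fixed length ([upstream_step]), and finitely many such steps
    fill the whole region.

    Behind the front ([downstream_rigidity]). Let w = v/u be the slope of the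
    streamlines. The Euler system expresses the gradient of w by that of p, and
    the Jacobian p_x w_y - p_y w_x becomes a quadratic form in the gradient of p
    whose discriminant has the sign of M^2 - 1; it is positive definite where the
    flow is subsonic ([pressure_slope_jacobian]). By Stokes' theorem, the integral
    of this Jacobian is the integral of p dw along the boundary. On the walls w = 0.
    On the exit p = p1, and w vanishes at both ends. On the front, p and w are
    functions of the slope k of the front only (the shock polar with upstream
    state U0), so p dw is the differential of a function of k, and k = 0 at both
    walls. Hence the integral is zero, the Jacobian vanishes identically
    ([elliptic_rigidity]), and p and w are constant. Then the strength of the
    front does not depend on the point, the front is a normal shock with p1 = p^+,
    and the remaining unknowns are constant too.

    Each region is straightened to the closed unit square, where one can integrate
    up to the curved boundary ([chart_C1_square]). *)

(** * Functions of one variable *)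

(** Composition with the retraction of the line onto [0, 1] turns a function that
    is only controlled on [0, 1] into one that is continuous everywhere, so that
    continuity never has to be taken relatively to a subset. *)
Definition clamp (t : R) : R := Rmax 0 (Rmin 1 t).

Lemma clamp_range t : 0 <= clamp t <= 1.
Proof.
  unfold clamp, Rmax, Rmin.
  destruct (Rle_dec 1 t); destruct (Rle_dec 0 _); lra.
Qed.

Lemma clamp_id t : 0 <= t <= 1 -> clamp t = t.
Proof.
  intros H; unfold clamp; rewrite Rmin_right by lra; apply Rmax_right; lra.
Qed.

Lemma clamp_lipschitz s t : Rabs (clamp s - clamp t) <= Rabs (s - t).
Proof.
  unfold clamp, Rmax, Rmin.
  destruct (Rle_dec 1 s); destruct (Rle_dec 1 t);
  repeat destruct (Rle_dec 0 _); unfold Rabs; repeat destruct Rcase_abs; lra.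
Qed.

Lemma clamp_continuous t : continuous clamp t.
Proof.
  apply filterlim_locally; intros eps; exists eps; intros s Hs.
  change (Rabs (clamp s - clamp t) < eps).
  eapply Rle_lt_trans; [apply clamp_lipschitz | exact Hs].
Qed.

Lemma locally_open_itv (a b x : R) (P : R -> Prop) :
  a < x < b -> (forall y, a < y < b -> P y) -> locally x P.
Proof.
  intros Hx HP.
  assert (He : 0 < Rmin (x - a) (b - x)) by (apply Rmin_pos; lra).
  exists (mkposreal _ He); intros y Hy; apply HP.
  change (Rabs (y - x) < Rmin (x - a) (b - x)) in Hy.
  pose proof (Rmin_l (x - a) (b - x)); pose proof (Rmin_r (x - a) (b - x)).
  apply Rabs_def2 in Hy; lra.
Qed.

Lemma derive_plus (f g : R -> R) (x df dg : R) :
  is_derive f x df -> is_derive g x dg -> is_derive (fun x => f x + g x) x (df + dg).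
Proof. exact (is_derive_plus (V := R_NormedModule) f g x df dg). Qed.

Lemma derive_minus (f g : R -> R) (x df dg : R) :
  is_derive f x df -> is_derive g x dg -> is_derive (fun x => f x - g x) x (df - dg).
Proof. exact (is_derive_minus (V := R_NormedModule) f g x df dg). Qed.

Lemma derive_mult (f g : R -> R) (x df dg : R) :
  is_derive f x df -> is_derive g x dg ->
  is_derive (fun x => f x * g x) x (df * g x + f x * dg).
Proof. intros Hf Hg; exact (is_derive_mult (K := R_AbsRing) f g x df dg Hf Hg Rmult_comm). Qed.

Lemma derive_const c (x : R) : is_derive (fun _ : R => c) x 0.
Proof. exact (is_derive_const (V := R_NormedModule) c x). Qed.

Lemma derive_eq (f : R -> R) (x l l' : R) : is_derive f x l -> l = l' -> is_derive f x l'.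
Proof. intros H <-; exact H. Qed.

Lemma derive_ext (f g : R -> R) (x l : R) :
  (forall t, f t = g t) -> is_derive f x l -> is_derive g x l.
Proof. intros H; apply is_derive_ext; exact H. Qed.

Lemma derive_continuous (f : R -> R) (x l : R) : is_derive f x l -> continuous f x.
Proof. intros H; apply (ex_derive_continuous f); exists l; exact H. Qed.

Lemma cont_plus {U : UniformSpace} (f g : U -> R) x :
  continuous f x -> continuous g x -> continuous (fun x => f x + g x) x.
Proof. exact (continuous_plus (V := R_NormedModule) f g x). Qed.

Lemma cont_minus {U : UniformSpace} (f g : U -> R) x :
  continuous f x -> continuous g x -> continuous (fun x => f x - g x) x.
Proof. exact (continuous_minus (V := R_NormedModule) f g x). Qed.

Lemma cont_opp {U : UniformSpace} (f : U -> R) x :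
  continuous f x -> continuous (fun x => - f x) x.
Proof. exact (continuous_opp (V := R_NormedModule) f x). Qed.

Lemma cont_mult {U : UniformSpace} (f g : U -> R) x :
  continuous f x -> continuous g x -> continuous (fun x => f x * g x) x.
Proof. exact (continuous_mult (K := R_AbsRing) f g x). Qed.

Lemma cont_const {U : UniformSpace} (c : R) (x : U) : continuous (fun _ : U => c) x.
Proof. exact (continuous_const c x). Qed.

(** The definition of the derivative with the division cleared: estimates of
    increments are additive in this form. *)
Lemma derive_of_bound (f : R -> R) x l :
  (forall eps, 0 < eps -> exists delta, 0 < delta /\ forall h, Rabs h < delta ->
     Rabs (f (x + h) - f x - h * l) <= eps * Rabs h) ->
  is_derive f x l.
Proof.
  intros H; apply is_derive_Reals; intros eps Heps.
  destruct (H (eps / 2)) as (d & Hd & B); [lra|].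
  exists (mkposreal d Hd); intros h Hh Hhd; simpl in Hhd.
  specialize (B h Hhd).
  replace ((f (x + h) - f x) / h - l) with ((f (x + h) - f x - h * l) / h)
    by (field; exact Hh).
  unfold Rdiv; rewrite Rabs_mult, Rabs_inv.
  assert (0 < Rabs h) by (apply Rabs_pos_lt; exact Hh).
  apply Rle_lt_trans with (eps / 2); [|lra].
  apply Rmult_le_reg_r with (Rabs h); [assumption|].
  rewrite Rmult_assoc, Rinv_l by lra; lra.
Qed.

Lemma mvt_bound (f df : R -> R) a b l e :
  (forall x, Rmin a b < x < Rmax a b -> is_derive f x (df x)) ->
  (forall x, Rmin a b <= x <= Rmax a b -> continuous f x) ->
  (forall x, Rmin a b <= x <= Rmax a b -> Rabs (df x - l) <= e) ->
  Rabs (f b - f a - (b - a) * l) <= e * Rabs (b - a).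
Proof.
  intros Hd Hc Hb.
  destruct (MVT_gen f a b df) as (c & Hc1 & Heq).
  - exact Hd.
  - intros x Hx; apply continuity_pt_filterlim; apply (Hc x Hx).
  - rewrite Heq.
    replace (df c * (b - a) - (b - a) * l) with ((df c - l) * (b - a)) by ring.
    rewrite Rabs_mult; apply Rmult_le_compat_r; [apply Rabs_pos | auto].
Qed.

Lemma zero_derivative_constant (f : R -> R) a b :
  (forall x, a < x < b -> is_derive f x 0) ->
  (forall x, a <= x <= b -> continuous f x) ->
  forall x y, a <= x <= b -> a <= y <= b -> f x = f y.
Proof.
  intros Hd Hc x y Hx Hy.
  assert (Hm : forall z, Rmin x y <= z <= Rmax x y -> a <= z <= b).
  { intros z; unfold Rmin, Rmax; destruct (Rle_dec x y); lra. }
  assert (Hm' : forall z, Rmin x y < z < Rmax x y -> a < z < b).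
  { intros z; unfold Rmin, Rmax; destruct (Rle_dec x y); lra. }
  destruct (MVT_gen f x y (fun _ => 0)) as (c & _ & Heq).
  - intros z Hz; apply Hd, Hm', Hz.
  - intros z Hz; apply continuity_pt_filterlim, (Hc z), Hm, Hz.
  - lra.
Qed.

(** The derivative is only required inside the interval: nothing is known about
    derivatives of the flow on the walls and on the front themselves. *)
Lemma fundamental_theorem01 (F f : R -> R) :
  (forall x, 0 < x < 1 -> is_derive F x (f x)) ->
  (forall x, 0 <= x <= 1 -> continuous F x) ->
  (forall x, continuous f x) ->
  RInt f 0 1 = F 1 - F 0.
Proof.
  intros Hd Hc Hf.
  assert (HI : forall x, is_derive (RInt f 0) x (f x)).
  { intros x; apply (is_derive_RInt f (RInt f 0) 0 x); [|apply Hf].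
    apply filter_forall; intros y; apply (RInt_correct f).
    apply (ex_RInt_continuous f); intros; apply Hf. }
  assert (H : F 1 - RInt f 0 1 = F 0 - RInt f 0 0).
  { apply (zero_derivative_constant (fun x => F x - RInt f 0 x) 0 1); try lra.
    - intros x Hx; eapply derive_eq; [apply (derive_minus F (RInt f 0)); auto | ring].
    - intros x Hx; apply (cont_minus F (RInt f 0)); auto.
      eapply derive_continuous, HI. }
  rewrite RInt_point in H; change (zero : R) with 0 in H; lra.
Qed.

(** [cont], [deriv] and [cont2] follow the syntax of the function; plain unification would
    unfold the field operations when it compares, say, a sum with a difference.
    Subterms that are not sums, differences or products go to [base]. *)
Ltac cont base := repeat lazymatch goal with
  | |- continuous (fun x => @?f x - @?g x) _ => apply (cont_minus f g)
  | |- continuous (fun x => @?f x + @?g x) _ => apply (cont_plus f g)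
  | |- continuous (fun x => - @?f x) _ => apply (cont_opp f)
  | |- continuous (fun x => @?f x * @?g x) _ => apply (cont_mult f g)
  | |- continuous (fun _ => ?c) _ => apply (cont_const c)
  | |- _ => base
  end.

Ltac deriv base := lazymatch goal with
  | |- is_derive (fun _ => ?c) _ _ => apply (derive_const c)
  | |- is_derive (fun x => @?f x + @?g x) _ _ => apply (derive_plus f g); deriv base
  | |- is_derive (fun x => @?f x - @?g x) _ _ => apply (derive_minus f g); deriv base
  | |- is_derive (fun x => @?f x * @?g x) _ _ => apply (derive_mult f g); deriv base
  | |- _ => base
  end.

Lemma limit_le (f : R -> R) y c d :
  continuous f y -> 0 <= y <= 1 -> 0 < d ->
  (forall y', 0 < y' < 1 -> Rabs (y' - y) < d -> f y' <= c) -> f y <= c.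
Proof.
  intros Hc Hy Hd H; apply Rnot_lt_le; intros Hlt.
  assert (He : 0 < f y - c) by lra.
  apply filterlim_locally with (eps := mkposreal _ He) in Hc.
  destruct Hc as [e Hc].
  pose proof (cond_pos e).
  set (t := Rmin (1 / 2) (Rmin (d / 2) (e / 2))).
  assert (Ht : 0 < t <= 1 / 2 /\ t <= d / 2 /\ t <= e / 2).
  { unfold t; repeat split; [repeat apply Rmin_pos; lra | apply Rmin_l | | ];
    (eapply Rle_trans; [apply Rmin_r|]); [apply Rmin_l | apply Rmin_r]. }
  set (y' := y + t * (1 / 2 - y)).
  assert (Hyy : Rabs (y' - y) <= t).
  { unfold y'; apply Rabs_le; nra. }
  assert (Hy' : 0 < y' < 1) by (unfold y'; nra).
  specialize (H y' Hy' ltac:(lra)).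
  assert (B : ball y e y') by (change (Rabs (y' - y) < e); lra).
  specialize (Hc y' B).
  change (Rabs (f y' - f y) < f y - c) in Hc.
  apply Rabs_def2 in Hc; lra.
Qed.

(** * Functions of two variables, and integrals with a parameter *)

Definition continuous2 (F : R -> R -> R) : Prop := forall x y, continuity_2d_pt F x y.

Lemma continuous2_swap F : continuous2 F -> continuous2 (fun x y => F y x).
Proof.
  intros H x y eps; destruct (H y x eps) as [d Hd].
  exists d; intros u v Hu Hv; apply Hd; assumption.
Qed.

Lemma continuous2_fst F y x : continuous2 F -> continuous (fun s => F s y) x.
Proof.
  intros H; apply filterlim_locally; intros eps.
  destruct (H x y eps) as [d Hd]; exists d; intros s Hs.
  apply Hd; [exact Hs | rewrite Rminus_eq_0, Rabs_R0; apply cond_pos].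
Qed.

Lemma continuous2_snd F x y : continuous2 F -> continuous (F x) y.
Proof.
  intros H; apply (continuous2_fst (fun a b => F b a)), continuous2_swap, H.
Qed.

Lemma continuous2_const c : continuous2 (fun _ _ => c).
Proof. intros x y; apply continuity_2d_pt_const. Qed.

Lemma continuous2_plus F G :
  continuous2 F -> continuous2 G -> continuous2 (fun x y => F x y + G x y).
Proof. intros HF HG x y; apply continuity_2d_pt_plus; auto. Qed.

Lemma continuous2_minus F G :
  continuous2 F -> continuous2 G -> continuous2 (fun x y => F x y - G x y).
Proof. intros HF HG x y; apply continuity_2d_pt_minus; auto. Qed.

Lemma continuous2_mult F G :
  continuous2 F -> continuous2 G -> continuous2 (fun x y => F x y * G x y).
Proof. intros HF HG x y; apply continuity_2d_pt_mult; auto. Qed.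

Lemma continuous2_of_fst f : (forall x, continuous f x) -> continuous2 (fun x _ => f x).
Proof.
  intros Hf x y; apply (continuity_1d_2d_pt_comp f (fun u _ => u));
    [apply continuity_pt_filterlim, Hf | apply continuity_2d_pt_id1].
Qed.

Lemma continuous2_of_snd f : (forall x, continuous f x) -> continuous2 (fun _ y => f y).
Proof.
  intros Hf x y; apply (continuity_1d_2d_pt_comp f (fun _ v => v));
    [apply continuity_pt_filterlim, Hf | apply continuity_2d_pt_id2].
Qed.

Ltac cont2 := repeat lazymatch goal with
  | |- continuous2 (fun x y => @?f x y - @?g x y) => apply (continuous2_minus f g)
  | |- continuous2 (fun x y => @?f x y + @?g x y) => apply (continuous2_plus f g)
  | |- continuous2 (fun x y => @?f x y * @?g x y) => apply (continuous2_mult f g)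
  | |- continuous2 (fun _ _ => ?c) => apply (continuous2_const c)
  | |- continuous2 (fun x _ => @?f x) => apply (continuous2_of_fst f); solve [auto]
  | |- continuous2 (fun _ y => @?f y) => apply (continuous2_of_snd f); solve [auto]
  | |- _ => assumption
  end.

Lemma continuous2_closed_eq F c :
  continuous2 F -> (forall s y, 0 < s < 1 -> 0 < y < 1 -> F s y = c) ->
  forall s y, 0 <= s <= 1 -> 0 <= y <= 1 -> F s y = c.
Proof.
  intros HF H.
  assert (H1 : forall s y, 0 < s < 1 -> 0 <= y <= 1 -> F s y = c).
  { intros s y Hs Hy; apply Rle_antisym.
    - apply (limit_le (F s) y c 1); auto using continuous2_snd; [lra|].
      intros y' Hy' _; rewrite H; lra.
    - apply Ropp_le_cancel.
      apply (limit_le (fun y => - F s y) y (- c) 1); auto; [|lra|].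
      + apply cont_opp, continuous2_snd, HF.
      + intros y' Hy' _; rewrite H; lra. }
  intros s y Hs Hy; apply Rle_antisym.
  - apply (limit_le (fun s => F s y) s c 1); auto using continuous2_fst; [lra|].
    intros y' Hy' _; rewrite H1; lra.
  - apply Ropp_le_cancel.
    apply (limit_le (fun s => - F s y) s (- c) 1); auto; [|lra|].
    + apply cont_opp; apply (continuous2_fst F), HF.
    + intros y' Hy' _; rewrite H1; lra.
Qed.

(** By compactness of the range [0, 1] of [y]. *)
Lemma continuous2_uniform F :
  continuous2 F -> forall x eps, 0 < eps ->
  exists d, 0 < d /\ forall x', Rabs (x' - x) < d ->
  forall y, 0 <= y <= 1 -> Rabs (F x' y - F x y) < eps.
Proof.
  intros HF x eps He.
  destruct (uniform_continuity_2d F (x - 1) (x + 1) 0 1 (fun u v _ _ => HF u v)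
    (mkposreal _ He)) as [d Hd].
  exists (Rmin 1 d); split; [apply Rmin_pos; [lra | apply cond_pos]|].
  intros x' B y Hy.
  assert (B1 : Rabs (x' - x) < 1) by (eapply Rlt_le_trans; [apply B | apply Rmin_l]).
  assert (B2 : Rabs (x' - x) < d) by (eapply Rlt_le_trans; [apply B | apply Rmin_r]).
  apply Rabs_def2 in B1.
  apply (Hd x y x' y); auto; try lra; rewrite Rminus_eq_0, Rabs_R0; apply cond_pos.
Qed.

Lemma ex_RInt_cont (f : R -> R) a b : (forall x, continuous f x) -> ex_RInt f a b.
Proof. intros H; apply (ex_RInt_continuous f); intros; apply H. Qed.

Lemma RInt_diff01 (f g : R -> R) :
  (forall x, continuous f x) -> (forall x, continuous g x) ->
  RInt (fun x => f x - g x) 0 1 = RInt f 0 1 - RInt g 0 1.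
Proof.
  intros; apply (RInt_minus f g); apply ex_RInt_cont; assumption.
Qed.

Lemma RInt_scal01 (f : R -> R) c :
  (forall x, continuous f x) -> RInt (fun x => c * f x) 0 1 = c * RInt f 0 1.
Proof. intros; apply (RInt_scal f); apply ex_RInt_cont; assumption. Qed.

Lemma RInt_abs01 (f : R -> R) M :
  (forall x, continuous f x) -> (forall x, 0 <= x <= 1 -> Rabs (f x) <= M) ->
  Rabs (RInt f 0 1) <= M.
Proof.
  intros Hf HM; replace M with ((1 - 0) * M) by ring.
  apply abs_RInt_le_const; [lra | apply ex_RInt_cont; auto | auto].
Qed.

Lemma continuous_RInt01 F : continuous2 F ->
  forall x, continuous (fun x => RInt (F x) 0 1) x.
Proof.
  intros HF x; apply filterlim_locally; intros eps.
  destruct (continuous2_uniform F HF x (eps / 2)) as (d & Hd & B).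
  { apply is_pos_div_2. }
  exists (mkposreal d Hd); intros x' Hx'.
  change (Rabs (x' - x) < d) in Hx'.
  change (Rabs (RInt (F x') 0 1 - RInt (F x) 0 1) < eps).
  rewrite <- RInt_diff01 by (intros; apply continuous2_snd, HF).
  apply Rle_lt_trans with (eps / 2); [|pose proof (cond_pos eps); lra].
  apply RInt_abs01.
  - intros y; apply cont_minus; apply continuous2_snd, HF.
  - intros y Hy; apply Rlt_le, B; auto.
Qed.

(** The mean value theorem gives an error that is uniform in [y], which is what
    allows increments to be integrated over [y]. *)
Lemma uniform_increment F Fx :
  continuous2 F -> continuous2 Fx ->
  (forall x y, 0 < x < 1 -> 0 <= y <= 1 -> is_derive (fun x => F x y) x (Fx x y)) ->
  forall x, 0 < x < 1 -> forall eps, 0 < eps -> exists d, 0 < d /\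
  forall h y, Rabs h < d -> 0 <= y <= 1 -> 0 < x + h < 1 /\
    Rabs (F (x + h) y - F x y - h * Fx x y) <= eps * Rabs h.
Proof.
  intros HF HFx HD x Hx eps He.
  destruct (continuous2_uniform Fx HFx x eps He) as (d & Hd & B).
  exists (Rmin d (Rmin x (1 - x))); split; [repeat apply Rmin_pos; lra|].
  intros h y Hh Hy.
  assert (Hh3 : Rabs h < d /\ Rabs h < x /\ Rabs h < 1 - x).
  { repeat split; eapply Rlt_le_trans; try apply Hh;
    [apply Rmin_l | eapply Rle_trans; [apply Rmin_r | apply Rmin_l]
    | eapply Rle_trans; [apply Rmin_r | apply Rmin_r]]. }
  destruct Hh3 as (H1 & H2 & H3).
  pose proof (Rabs_def2 _ _ H2); pose proof (Rabs_def2 _ _ H3).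
  split; [lra|].
  replace h with (x + h - x) at 2 3 by ring.
  assert (Hin : forall z, Rmin x (x + h) <= z <= Rmax x (x + h) ->
    0 < z < 1 /\ Rabs (z - x) <= Rabs h).
  { intros z; unfold Rmin, Rmax; destruct (Rle_dec x (x + h)); intros Hz;
    (split; [lra|]); unfold Rabs; repeat destruct Rcase_abs; lra. }
  apply (mvt_bound (fun x => F x y) (fun x => Fx x y)).
  - intros z Hz; apply HD; auto; apply Hin; lra.
  - intros z Hz; apply continuous2_fst, HF.
  - intros z Hz; destruct (Hin z Hz); apply Rlt_le, B; auto; lra.
Qed.

Lemma derive_RInt01 F Fx :
  continuous2 F -> continuous2 Fx ->
  (forall x y, 0 < x < 1 -> 0 <= y <= 1 -> is_derive (fun x => F x y) x (Fx x y)) ->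
  forall x, 0 < x < 1 ->
  is_derive (fun x => RInt (F x) 0 1) x (RInt (Fx x) 0 1).
Proof.
  intros HF HFx HD x Hx; apply derive_of_bound; intros eps He.
  destruct (uniform_increment F Fx HF HFx HD x Hx eps He) as (d & Hd & B).
  exists d; split; auto; intros h Hh.
  assert (C : forall z u, continuous (F z) u) by (intros; apply continuous2_snd, HF).
  assert (C' : forall z u, continuous (Fx z) u) by (intros; apply continuous2_snd, HFx).
  assert (C1 : forall u, continuous (fun y => h * Fx x y) u).
  { intros; apply cont_mult; [apply cont_const | apply C']. }
  assert (C2 : forall u, continuous (fun y => F (x + h) y - F x y) u).
  { intros; apply cont_minus; apply C. }
  rewrite <- RInt_scal01, <- RInt_diff01, <- RInt_diff01 by auto.
  apply RInt_abs01.
  - intros; apply cont_minus; auto.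
  - intros y Hy; apply (B h y Hh Hy).
Qed.

(** * Functions of class C^1 on the closed unit square *)

Lemma bounded01 (f : R -> R) :
  (forall x, continuous f x) -> exists M, 0 <= M /\ forall x, 0 <= x <= 1 -> Rabs (f x) <= M.
Proof.
  intros Hf.
  destruct (continuity_ab_maj (fun x => Rabs (f x)) 0 1) as (m & Hm & _); [lra| |].
  - intros c _; apply (continuity_pt_comp f Rabs);
      [apply continuity_pt_filterlim, Hf | apply Rcontinuity_abs].
  - exists (Rabs (f m)); split; [apply Rabs_pos | auto].
Qed.

(** The functions are extended to the plane by clamping, so continuity is global and
    only the derivatives refer to the square. Derivatives along the sides are
    included because the front and the exit will be sides of the square, and the
    data on them have to be differentiated. *)
Definition C1_square (Q Qs Qy : R -> R -> R) : Prop :=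
  continuous2 Q /\ continuous2 Qs /\ continuous2 Qy /\
  (forall s y, 0 < s < 1 -> 0 <= y <= 1 -> is_derive (fun s => Q s y) s (Qs s y)) /\
  (forall s y, 0 <= s <= 1 -> 0 < y < 1 -> is_derive (fun y => Q s y) y (Qy s y)).

(** On an edge, the derivative along that edge is the limit of the derivatives
    inside: the mean value inequality on nearby parallel segments is uniform. *)
Lemma derive_up_to_edge Q Qs :
  continuous2 Q -> continuous2 Qs ->
  (forall s y, 0 < s < 1 -> 0 < y < 1 -> is_derive (fun s => Q s y) s (Qs s y)) ->
  forall s y, 0 < s < 1 -> 0 <= y <= 1 -> is_derive (fun s => Q s y) s (Qs s y).
Proof.
  intros HQ HQs HD s y Hs Hy; apply derive_of_bound; intros eps He.
  destruct (HQs s y (mkposreal eps He)) as [d Hd]; simpl in Hd.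
  exists (Rmin d (Rmin s (1 - s))); split.
  { repeat apply Rmin_pos; try lra; apply cond_pos. }
  intros h Hh.
  assert (Hh3 : Rabs h < d /\ Rabs h < s /\ Rabs h < 1 - s).
  { repeat split; eapply Rlt_le_trans; try apply Hh;
    [apply Rmin_l | eapply Rle_trans; [apply Rmin_r | apply Rmin_l]
    | eapply Rle_trans; [apply Rmin_r | apply Rmin_r]]. }
  destruct Hh3 as (H1 & H2 & H3).
  pose proof (Rabs_def2 _ _ H2); pose proof (Rabs_def2 _ _ H3).
  assert (Hin : forall z, Rmin s (s + h) <= z <= Rmax s (s + h) ->
    0 < z < 1 /\ Rabs (z - s) <= Rabs h).
  { intros z; unfold Rmin, Rmax; destruct (Rle_dec s (s + h)); intros Hz;
    (split; [lra|]); unfold Rabs; repeat destruct Rcase_abs; lra. }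
  apply (limit_le (fun y' => Rabs (Q (s + h) y' - Q s y' - h * Qs s y)) y _ d);
    auto; [| apply cond_pos |].
  - apply (continuous_comp (fun y' => Q (s + h) y' - Q s y' - h * Qs s y) Rabs).
    + apply cont_minus; [apply cont_minus; apply continuous2_snd, HQ | apply cont_const].
    + apply continuity_pt_filterlim, Rcontinuity_abs.
  - intros y' Hy' Hyd.
    replace h with (s + h - s) at 2 3 by ring.
    apply (mvt_bound (fun s => Q s y') (fun s => Qs s y')).
    + intros z Hz; apply HD; auto; apply Hin; lra.
    + intros z Hz; apply continuous2_fst, HQ.
    + intros z Hz; destruct (Hin z Hz); apply Rlt_le, Hd; auto; lra.
Qed.

Lemma C1_square_intro Q Qs Qy :
  continuous2 Q -> continuous2 Qs -> continuous2 Qy ->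
  (forall s y, 0 < s < 1 -> 0 < y < 1 -> is_derive (fun s => Q s y) s (Qs s y)) ->
  (forall s y, 0 < s < 1 -> 0 < y < 1 -> is_derive (fun y => Q s y) y (Qy s y)) ->
  C1_square Q Qs Qy.
Proof.
  intros HQ HQs HQy Hs Hy; refine (conj HQ (conj HQs (conj HQy (conj _ _)))).
  - apply derive_up_to_edge; auto.
  - intros s y Hs' Hy'.
    apply (derive_up_to_edge (fun y s => Q s y) (fun y s => Qy s y));
      auto using continuous2_swap.
Qed.

(** Stokes' theorem for the form P dW, one slice at a time, with [P] and [W] of
    class C^1 only. Formally the integrand P W_s has the y-derivative
    P_y W_s + P W_sy, and an integration by parts in [s] moves the second
    derivative of [W] off. Doing this integration by parts on the increments
    W(s, y + h) - W(s, y) avoids second derivatives, and the remainders are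
    small by uniform differentiability. *)
Lemma stokes_slice P Ps Py W Ws Wy :
  C1_square P Ps Py -> C1_square W Ws Wy ->
  forall y, 0 < y < 1 ->
  is_derive (fun y => RInt (fun s => P s y * Ws s y) 0 1) y
    (RInt (fun s => Py s y * Ws s y - Ps s y * Wy s y) 0 1
     + (P 1 y * Wy 1 y - P 0 y * Wy 0 y)).
Proof.
  intros (CP & CPs & CPy & DPs & DPy) (CW & CWs & CWy & DWs & DWy) y Hy.
  assert (S : forall F z, continuous2 F -> forall s, continuous (fun s => F s z) s).
  { intros; apply continuous2_fst; assumption. }
  destruct (bounded01 (fun s => P s y)) as (M1 & HM1 & B1); [apply S, CP|].
  destruct (bounded01 (fun s => Ps s y)) as (M2 & HM2 & B2); [apply S, CPs|].
  destruct (bounded01 (fun s => Py s y)) as (M3 & HM3 & B3); [apply S, CPy|].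
  destruct (bounded01 (fun s => Ws s y)) as (M4 & HM4 & B4); [apply S, CWs|].
  set (M := M1 + M2 + M3 + M4 + 1).
  apply derive_of_bound; intros eps He.
  set (e := Rmin 1 (eps / (5 * M))).
  assert (HM : 0 < 5 * M) by (unfold M; lra).
  assert (He1 : 0 < e).
  { apply Rmin_pos; [lra | apply Rdiv_lt_0_compat; lra]. }
  assert (He2 : e <= 1) by apply Rmin_l.
  assert (He3 : 5 * M * e <= eps).
  { apply Rle_trans with (5 * M * (eps / (5 * M))).
    - apply Rmult_le_compat_l; [lra | apply Rmin_r].
    - right; field; lra. }
  destruct (uniform_increment (fun y s => P s y) (fun y s => Py s y)
    (continuous2_swap _ CP) (continuous2_swap _ CPy)
    (fun y s Hy Hs => DPy s y Hs Hy) y Hy e He1) as (d1 & Hd1 & I1).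
  destruct (uniform_increment (fun y s => W s y) (fun y s => Wy s y)
    (continuous2_swap _ CW) (continuous2_swap _ CWy)
    (fun y s Hy Hs => DWy s y Hs Hy) y Hy e He1) as (d2 & Hd2 & I2).
  destruct (continuous2_uniform (fun y s => Ws s y) (continuous2_swap _ CWs) y e He1)
    as (d3 & Hd3 & I3).
  exists (Rmin d1 (Rmin d2 d3)); split; [repeat apply Rmin_pos; assumption|].
  intros h Hh.
  assert (Hh3 : Rabs h < d1 /\ Rabs h < d2 /\ Rabs h < d3).
  { repeat split; eapply Rlt_le_trans; try apply Hh;
    [apply Rmin_l | eapply Rle_trans; [apply Rmin_r | apply Rmin_l]
    | eapply Rle_trans; [apply Rmin_r | apply Rmin_r]]. }
  destruct Hh3 as (H1 & H2 & H3).
  set (z := y + h).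
  assert (Hz : 0 < z < 1) by (apply (I1 h 0 H1); lra).
  (* The integration by parts in s is exact, with y and z = y + h fixed. *)
  assert (E1 : RInt (fun s => Ps s y * (W s z - W s y) + P s y * (Ws s z - Ws s y)) 0 1
    = P 1 y * (W 1 z - W 1 y) - P 0 y * (W 0 z - W 0 y)).
  { apply (fundamental_theorem01 (fun s => P s y * (W s z - W s y))).
    - intros s Hs; apply (derive_mult (fun s => P s y) (fun s => W s z - W s y)).
      + apply DPs; lra.
      + apply (derive_minus (fun s => W s z) (fun s => W s y)); apply DWs; lra.
    - intros s _; cont ltac:(apply S; assumption).
    - intros s; cont ltac:(apply S; assumption). }
  set (I := RInt (fun s => Py s y * Ws s y - Ps s y * Wy s y) 0 1).
  set (T := fun s => P s z * Ws s z - P s y * Ws s y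
    - h * (Py s y * Ws s y - Ps s y * Wy s y)
    - (Ps s y * (W s z - W s y) + P s y * (Ws s z - Ws s y))).
  assert (E2 : RInt (fun s => P s z * Ws s z) 0 1 - RInt (fun s => P s y * Ws s y) 0 1
    - h * I - (P 1 y * (W 1 z - W 1 y) - P 0 y * (W 0 z - W 0 y)) = RInt T 0 1).
  { unfold T, I; rewrite <- E1, <- RInt_scal01, <- !RInt_diff01; try reflexivity;
    intros s; cont ltac:(apply S; assumption). }
  assert (E3 : Rabs (RInt T 0 1) <= 3 * M * e * Rabs h).
  { apply RInt_abs01.
    - intros s; unfold T; cont ltac:(apply S; assumption).
    - intros s Hs.
      destruct (I1 h s H1 Hs) as [_ J1]; destruct (I2 h s H2 Hs) as [_ J2].
      assert (J3 : Rabs (Ws s z - Ws s y) < e).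
      { apply I3; auto; unfold z; replace (y + h - y) with h by ring; assumption. }
      specialize (B2 s Hs); specialize (B3 s Hs); specialize (B4 s Hs).
      fold z in J1, J2.
      assert (J4 : Rabs (Ws s z) <= M).
      { replace (Ws s z) with (Ws s y + (Ws s z - Ws s y)) by ring.
        eapply Rle_trans; [apply Rabs_triang|]; unfold M; lra. }
      replace (T s) with ((P s z - P s y - h * Py s y) * Ws s z
        + h * Py s y * (Ws s z - Ws s y)
        - Ps s y * (W s z - W s y - h * Wy s y)) by (unfold T; ring).
      pose proof (Rabs_pos h).
      eapply Rle_trans; [apply Rabs_triang|]; rewrite Rabs_Ropp.
      replace (3 * M * e * Rabs h)
        with ((e * Rabs h) * M + (Rabs h * M) * e + M * (e * Rabs h)) by ring.
      apply Rplus_le_compat; [eapply Rle_trans; [apply Rabs_triang|];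
        apply Rplus_le_compat |]; rewrite !Rabs_mult.
      + apply Rmult_le_compat; auto using Rabs_pos.
      + apply Rmult_le_compat; auto using Rmult_le_pos, Rabs_pos; [|lra].
        apply Rmult_le_compat_l; auto; unfold M; lra.
      + apply Rmult_le_compat; auto using Rabs_pos; unfold M; lra. }
  destruct (I2 h 0 H2 ltac:(lra)) as [_ K0]; destruct (I2 h 1 H2 ltac:(lra)) as [_ K1].
  fold z in K0, K1.
  pose proof (B1 0 ltac:(lra)) as L0; pose proof (B1 1 ltac:(lra)) as L1.
  match goal with |- Rabs ?X <= _ => replace X with
    (RInt T 0 1 + P 1 y * (W 1 z - W 1 y - h * Wy 1 y)
      - P 0 y * (W 0 z - W 0 y - h * Wy 0 y)) by (rewrite <- E2; unfold z; ring) end.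
  apply Rle_trans with (5 * M * e * Rabs h);
    [| apply Rmult_le_compat_r; [apply Rabs_pos | exact He3]].
  eapply Rle_trans; [apply Rabs_triang|]; rewrite Rabs_Ropp.
  replace (5 * M * e * Rabs h)
    with (3 * M * e * Rabs h + M * (e * Rabs h) + M * (e * Rabs h)) by ring.
  apply Rplus_le_compat; [eapply Rle_trans; [apply Rabs_triang|];
    apply Rplus_le_compat; [exact E3|] |]; rewrite Rabs_mult;
  apply Rmult_le_compat; auto using Rabs_pos; unfold M; lra.
Qed.

(** Divergence theorem for the field (A, B) in a region x < g(y), written in the
    chart x = -1 + s (1 + g(y)): the flux through the curve s = const does not
    depend on [s]. Indeed its integrand A - s g' B has an s-derivative equal to
    minus the y-derivative of (1 + g) B, whose integral vanishes as B = 0 on the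
    walls. *)
Lemma flux_conservation A As Ay B Bs By g dg :
  C1_square A As Ay -> C1_square B Bs By ->
  (forall y, continuous g y) -> (forall y, continuous dg y) ->
  (forall y, 0 < y < 1 -> is_derive g y (dg y)) ->
  (forall s y, 0 < s < 1 -> 0 < y < 1 ->
     As s y - s * dg y * Bs s y + (1 + g y) * By s y = 0) ->
  (forall s, 0 <= s <= 1 -> B s 0 = 0 /\ B s 1 = 0) ->
  forall s, 0 <= s <= 1 ->
  RInt (fun y => A s y - s * dg y * B s y) 0 1 = RInt (A 0) 0 1.
Proof.
  intros (CA & CAs & CAy & DAs & DAy) (CB & CBs & CBy & DBs & DBy) Cg Cdg Dg Hdiv HB s Hs.
  pose (F := fun s y => A s y - s * dg y * B s y).
  pose (Fs := fun s y => As s y - (dg y * B s y + s * dg y * Bs s y)).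
  assert (Cs : forall s, continuous (fun s : R => s) s) by (intros; apply continuous_id).
  assert (CF : continuous2 F) by (unfold F; cont2).
  assert (CFs : continuous2 Fs) by (unfold Fs; cont2).
  assert (DF : forall s y, 0 < s < 1 -> 0 <= y <= 1 ->
    is_derive (fun s => F s y) s (Fs s y)).
  { intros s' y Hs' Hy; unfold F, Fs; apply derive_minus; [apply DAs; auto|].
    apply (derive_mult (fun s => s * dg y) (fun s => B s y)); [| apply DBs; auto].
    eapply derive_eq;
      [apply (derive_mult (fun s => s) (fun _ => dg y) s' 1 0);
        [apply (is_derive_id (K := R_AbsRing)) | apply derive_const] | simpl; ring]. }
  assert (Z : forall s', 0 < s' < 1 -> RInt (Fs s') 0 1 = 0).
  { intros s' Hs'.
    transitivity (RInt (fun y => (-1) * (dg y * B s' y + (1 + g y) * By s' y)) 0 1).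
    { apply RInt_ext; intros y Hy; rewrite Rmin_left, Rmax_right in Hy by lra.
      specialize (Hdiv s' y Hs' Hy); unfold Fs; simpl; lra. }
    assert (C : forall y, continuous (fun y => dg y * B s' y + (1 + g y) * By s' y) y).
    { intros y; apply (continuous2_snd (fun s y => dg y * B s y + (1 + g y) * By s y));
      cont2. }
    rewrite RInt_scal01 by exact C.
    rewrite (fundamental_theorem01 (fun y => (1 + g y) * B s' y)).
    - destruct (HB s' ltac:(lra)) as [-> ->]; match goal with |- ?a = ?b => change (@eq R a b) end; ring.
    - intros y Hy; apply (derive_mult (fun y => 1 + g y) (fun y => B s' y) y (dg y) (By s' y)).
      + eapply derive_eq; [apply (derive_plus (fun _ => 1) g y 0 (dg y));
          [apply derive_const | auto] | ring].
      + apply DBy; lra.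
    - intros y _; apply (continuous2_snd (fun s y => (1 + g y) * B s y)); cont2.
    - exact C. }
  transitivity (RInt (F 0) 0 1).
  - apply (zero_derivative_constant (fun s => RInt (F s) 0 1) 0 1); try lra.
    + intros x Hx; apply (derive_eq _ _ _ _ (derive_RInt01 F Fs CF CFs DF x Hx) (Z x Hx)).
    + intros x _; apply continuous_RInt01, CF.
  - apply RInt_ext; intros y _; unfold F; simpl; ring.
Qed.

Lemma integral_zero_pointwise (f : R -> R) :
  (forall x, continuous f x) -> (forall x, 0 < x < 1 -> 0 <= f x) ->
  RInt f 0 1 = 0 -> forall x, 0 <= x <= 1 -> f x = 0.
Proof.
  intros Hc Hp HI.
  assert (Hint : forall x, 0 < x < 1 -> f x <= 0).
  { intros x Hx; apply Rnot_lt_le; intros Hpos.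
    assert (C := Hc x).
    assert (He : 0 < f x / 2) by lra.
    apply filterlim_locally with (eps := mkposreal _ He) in C.
    destruct C as [d C].
    pose (r := Rmin (d / 2) (Rmin (x / 2) ((1 - x) / 2))).
    pose proof (cond_pos d).
    assert (Hr : 0 < r /\ r <= d / 2 /\ r <= x / 2 /\ r <= (1 - x) / 2).
    { unfold r; repeat split; [repeat apply Rmin_pos; lra | apply Rmin_l | |];
      (eapply Rle_trans; [apply Rmin_r|]); [apply Rmin_l | apply Rmin_r]. }
    assert (E : forall a b, ex_RInt f a b) by (intros; apply ex_RInt_cont; auto).
    assert (H1 : 0 <= RInt f 0 (x - r)).
    { apply RInt_ge_0; [lra | auto | intros; apply Hp; lra]. }
    assert (H2 : 0 < RInt f (x - r) (x + r)).
    { apply RInt_gt_0; [lra | | auto].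
      intros z Hz; assert (B : ball x d z).
      { change (Rabs (z - x) < d); apply Rabs_def1; lra. }
      specialize (C z B); change (Rabs (f z - f x) < f x / 2) in C.
      apply Rabs_def2 in C; lra. }
    assert (H3 : 0 <= RInt f (x + r) 1).
    { apply RInt_ge_0; [lra | auto | intros; apply Hp; lra]. }
    rewrite <- (RInt_Chasles f 0 (x - r) 1) in HI by auto.
    rewrite <- (RInt_Chasles f (x - r) (x + r) 1) in HI by auto.
    change (RInt f 0 (x - r) + (RInt f (x - r) (x + r) + RInt f (x + r) 1) = 0) in HI.
    lra. }
  intros x Hx; apply Rle_antisym.
  - apply (limit_le f x 0 1); auto; lra.
  - apply Ropp_le_cancel, (limit_le (fun x => - f x) x (- 0) 1); auto; [|lra|].
    + apply cont_opp, Hc.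
    + intros y Hy _; specialize (Hp y Hy); lra.
Qed.

(** Constancy along horizontal segments carries the data of the front or of the
    exit into the whole region. *)
Lemma C1_square_constant_s Q Qs Qy :
  C1_square Q Qs Qy -> (forall s y, 0 < s < 1 -> 0 < y < 1 -> Qs s y = 0) ->
  forall s s' y, 0 <= s <= 1 -> 0 <= s' <= 1 -> 0 <= y <= 1 -> Q s y = Q s' y.
Proof.
  intros (CQ & CQs & _ & DQ & _) HZ s s' y Hs Hs' Hy.
  apply (zero_derivative_constant (fun s => Q s y) 0 1); auto.
  - intros x Hx; eapply derive_eq; [apply DQ; auto|].
    apply (continuous2_closed_eq Qs 0 CQs HZ); lra.
  - intros; apply continuous2_fst, CQ.
Qed.

(** * Straightening a region between two graphs *)

(** [C1_up_to] hides the partial derivatives; here they can be referred to. *)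
Definition partials (A Abar : R * R -> Prop) (q qx qy : R * R -> R) : Prop :=
  continuous_on Abar q /\ continuous_on Abar qx /\ continuous_on Abar qy /\
  forall x y, A (x, y) ->
    is_derive (fun s => q (s, y)) x (qx (x, y)) /\
    is_derive (fun s => q (x, s)) y (qy (x, y)).

(** The function [q] read in the chart (s, y) |-> (X s y, y) of the unit square. *)
Definition pull (X : R -> R -> R) (q : R * R -> R) (s y : R) : R :=
  q (X (clamp s) (clamp y), clamp y).

Lemma pull_continuous (Abar : R * R -> Prop) X q :
  continuous2 X ->
  (forall s y, 0 <= s <= 1 -> 0 <= y <= 1 -> Abar (X s y, y)) ->
  continuous_on Abar q -> continuous2 (pull X q).
Proof.
  intros CX HA Cq s y eps.
  assert (H0 : Abar (X (clamp s) (clamp y), clamp y)) by (apply HA; apply clamp_range).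
  specialize (Cq _ H0).
  apply filterlim_locally with (eps := eps) in Cq.
  destruct Cq as [d Cq].
  destruct (CX (clamp s) (clamp y) d) as [d' Hd'].
  pose proof (cond_pos d); pose proof (cond_pos d').
  assert (Hm : 0 < Rmin d d') by (apply Rmin_pos; assumption).
  exists (mkposreal _ Hm); simpl; intros u v Hu Hv.
  pose proof (Rmin_l d d'); pose proof (Rmin_r d d').
  pose proof (clamp_lipschitz u s); pose proof (clamp_lipschitz v y).
  apply (Cq (X (clamp u) (clamp v), clamp v)).
  - split; simpl.
    + apply Hd'; lra.
    + change (Rabs (clamp v - clamp y) < d); lra.
  - apply HA; apply clamp_range.
Qed.

(** The region between the graphs of [a] and [b] becomes the unit square in the
    coordinate s = (x - a) / (b - a). The chain rule in [y] needs [q] to be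
    differentiable jointly in both variables, which holds as its partial
    derivatives are continuous. *)
Lemma chart_C1_square (A Abar : R * R -> Prop) q qx qy a b da db :
  (forall z, A z -> Abar z) -> (forall z, A z -> locally z A) ->
  partials A Abar q qx qy ->
  (forall y, continuous a y) -> (forall y, continuous b y) ->
  (forall y, continuous da y) -> (forall y, continuous db y) ->
  (forall y, 0 < y < 1 -> is_derive a y (da y)) ->
  (forall y, 0 < y < 1 -> is_derive b y (db y)) ->
  let X := fun s y => a y + s * (b y - a y) in
  (forall s y, 0 < s < 1 -> 0 < y < 1 -> A (X s y, y)) ->
  (forall s y, 0 <= s <= 1 -> 0 <= y <= 1 -> Abar (X s y, y)) ->
  C1_square (pull X q)
    (fun s y => pull X qx s y * (b (clamp y) - a (clamp y)))
    (fun s y => pull X qy s y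
       + pull X qx s y * (da (clamp y) + clamp s * (db (clamp y) - da (clamp y)))).
Proof.
  intros HA HO (Cq & Cqx & Cqy & HD) Ca Cb Cda Cdb Da Db X HX HXbar.
  assert (Cid : forall s : R, continuous (fun s : R => s) s) by (intros; apply continuous_id).
  assert (CX : continuous2 X) by (unfold X; cont2).
  assert (Cc : forall f : R -> R, (forall y, continuous f y) ->
    forall y, continuous (fun y => f (clamp y)) y).
  { intros f Hf y; apply (continuous_comp clamp f); [apply clamp_continuous | apply Hf]. }
  assert (Pq := pull_continuous Abar X q CX HXbar Cq).
  assert (Pqx := pull_continuous Abar X qx CX HXbar Cqx).
  assert (Pqy := pull_continuous Abar X qy CX HXbar Cqy).
  apply C1_square_intro.
  - exact Pq.
  - cont2.
  - assert (Cs : forall s, continuous clamp s) by apply clamp_continuous.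
    apply (continuous2_plus (pull X qy) (fun s y => pull X qx s y
      * (da (clamp y) + clamp s * (db (clamp y) - da (clamp y))))); [exact Pqy|].
    apply (continuous2_mult (pull X qx)
      (fun s y => da (clamp y) + clamp s * (db (clamp y) - da (clamp y)))); [exact Pqx|].
    cont2.
  - intros s y Hs Hy.
    apply (is_derive_ext_loc (fun s => q (X s y, y))).
    { apply (locally_open_itv 0 1); auto; intros s' Hs'; unfold pull.
      rewrite !clamp_id by lra; reflexivity. }
    unfold pull; rewrite !clamp_id by lra.
    destruct (HD (X s y) y (HX s y Hs Hy)) as [D1 _].
    eapply derive_eq.
    + apply (is_derive_comp (fun x => q (x, y)) (fun s => X s y)); [exact D1|].
      apply (derive_plus (fun _ => a y) (fun s => s * (b y - a y)) s 0 (1 * (b y - a y) + s * 0));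
        [apply derive_const|].
      apply (derive_mult (fun s => s) (fun _ => b y - a y) s 1 0);
        [apply (is_derive_id (K := R_AbsRing)) | apply derive_const].
    + unfold scal; simpl; unfold mult; simpl; ring.
  - intros s y Hs Hy.
    apply (is_derive_ext_loc (fun y => q (X s y, y))).
    { apply (locally_open_itv 0 1); auto; intros y' Hy'; unfold pull.
      rewrite !clamp_id by lra; reflexivity. }
    unfold pull; rewrite !clamp_id by lra.
    assert (HXA := HX s y Hs Hy).
    destruct (HD (X s y) y HXA) as [_ D2].
    assert (DX : is_derive (X s) y (da y + s * (db y - da y))).
    { eapply derive_eq.
      - apply (derive_plus a (fun y => s * (b y - a y)) y (da y)
          (0 * (b y - a y) + s * (db y - da y))); [auto|].
        apply (derive_mult (fun _ => s) (fun y => b y - a y)); [apply derive_const|].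
        apply derive_minus; auto.
      - simpl; ring. }
    assert (F : filterdiff (fun u : R * R => q (fst u, snd u)) (locally (X s y, y))
      (fun u => plus (scal (fst u) (qx (X s y, y))) (scal (snd u) (qy (X s y, y))))).
    { apply (is_derive_filterdiff (fun x y => q (x, y)) (X s y) y
        (fun x y => qx (x, y)) (qy (X s y, y))).
      - generalize (HO _ HXA); apply filter_imp; intros [x' y'] H; apply (HD x' y' H).
      - exact D2.
      - apply (continuous_ext qx); [intros []; reflexivity|].
        apply (continuous_continuous_on A); [auto|].
        apply (continuous_on_subset Abar); auto. }
    apply (filterdiff_differentiable_pt_lim (fun x y => q (x, y))) in F.
    apply is_derive_Reals in DX.
    apply is_derive_Reals.
    replace (qy (X s y, y) + qx (X s y, y) * (da y + s * (db y - da y)))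
      with (qx (X s y, y) * (da y + s * (db y - da y)) + qy (X s y, y) * 1) by ring.
    apply (derivable_pt_lim_comp_2d (fun x y => q (x, y)) (X s) (fun y => y));
      [exact F | exact DX | apply derivable_pt_lim_id].
Qed.

(** * Calculus of functions of class C^1 up to the boundary *)

Lemma continuous_on_comp (D : R * R -> Prop) q (h : R -> R) :
  continuous_on D q -> (forall z, D z -> continuous h (q z)) ->
  continuous_on D (fun z => h (q z)).
Proof.
  intros Hq Hh z Hz; eapply filterlim_comp; [apply (Hq z Hz) | apply (Hh z Hz)].
Qed.

Lemma continuous_on_plus (D : R * R -> Prop) (f g : R * R -> R) :
  continuous_on D f -> continuous_on D g -> continuous_on D (fun z => f z + g z).
Proof.
  intros Hf Hg z Hz.
  eapply (filterlim_comp_2 (G := locally (f z)) (H := locally (g z)));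
    [apply (Hf z Hz) | apply (Hg z Hz) | apply (filterlim_plus (V := R_NormedModule))].
Qed.

Lemma continuous_on_mult (D : R * R -> Prop) (f g : R * R -> R) :
  continuous_on D f -> continuous_on D g -> continuous_on D (fun z => f z * g z).
Proof.
  intros Hf Hg z Hz.
  eapply (filterlim_comp_2 (G := locally (f z)) (H := locally (g z)));
    [apply (Hf z Hz) | apply (Hg z Hz) | apply (filterlim_mult (K := R_AbsRing))].
Qed.

Lemma continuous_on_minus (D : R * R -> Prop) (f g : R * R -> R) :
  continuous_on D f -> continuous_on D g -> continuous_on D (fun z => f z - g z).
Proof.
  intros Hf Hg; apply (continuous_on_plus D f (fun z => - g z)); [exact Hf|].
  intros z Hz; eapply filterlim_comp;
    [apply (Hg z Hz) | apply (filterlim_opp (V := R_NormedModule))].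
Qed.

Lemma continuous_on_const (D : R * R -> Prop) (c : R) : continuous_on D (fun _ => c).
Proof. apply continuous_on_forall; intros; apply continuous_const. Qed.

Lemma C1_up_to_const A Abar c : C1_up_to A Abar (fun _ => c).
Proof.
  split; [apply continuous_on_const|].
  exists (fun _ => 0), (fun _ => 0).
  do 2 (split; [apply continuous_on_const|]).
  intros x y _; split; apply derive_const.
Qed.

Lemma C1_up_to_plus A Abar q r :
  C1_up_to A Abar q -> C1_up_to A Abar r -> C1_up_to A Abar (fun z => q z + r z).
Proof.
  intros (Cq & qx & qy & Cqx & Cqy & Dq) (Cr & rx & ry & Crx & Cry & Dr).
  split; [apply continuous_on_plus; assumption|].
  exists (fun z => qx z + rx z), (fun z => qy z + ry z).
  do 2 (split; [apply continuous_on_plus; assumption|]).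
  intros x y H; destruct (Dq x y H), (Dr x y H); split.
  - apply (derive_plus (fun s => q (s, y)) (fun s => r (s, y))); assumption.
  - apply (derive_plus (fun s => q (x, s)) (fun s => r (x, s))); assumption.
Qed.

Lemma C1_up_to_minus A Abar q r :
  C1_up_to A Abar q -> C1_up_to A Abar r -> C1_up_to A Abar (fun z => q z - r z).
Proof.
  intros (Cq & qx & qy & Cqx & Cqy & Dq) (Cr & rx & ry & Crx & Cry & Dr).
  split; [apply continuous_on_minus; assumption|].
  exists (fun z => qx z - rx z), (fun z => qy z - ry z).
  do 2 (split; [apply continuous_on_minus; assumption|]).
  intros x y H; destruct (Dq x y H), (Dr x y H); split.
  - apply (derive_minus (fun s => q (s, y)) (fun s => r (s, y))); assumption.
  - apply (derive_minus (fun s => q (x, s)) (fun s => r (x, s))); assumption.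
Qed.

Lemma C1_up_to_mult A (Abar : R * R -> Prop) q r :
  C1_up_to A Abar q -> C1_up_to A Abar r -> C1_up_to A Abar (fun z => q z * r z).
Proof.
  intros (Cq & qx & qy & Cqx & Cqy & Dq) (Cr & rx & ry & Crx & Cry & Dr).
  split; [apply continuous_on_mult; assumption|].
  exists (fun z => qx z * r z + q z * rx z), (fun z => qy z * r z + q z * ry z).
  do 2 (split; [apply continuous_on_plus; apply continuous_on_mult; assumption|]).
  intros x y H; destruct (Dq x y H), (Dr x y H); split.
  - apply (derive_mult (fun s => q (s, y)) (fun s => r (s, y))); assumption.
  - apply (derive_mult (fun s => q (x, s)) (fun s => r (x, s))); assumption.
Qed.

Lemma C1_up_to_comp (A Abar : R * R -> Prop) q (h dh : R -> R) :
  (forall z, A z -> Abar z) ->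
  (forall z, Abar z -> is_derive h (q z) (dh (q z))) ->
  (forall z, Abar z -> continuous dh (q z)) ->
  C1_up_to A Abar q -> C1_up_to A Abar (fun z => h (q z)).
Proof.
  intros HA Dh Cdh (Cq & qx & qy & Cqx & Cqy & Dq).
  split.
  { apply continuous_on_comp; [assumption|].
    intros z Hz; apply (derive_continuous h _ _ (Dh z Hz)). }
  exists (fun z => qx z * dh (q z)), (fun z => qy z * dh (q z)).
  assert (C := continuous_on_comp Abar q dh Cq Cdh).
  do 2 (split; [apply continuous_on_mult; assumption|]).
  intros x y H; destruct (Dq x y H); split.
  - apply (is_derive_comp h (fun s => q (s, y))); [apply Dh, HA, H | assumption].
  - apply (is_derive_comp h (fun s => q (x, s))); [apply Dh, HA, H | assumption].
Qed.

(** * The Euler system for smooth flows *)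

Lemma bernoulli_formula gamma s : 1 < gamma -> positive_state s ->
  bernoulli gamma s
  = 1 / 2 * (velx s ^ 2 + vely s ^ 2) + gamma / (gamma - 1) * (pres s * / dens s).
Proof.
  intros Hg [Hp Hr]; unfold bernoulli, sonic_speed.
  rewrite pow2_sqrt.
  - field; lra.
  - apply Rlt_le, Rdiv_lt_0_compat; [apply Rmult_lt_0_compat; lra | exact Hr].
Qed.

(** The Bernoulli function without the square root of the sonic speed, in a form
    suited to the differentiation and continuity lemmas above. *)
Definition energy (gamma : R) (s : state) : R :=
  1 / 2 * (velx s * velx s + vely s * vely s) + gamma / (gamma - 1) * (pres s * / dens s).

Lemma bernoulli_energy gamma s : 1 < gamma -> positive_state s ->
  bernoulli gamma s = energy gamma s.
Proof.
  intros; rewrite bernoulli_formula by assumption; unfold energy; simpl; ring.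
Qed.

(** The mass equation is subtracted from the momentum equations. The last equation
    is the transport of entropy: the Bernoulli law, differentiated along the
    velocity, gives the variation of the kinetic energy, which the momentum
    equations express by that of the pressure. *)
Lemma primitive_form (gamma b0 : R) (A : R * R -> Prop) (U : flow) x y
    (px py ux uy vx vy rx ry : R) :
  1 < gamma -> (forall z, A z -> locally z A) ->
  (forall z, A z -> positive_state (U z)) ->
  (forall x y, A (x, y) -> euler_at gamma b0 U x y) ->
  A (x, y) ->
  is_derive (fun s => pres (U (s, y))) x px -> is_derive (fun s => pres (U (x, s))) y py ->
  is_derive (fun s => velx (U (s, y))) x ux -> is_derive (fun s => velx (U (x, s))) y uy ->
  is_derive (fun s => vely (U (s, y))) x vx -> is_derive (fun s => vely (U (x, s))) y vy ->
  is_derive (fun s => dens (U (s, y))) x rx -> is_derive (fun s => dens (U (x, s))) y ry ->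
  let p := pres (U (x, y)) in let u := velx (U (x, y)) in
  let v := vely (U (x, y)) in let r := dens (U (x, y)) in
  rx * u + r * ux + (ry * v + r * vy) = 0 /\
  r * (u * ux + v * uy) + px = 0 /\
  r * (u * vx + v * vy) + py = 0 /\
  u * px + v * py + gamma * p * (ux + vy) = 0.
Proof.
  intros Hg HO Hpos HE HA Dpx Dpy Dux Duy Dvx Dvy Drx Dry p u v r.
  destruct (Hpos _ HA) as [Hp Hr]; fold p r in Hp, Hr.
  destruct (HE x y HA) as (E1 & E2 & E3 & _).
  assert (Bern : forall z, A z -> 1 / 2 * (velx (U z) * velx (U z) + vely (U z) * vely (U z))
    + gamma / (gamma - 1) * (pres (U z) * / dens (U z)) = b0).
  { intros [x' y'] Hz; destruct (HE x' y' Hz) as (_ & _ & _ & <-).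
    rewrite bernoulli_formula by auto; simpl; ring. }
  assert (Dinv : forall (f : R -> R) (t df : R), 0 < f t -> is_derive f t df ->
    is_derive (fun t => / f t) t (- df / f t ^ 2)).
  { intros f t df Hf D; apply is_derive_inv; [exact D | lra]. }
  assert (DB : forall (P Q V D : R -> R) (t dp dq dv dd : R),
    0 < D t -> is_derive P t dp -> is_derive Q t dq -> is_derive V t dv -> is_derive D t dd ->
    locally t (fun t => 1 / 2 * (Q t * Q t + V t * V t)
      + gamma / (gamma - 1) * (P t * / D t) = b0) ->
    Q t * dq + V t * dv + gamma / (gamma - 1) * (dp / D t - P t * dd / D t ^ 2) = 0).
  { intros P Q V D t dp dq dv dd HD DP DQ DV DD HL.
    assert (H0 : is_derive (fun t => 1 / 2 * (Q t * Q t + V t * V t)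
      + gamma / (gamma - 1) * (P t * / D t)) t 0).
    { apply (is_derive_ext_loc (fun _ => b0)); [|apply derive_const].
      revert HL; apply filter_imp; intros ? ->; reflexivity. }
    assert (H1 : is_derive (fun t => 1 / 2 * (Q t * Q t + V t * V t)
      + gamma / (gamma - 1) * (P t * / D t)) t
      (0 * (Q t * Q t + V t * V t) + 1 / 2 * (dq * Q t + Q t * dq + (dv * V t + V t * dv))
       + (0 * (P t * / D t) + gamma / (gamma - 1) * (dp * / D t + P t * (- dd / D t ^ 2))))).
    { deriv ltac:(first [assumption | apply Dinv; assumption]). }
    apply is_derive_unique in H0; apply is_derive_unique in H1.
    rewrite H0 in H1; unfold Rdiv in *; lra. }
  assert (Lx : locally x (fun s => A (s, y))).
  { destruct (HO _ HA) as [d Hd]; exists d; intros s Hs; apply Hd; split;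
      [exact Hs | apply ball_center]. }
  assert (Ly : locally y (fun s => A (x, s))).
  { destruct (HO _ HA) as [d Hd]; exists d; intros s Hs; apply Hd; split;
      [apply ball_center | exact Hs]. }
  assert (Bx := DB (fun s => pres (U (s, y))) (fun s => velx (U (s, y)))
    (fun s => vely (U (s, y))) (fun s => dens (U (s, y))) x px ux vx rx Hr Dpx Dux Dvx Drx
    (filter_imp _ _ (fun s H => Bern (s, y) H) Lx)).
  assert (By := DB (fun s => pres (U (x, s))) (fun s => velx (U (x, s)))
    (fun s => vely (U (x, s))) (fun s => dens (U (x, s))) y py uy vy ry Hr Dpy Duy Dvy Dry
    (filter_imp _ _ (fun s H => Bern (x, s) H) Ly)).
  cbv beta in Bx, By; fold p u v r in Bx, By.
  assert (DM : forall (P Q V D : R -> R) (t dp dq dv dd : R),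
    is_derive P t dp -> is_derive Q t dq -> is_derive V t dv -> is_derive D t dd ->
    Derive (fun t => D t * Q t) t = dd * Q t + D t * dq /\
    Derive (fun t => D t * Q t ^ 2 + P t) t = dd * Q t ^ 2 + D t * (2 * Q t * dq) + dp /\
    Derive (fun t => D t * Q t * V t) t
      = dd * Q t * V t + D t * dq * V t + D t * Q t * dv).
  { intros P Q V D t dp dq dv dd DP DQ DV DD; repeat split; apply is_derive_unique.
    - deriv ltac:(eassumption).
    - apply (is_derive_ext (fun t => D t * (Q t * Q t) + P t)); [intros; simpl; ring|].
      eapply derive_eq; [deriv ltac:(eassumption) | simpl; ring].
    - eapply derive_eq; [deriv ltac:(eassumption) | simpl; ring]. }
  destruct (DM (fun s : R => pres (U (s, y))) (fun s : R => velx (U (s, y)))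
    (fun s : R => vely (U (s, y))) (fun s : R => dens (U (s, y))) x _ _ _ _ Dpx Dux Dvx Drx) as (F1 & F2 & F3).
  destruct (DM (fun s : R => pres (U (x, s))) (fun s : R => vely (U (x, s)))
    (fun s : R => velx (U (x, s))) (fun s : R => dens (U (x, s))) y _ _ _ _ Dpy Dvy Duy Dry) as (G1 & G2 & G3).
  cbv beta in F1, F2, F3, G1, G2, G3.
  unfold divergence, mass_x, mass_y in E1; cbv beta in E1; rewrite F1, G1 in E1.
  unfold divergence, momx_x, momx_y in E2; cbv beta in E2.
  rewrite F2, (Derive_ext _ (fun t => dens (U (x, t)) * vely (U (x, t)) * velx (U (x, t)))),
    G3 in E2
    by (intros; ring).
  unfold divergence, momy_x, momy_y in E3; cbv beta in E3; rewrite F3, G2 in E3.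
  fold p u v r in E1, E2, E3.
  assert (K1 : rx * u + r * ux + (ry * v + r * vy) = 0) by exact E1.
  assert (K2 : r * (u * ux + v * uy) + px = 0).
  { match type of E2 with ?e = _ => match type of K1 with ?k = _ =>
      transitivity (e - u * k); [ring | rewrite E2, K1; ring] end end. }
  assert (K3 : r * (u * vx + v * vy) + py = 0).
  { match type of E3 with ?e = _ => match type of K1 with ?k = _ =>
      transitivity (e - v * k); [ring | rewrite E3, K1; ring] end end. }
  refine (conj K1 (conj K2 (conj K3 _))).
  match type of Bx with ?bx = _ => match type of By with ?b_y = _ =>
  match type of K1 with ?k1 = _ => match type of K2 with ?k2 = _ =>
  match type of K3 with ?k3 = _ =>
    transitivity ((gamma - 1) * r * (u * bx + v * b_y) - (gamma - 1) * (u * k2 + v * k3)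
      + gamma * p / r * k1) end end end end end.
  - field; lra.
  - rewrite Bx, By, K1, K2, K3; ring.
Qed.

(** * Shock relations *)

(** The mass flux [j] through the front is continuous and non-zero since [p] > 0.
    So the jumps of the velocity and of the specific volume are multiples of [p];
    substitution into the Bernoulli law leaves an equation from which a factor [p]
    cancels. Since [p] > 0, the normal Mach number ahead of the front exceeds 1. *)
Lemma shock_strength gamma k Sm Sp :
  1 < gamma -> positive_state Sm -> positive_state Sp ->
  rankine_hugoniot k Sm Sp -> entropy_condition Sm Sp ->
  bernoulli gamma Sm = bernoulli gamma Sp ->
  dens Sm * (velx Sm - k * vely Sm) ^ 2
  = (1 + k ^ 2) * (gamma * pres Sm + (gamma + 1) / 2 * jump pres Sm Sp).
Proof.
  intros Hg Hm Hp (R1 & R2 & R3) HE HB.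
  rewrite !bernoulli_formula in HB by assumption.
  unfold entropy_condition, jump, mass_x, mass_y, momx_x, momx_y, momy_x, momy_y in *.
  destruct Sm as [p u v r], Sp as [P U V D], Hm as [Hp0 Hr0], Hp as [HP HD]; simpl in *.
  set (q := P - p) in *.
  set (j := r * (u - k * v)).
  assert (J1 : D * (U - k * V) = j) by (unfold j; lra).
  assert (J2 : j * (U - u) = - q).
  { replace (j * (U - u)) with (U * (D * (U - k * V)) - u * j) by (rewrite J1; ring).
    unfold j, q; lra. }
  assert (J3 : j * (V - v) = k * q).
  { replace (j * (V - v)) with (V * (D * (U - k * V)) - v * j) by (rewrite J1; ring).
    unfold j, q; lra. }
  assert (Hj : j <> 0) by (intros E; rewrite E in J2; lra).
  assert (EU : U = u - q / j) by (apply (Rmult_eq_reg_l j); [field_simplify|]; lra).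
  assert (EV : V = v + k * q / j) by (apply (Rmult_eq_reg_l j); [field_simplify|]; lra).
  assert (ED : / D = (u - k * v - (1 + k ^ 2) * q / j) / j).
  { replace (u - k * v - (1 + k ^ 2) * q / j) with (U - k * V)
      by (rewrite EU, EV; field; exact Hj).
    rewrite <- J1; field; split; [|lra]; intros E; apply Hj; rewrite <- J1, E; ring. }
  assert (Er : / r = (u - k * v) / j).
  { unfold j; field; split; [|lra]; intros E; apply Hj; unfold j; rewrite E; ring. }
  rewrite ED, Er, EU, EV in HB.
  replace P with (p + q) in HB by (unfold q; ring).
  replace (r * ((u - k * v) * ((u - k * v) * 1))) with (j * (u - k * v)) by (unfold j; ring).
  apply (Rmult_eq_reg_l (q / (j * j * (gamma - 1)))).
  - match type of HB with ?l = ?rr => apply (Rplus_eq_reg_r (l - rr)) end.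
    rewrite HB at 2.
    field. lra.
  - apply Rgt_not_eq, Rdiv_lt_0_compat; [exact HE|].
    apply Rmult_lt_0_compat; [nra|lra].
Qed.

(** The shock polar of a horizontal upstream flow: the state behind the front
    is a function of the slope [k] of the front only. *)
Lemma state_behind_front gamma p0 u0 r0 k Sp :
  1 < gamma -> 0 < p0 -> 0 < u0 -> 0 < r0 ->
  let S0 := State p0 u0 0 r0 in
  positive_state Sp ->
  rankine_hugoniot k S0 Sp -> entropy_condition S0 Sp ->
  bernoulli gamma S0 = bernoulli gamma Sp ->
  let m := r0 * u0 in
  let q := 2 / (gamma + 1) * (m * u0 / (1 + k ^ 2) - gamma * p0) in
  pres Sp = p0 + q /\ velx Sp = u0 - q / m /\ vely Sp = k * q / m /\
  dens Sp * (velx Sp - k * vely Sp) = m /\ 0 < q.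
Proof.
  intros Hg Hp0 Hu0 Hr0 S0 Hp RH HE HB m q.
  assert (H0 : positive_state S0) by (split; assumption).
  assert (HS := shock_strength gamma k S0 Sp Hg H0 Hp RH HE HB).
  destruct RH as (R1 & R2 & R3).
  unfold entropy_condition, jump, mass_x, mass_y, momx_x, momx_y, momy_x, momy_y in *.
  destruct Sp as [P U V D], Hp as [HP HD]; simpl in *.
  assert (Hm : 0 < m) by (unfold m; nra).
  assert (HN : 0 < 1 + k * (k * 1)) by nra.
  assert (Eq : P - p0 = q).
  { unfold q, m; apply (Rmult_eq_reg_l ((1 + k * (k * 1)) * ((gamma + 1) / 2))); [|nra].
    field_simplify; [|lra]. field_simplify in HS. nra. }
  rewrite <- Eq.
  assert (J1 : D * (U - k * V) = m) by (unfold m; lra).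
  assert (J2 : m * (U - u0) = - (P - p0)).
  { replace (m * (U - u0)) with (U * (D * (U - k * V)) - u0 * m) by (rewrite J1; ring).
    unfold m; lra. }
  assert (J3 : m * V = k * (P - p0)).
  { replace (m * V) with (V * (D * (U - k * V))) by (rewrite J1; ring). lra. }
  repeat split; try lra.
  - apply (Rmult_eq_reg_l m); [field_simplify|]; lra.
  - apply (Rmult_eq_reg_l m); [field_simplify|]; lra.
Qed.

(** Along the shock polar, the slope of the velocity behind the front is the
    function k q(k) / (m u0 - q(k)) of the slope [k] of the front. The bound on
    [q] makes it smooth for all [k], including those with q(k) <= 0,
    for which there is no shock. *)
Lemma polar_slope_derivative m u0 b c :
  0 < m -> 0 < u0 -> 0 < b -> 0 < c < 1 ->
  let q := fun k => c * (m * u0 / (1 + k ^ 2) - b) in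
  (forall k, q k < m * u0) /\ (forall k, continuous q k) /\
  exists dw : R -> R,
    (forall k, continuous dw k) /\
    (forall k, is_derive (fun k => k * q k / (m * u0 - q k)) k (dw k)).
Proof.
  intros Hm Hu Hb Hc q.
  assert (HN : forall k, 1 <= 1 + k ^ 2) by (intros; nra).
  assert (Hmu : 0 < m * u0) by nra.
  assert (Hq : forall k, q k < m * u0).
  { intros k; unfold q.
    assert (m * u0 / (1 + k ^ 2) <= m * u0).
    { apply (Rmult_le_reg_r (1 + k ^ 2)); [specialize (HN k); lra|].
      unfold Rdiv; rewrite Rmult_assoc, Rinv_l by (specialize (HN k); lra).
      specialize (HN k); nra. }
    nra. }
  pose (dq := fun k => c * (m * u0 * (- (2 * k) / (1 + k ^ 2) ^ 2))).
  assert (Dq : forall k, is_derive q k (dq k)).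
  { intros k; unfold q, dq; specialize (HN k); auto_derive; [simpl in *; lra|].
    field; simpl in *; lra. }
  assert (Cq : forall k, continuous q k) by (intros; eapply derive_continuous, Dq).
  split; [exact Hq|]; split; [exact Cq|].
  exists (fun k => ((q k + k * dq k) * (m * u0 - q k) + k * q k * dq k)
    * (/ (m * u0 - q k) * / (m * u0 - q k))).
  assert (Cdq : forall k, continuous dq k).
  { intros k; apply (ex_derive_continuous dq); unfold dq; specialize (HN k).
    auto_derive; simpl in *; nra. }
  assert (Cid : forall k : R, continuous (fun k : R => k) k) by (intros; apply continuous_id).
  assert (CI : forall k, continuous (fun k => / (m * u0 - q k)) k).
  { intros k; apply (continuous_comp (fun k => m * u0 - q k) Rinv).
    - cont ltac:(apply Cq).
    - apply continuous_Rinv; specialize (Hq k); lra. }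
  split.
  - intros k; cont ltac:(first [apply Cq | apply Cdq | apply CI | apply Cid]).
  - intros k; specialize (Hq k).
    assert (DI : is_derive (fun k => / (m * u0 - q k)) k (- (0 - dq k) / (m * u0 - q k) ^ 2)).
    { apply (is_derive_inv (fun k => m * u0 - q k)); [|lra].
      apply (derive_minus (fun _ => m * u0) q); [apply derive_const | apply Dq]. }
    apply (is_derive_ext (fun k => k * q k * / (m * u0 - q k))); [reflexivity|].
    eapply derive_eq.
    + apply (derive_mult (fun k => k * q k) (fun k => / (m * u0 - q k)) k
        (1 * q k + k * dq k)); [|exact DI].
      apply (derive_mult (fun k => k) q k 1 (dq k));
        [apply (is_derive_id (K := R_AbsRing)) | apply Dq].
    + simpl; field; lra.
Qed.

Lemma p_plus_normal_shock gamma p0 u0 r0 :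
  1 < gamma -> 0 < p0 -> 0 < u0 -> 0 < r0 ->
  p_plus gamma p0 u0 r0 = p0 + 2 / (gamma + 1) * (r0 * u0 * u0 - gamma * p0).
Proof.
  intros Hg Hp Hu Hr; unfold p_plus.
  assert (Hc : 0 < gamma * p0 / r0) by (apply Rdiv_lt_0_compat; nra).
  assert (Hs := sqrt_lt_R0 _ Hc).
  assert (E : (u0 / sqrt (gamma * p0 / r0)) ^ 2 = u0 ^ 2 * r0 / (gamma * p0)).
  { replace ((u0 / sqrt (gamma * p0 / r0)) ^ 2) with (u0 ^ 2 / sqrt (gamma * p0 / r0) ^ 2)
      by (field; lra).
    rewrite pow2_sqrt by lra; field; repeat split; lra. }
  rewrite E; field; repeat split; nra.
Qed.

Lemma rho_plus_normal_shock gamma p0 u0 r0 :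
  1 < gamma -> 0 < p0 -> 0 < u0 -> 0 < r0 ->
  0 < u_plus gamma p0 u0 r0 ->
  rho_plus gamma p0 u0 r0 * u_plus gamma p0 u0 r0 = r0 * u0.
Proof.
  intros Hg Hp Hu Hr HU; unfold rho_plus, u_plus in *.
  rewrite p_plus_normal_shock in * by assumption.
  assert (0 < r0 * u0 * u0) by (apply Rmult_lt_0_compat; [apply Rmult_lt_0_compat|]; lra).
  assert (0 < gamma * p0) by nra.
  field.
  repeat split; try lra; nra.
Qed.

Lemma normal_shock gamma p0 u0 r0 :
  1 < gamma -> 0 < p0 -> 0 < u0 -> 0 < r0 -> gamma * p0 < r0 * u0 ^ 2 ->
  let q := p_plus gamma p0 u0 r0 - p0 in
  0 < q /\ r0 * u0 * u0 = gamma * p0 + (gamma + 1) / 2 * q /\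
  r0 * u0 * u_plus gamma p0 u0 r0 = r0 * u0 * u0 - q /\
  0 < u_plus gamma p0 u0 r0 /\
  rho_plus gamma p0 u0 r0 * u_plus gamma p0 u0 r0 = r0 * u0 /\
  0 < rho_plus gamma p0 u0 r0.
Proof.
  intros Hg Hp Hu Hr HM q.
  assert (Eq : q = 2 / (gamma + 1) * (r0 * u0 * u0 - gamma * p0)).
  { unfold q; rewrite p_plus_normal_shock by assumption; ring. }
  assert (Hq : 0 < q).
  { rewrite Eq; apply Rmult_lt_0_compat; [apply Rdiv_lt_0_compat|]; simpl in HM; lra. }
  assert (Ez : r0 * u0 * u0 = gamma * p0 + (gamma + 1) / 2 * q) by (rewrite Eq; field; lra).
  assert (Hm : 0 < r0 * u0) by nra.
  assert (Em : r0 * u0 * u_plus gamma p0 u0 r0 = r0 * u0 * u0 - q).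
  { unfold u_plus; fold q; field; lra. }
  assert (Hup : 0 < u_plus gamma p0 u0 r0).
  { apply (Rmult_lt_reg_l (r0 * u0)); [exact Hm|]; rewrite Em, Ez; nra. }
  assert (Er := rho_plus_normal_shock gamma p0 u0 r0 Hg Hp Hu Hr Hup).
  repeat split; auto.
  apply (Rmult_lt_reg_r (u_plus gamma p0 u0 r0)); [exact Hup|]; rewrite Er; lra.
Qed.

(** * Pressure and streamline slope in a subsonic flow *)

Lemma subsonic_bound gamma s : 1 < gamma -> positive_state s -> subsonic gamma s ->
  dens s * (velx s ^ 2 + vely s ^ 2) < gamma * pres s.
Proof.
  intros Hg [Hp Hr] H; unfold subsonic, mach, sonic_speed in H.
  assert (Hc : 0 < gamma * pres s / dens s).
  { apply Rdiv_lt_0_compat; [apply Rmult_lt_0_compat|]; lra. }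
  assert (Hs := sqrt_lt_R0 _ Hc).
  apply (Rmult_lt_compat_r _ _ _ Hs) in H.
  unfold Rdiv in H at 1; rewrite Rmult_assoc, Rinv_l, Rmult_1_r, Rmult_1_l in H by lra.
  apply sqrt_lt_0_alt in H.
  apply (Rmult_lt_compat_l _ _ _ Hr) in H.
  replace (dens s * (gamma * pres s / dens s)) with (gamma * pres s) in H by (field; lra).
  exact H.
Qed.

Lemma supersonic_bound gamma p0 u0 r0 :
  1 < gamma -> 0 < p0 -> 0 < u0 -> 0 < r0 ->
  1 < u0 / sqrt (gamma * p0 / r0) -> gamma * p0 < r0 * u0 ^ 2.
Proof.
  intros Hg Hp Hu Hr H.
  assert (Hc : 0 < gamma * p0 / r0) by (apply Rdiv_lt_0_compat; nra).
  assert (Hs := sqrt_lt_R0 _ Hc).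
  apply (Rmult_lt_compat_r _ _ _ Hs) in H.
  unfold Rdiv in H at 2; rewrite Rmult_assoc, Rinv_l, Rmult_1_r, Rmult_1_l in H by lra.
  assert (H2 : sqrt (gamma * p0 / r0) ^ 2 < u0 ^ 2) by (simpl; nra).
  rewrite pow2_sqrt in H2 by lra.
  apply (Rmult_lt_compat_l _ _ _ Hr) in H2.
  replace (r0 * (gamma * p0 / r0)) with (gamma * p0) in H2 by (field; lra).
  exact H2.
Qed.

(** With w = v / u, the transverse component of the momentum equation gives w_x + w w_y,
    and the transport of entropy, in which u_x + w u_y is taken from the x-momentum
    equation, gives w_y. *)
Lemma slope_gradient gamma p u v r px py ux uy vx vy :
  0 < p -> 1 < gamma -> u <> 0 ->
  r * (u * ux + v * uy) + px = 0 ->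
  r * (u * vx + v * vy) + py = 0 ->
  u * px + v * py + gamma * p * (ux + vy) = 0 ->
  let wx := vx * / u + v * (- ux / u ^ 2) in
  let wy := vy * / u + v * (- uy / u ^ 2) in
  r * u ^ 2 * wy = px - r * u * (u * px + v * py) / (gamma * p) /\
  r * u ^ 2 * wx = v / u * px - py - v / u * (r * u ^ 2 * wy).
Proof.
  intros Hp Hg Hu E2 E3 E4 wx wy.
  assert (Epx : px = - r * (u * ux + v * uy)) by lra.
  assert (Epy : py = - r * (u * vx + v * vy)) by lra.
  assert (S : (u * px + v * py) / (gamma * p) = - (ux + vy)).
  { apply (Rmult_eq_reg_r (gamma * p)); [|nra].
    unfold Rdiv; rewrite Rmult_assoc, Rinv_l; nra. }
  split.
  - replace (r * u * (u * px + v * py) / (gamma * p))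
      with (r * u * ((u * px + v * py) / (gamma * p))) by (field; nra).
    rewrite S, Epx; unfold wy; field; assumption.
  - rewrite Epx, Epy; unfold wx, wy; field; assumption.
Qed.

(** The Jacobian multiplied by r u^2 is
    p_x^2 + p_y^2 - (r / (gamma p)) (u p_x + v p_y)^2, which by the Cauchy-Schwarz
    inequality is at least (1 - M^2) (p_x^2 + p_y^2). *)
Lemma pressure_slope_jacobian gamma p u v r px py wx wy :
  0 < p -> 1 < gamma -> 0 < r -> u <> 0 ->
  r * (u ^ 2 + v ^ 2) < gamma * p ->
  r * u ^ 2 * wy = px - r * u * (u * px + v * py) / (gamma * p) ->
  r * u ^ 2 * wx = v / u * px - py - v / u * (r * u ^ 2 * wy) ->
  0 <= px * wy - py * wx /\
  (px * wy - py * wx = 0 -> px = 0 /\ py = 0 /\ wx = 0 /\ wy = 0).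
Proof.
  intros Hp Hg Hr Hu Hsub Hy Hx.
  assert (Hgp : 0 < gamma * p) by nra.
  assert (K : 0 < r * u ^ 2) by (assert (0 < u ^ 2) by nra; nra).
  set (M := r / (gamma * p) * (u ^ 2 + v ^ 2)).
  assert (HM : M < 1).
  { apply (Rmult_lt_reg_r (gamma * p)); [exact Hgp|].
    replace (M * (gamma * p)) with (r * (u ^ 2 + v ^ 2)) by (unfold M; field; lra); lra. }
  assert (B : (1 - M) * (px ^ 2 + py ^ 2) <= r * u ^ 2 * (px * wy - py * wx)).
  { replace (r * u ^ 2 * (px * wy - py * wx))
      with (px * (r * u ^ 2 * wy) - py * (r * u ^ 2 * wx)) by ring.
    rewrite Hx, Hy.
    match goal with |- _ <= ?e => replace e
      with (px ^ 2 + py ^ 2 - r / (gamma * p) * (u * px + v * py) ^ 2)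
      by (field; repeat split; lra) end.
    assert (0 <= r / (gamma * p)) by (apply Rlt_le, Rdiv_lt_0_compat; lra).
    assert (CS : (u * px + v * py) ^ 2 <= (u ^ 2 + v ^ 2) * (px ^ 2 + py ^ 2)).
    { pose proof (pow2_ge_0 (u * py - v * px)); nra. }
    apply (Rmult_le_compat_l (r / (gamma * p))) in CS; [|assumption].
    unfold M; lra. }
  split.
  - apply (Rmult_le_reg_l _ _ _ K); rewrite Rmult_0_r.
    eapply Rle_trans; [|exact B]; apply Rmult_le_pos; nra.
  - intros J; rewrite J, Rmult_0_r in B.
    assert (Z : px ^ 2 + py ^ 2 <= 0) by (apply (Rmult_le_reg_l (1 - M)); lra).
    assert (Zx : px = 0) by nra.
    assert (Zy : py = 0) by nra.
    rewrite Zx, Zy in Hx, Hy.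
    assert (Wy : wy = 0).
    { apply (Rmult_eq_reg_l (r * u ^ 2)); [|lra]; rewrite Hy; field; lra. }
    rewrite Wy in Hx; repeat split; auto.
    apply (Rmult_eq_reg_l (r * u ^ 2)); [|lra]; rewrite Hx; field; lra.
Qed.

(** The function E(y) = (integral of P W_s ds) - p1 W(1, y) + G(k(y)), with
    G' = pi om' a primitive of p dw on the shock polar, is the integral of P dW
    around the part of the square below the height y, traversed clockwise; the wall
    contributes nothing. Its derivative is minus the integral of the Jacobian over
    the slice, and it vanishes at both walls. *)
Lemma elliptic_rigidity P Ps Py W Ws Wy (k dk pi om dom : R -> R) p1 :
  C1_square P Ps Py -> C1_square W Ws Wy ->
  (forall s, 0 <= s <= 1 -> W s 0 = 0 /\ W s 1 = 0) ->
  (forall y, 0 <= y <= 1 -> P 1 y = p1) ->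
  (forall y, 0 <= y <= 1 -> P 0 y = pi (k y) /\ W 0 y = om (k y)) ->
  (forall y, continuous k y) -> (forall y, 0 < y < 1 -> is_derive k y (dk y)) ->
  k 0 = 0 -> k 1 = 0 ->
  (forall c, continuous pi c) -> (forall c, continuous dom c) ->
  (forall c, is_derive om c (dom c)) ->
  (forall s y, 0 < s < 1 -> 0 < y < 1 -> 0 <= Ps s y * Wy s y - Py s y * Ws s y) ->
  forall s y, 0 < s < 1 -> 0 < y < 1 -> Ps s y * Wy s y - Py s y * Ws s y = 0.
Proof.
  intros HP HW W0 P1 Fr Ck Dk k0 k1 Cpi Cdom Dom HJ.
  assert (St := stokes_slice P Ps Py W Ws Wy HP HW).
  destruct HP as (CP & CPs & CPy & DPs & DPy), HW as (CW & CWs & CWy & DWs & DWy).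
  pose (G := RInt (fun c => pi c * dom c) 0).
  assert (DG : forall c, is_derive G c (pi c * dom c)).
  { intros c; apply (is_derive_RInt (fun c => pi c * dom c) G 0 c).
    - apply filter_forall; intros b; apply (RInt_correct (fun c => pi c * dom c)).
      apply ex_RInt_cont; intros; apply cont_mult; auto.
    - apply cont_mult; auto. }
  pose (J := fun s y => Ps s y * Wy s y - Py s y * Ws s y).
  pose (I := fun y => RInt (fun s => J s y) 0 1).
  assert (CJ : continuous2 J) by (unfold J; cont2).
  assert (CI : forall y, continuous I y).
  { intros y; apply (continuous_RInt01 (fun y s => J s y)); apply continuous2_swap, CJ. }
  pose (E := fun y => RInt (fun s => P s y * Ws s y) 0 1 - p1 * W 1 y + G (k y)).
  assert (DE : forall y, 0 < y < 1 -> is_derive E y (- I y)).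
  { intros y Hy; unfold E.
    eapply derive_eq.
    - apply (derive_plus (fun y => RInt (fun s => P s y * Ws s y) 0 1 - p1 * W 1 y)
        (fun y => G (k y))).
      + apply (derive_minus (fun y => RInt (fun s => P s y * Ws s y) 0 1)
          (fun y => p1 * W 1 y)); [apply (St y Hy)|].
        apply (derive_mult (fun _ => p1) (fun y => W 1 y)); [apply derive_const|].
        apply DWy; lra.
      + apply (is_derive_comp G k); [apply DG | apply Dk, Hy].
    - (* The two expressions of W on the front have the same derivative. *)
      assert (HWy : Wy 0 y = dk y * dom (k y)).
      { assert (H1 := DWy 0 y ltac:(lra) Hy).
        assert (H2 : is_derive (fun y => W 0 y) y (dk y * dom (k y))).
        { apply (is_derive_ext_loc (fun y => om (k y))).
          - apply (locally_open_itv 0 1); auto; intros z Hz; symmetry; apply Fr; lra.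
          - apply (is_derive_comp om k); [apply Dom | apply Dk, Hy]. }
        apply is_derive_unique in H1; apply is_derive_unique in H2; congruence. }
      destruct (Fr y ltac:(lra)) as [F1 _].
      rewrite HWy, F1, (P1 y) by lra.
      replace (I y) with (- RInt (fun s => Py s y * Ws s y - Ps s y * Wy s y) 0 1).
      + unfold scal; simpl; unfold mult; simpl; ring.
      + unfold I, J.
        rewrite <- (RInt_opp (fun s => Py s y * Ws s y - Ps s y * Wy s y)).
        * apply RInt_ext; intros s _; unfold opp; simpl; ring.
        * apply ex_RInt_cont; intros s.
          apply (continuous2_fst (fun s y => Py s y * Ws s y - Ps s y * Wy s y)); cont2. }
  assert (CE : forall y, continuous E y).
  { intros y; unfold E; apply cont_plus; [apply cont_minus|].
    - apply (continuous_RInt01 (fun y s => P s y * Ws s y)).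
      apply (continuous2_swap (fun s y => P s y * Ws s y)); cont2.
    - apply cont_mult; [apply cont_const | apply continuous2_snd, CW].
    - apply (continuous_comp k G); [apply Ck | eapply derive_continuous, DG]. }
  assert (EE : forall y, (y = 0 \/ y = 1) -> E y = 0).
  { intros y Hy; unfold E.
    assert (Hk : k y = 0) by (destruct Hy; subst; assumption).
    assert (HWz : forall s, 0 <= s <= 1 -> W s y = 0).
    { intros s Hs; destruct (W0 s Hs), Hy; subst; assumption. }
    rewrite Hk, HWz by lra; unfold G; rewrite RInt_point.
    rewrite (RInt_ext _ (fun _ => 0)).
    - rewrite RInt_const; unfold scal, zero; simpl; unfold mult; simpl; ring.
    - intros s Hs; rewrite Rmin_left, Rmax_right in Hs by lra.
      assert (H1 := DWs s y Hs ltac:(destruct Hy; subst; lra)).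
      assert (H2 : is_derive (fun s => W s y) s 0).
      { apply (is_derive_ext_loc (fun _ => 0)); [|apply derive_const].
        apply (locally_open_itv 0 1); auto; intros z Hz; symmetry; apply HWz; lra. }
      apply is_derive_unique in H1; apply is_derive_unique in H2.
      replace (Ws s y) with 0 by congruence; apply Rmult_0_r. }
  assert (HI : RInt (fun y => - I y) 0 1 = 0).
  { rewrite (fundamental_theorem01 E (fun y => - I y)); auto.
    - rewrite !EE by auto; apply Rminus_eq_0.
    - intros y; apply cont_opp, CI. }
  assert (HI2 : RInt I 0 1 = 0).
  { assert (O : RInt (fun y => - I y) 0 1 = - RInt I 0 1).
    { apply (RInt_opp I); apply ex_RInt_cont, CI. }
    lra. }
  assert (CJ1 : forall y s, continuous (fun s => J s y) s).
  { intros; apply continuous2_fst, CJ. }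
  intros s y Hs Hy; fold (J s y).
  apply (integral_zero_pointwise (fun s => J s y)); [apply CJ1 | | | lra].
  - intros s' Hs'; apply HJ; assumption.
  - apply (integral_zero_pointwise I); [exact CI | | exact HI2 | lra].
    intros y' Hy'; apply RInt_ge_0; [lra | apply ex_RInt_cont, CJ1 |].
    intros s' Hs'; apply HJ; assumption.
Qed.

(** * The regions ahead of and behind the front *)

Lemma D_in_clamp f df :
  (forall y, unit_itv y -> D_in f df unit_itv y) ->
  (forall y, continuous (fun y => f (clamp y)) y) /\
  (forall y, 0 < y < 1 -> is_derive (fun y => f (clamp y)) y (df (clamp y))).
Proof.
  intros H; split.
  - intros y; apply filterlim_locally; intros eps.
    assert (C := cont_deriv f df unit_itv (clamp y) (H _ (clamp_range y))).
    destruct (C eps (cond_pos eps)) as (d & Hd & B).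
    exists (mkposreal d Hd); intros z Hz.
    change (Rabs (z - y) < d) in Hz.
    change (Rabs (f (clamp z) - f (clamp y)) < eps).
    destruct (Req_dec (clamp z) (clamp y)) as [->|Hne].
    { rewrite Rminus_eq_0, Rabs_R0; apply cond_pos. }
    apply (B (clamp z)); split.
    + split; [apply clamp_range | auto].
    + eapply Rle_lt_trans; [apply clamp_lipschitz | exact Hz].
  - intros y Hy; rewrite (clamp_id y) by lra.
    apply (is_derive_ext_loc f).
    { apply (locally_open_itv 0 1); auto; intros z Hz; rewrite clamp_id; lra. }
    apply is_derive_Reals; intros eps He.
    destruct (H y ltac:(unfold unit_itv; lra) eps He) as (d & Hd & B).
    assert (Hm : 0 < Rmin d (Rmin y (1 - y))) by (repeat apply Rmin_pos; lra).
    exists (mkposreal _ Hm); simpl; intros h Hh Hhd.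
    assert (Hh3 : Rabs h < d /\ Rabs h < y /\ Rabs h < 1 - y).
    { repeat split; eapply Rlt_le_trans; try apply Hhd;
      [apply Rmin_l | eapply Rle_trans; [apply Rmin_r | apply Rmin_l]
      | eapply Rle_trans; [apply Rmin_r | apply Rmin_r]]. }
    destruct Hh3 as (H1 & H2 & H3); apply Rabs_def2 in H2; apply Rabs_def2 in H3.
    specialize (B (y + h)).
    replace (y + h - y) with h in B by ring.
    apply B; split; [split; [unfold unit_itv; lra | lra]|].
    simpl; unfold Rdist; replace (y + h - y) with h by ring; exact H1.
Qed.

Lemma locally_pos {T : UniformSpace} (g : T -> R) z :
  continuous g z -> 0 < g z -> locally z (fun z => 0 < g z).
Proof.
  intros Hc Hp; apply filterlim_locally with (eps := mkposreal _ Hp) in Hc.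
  revert Hc; apply filter_imp; intros w Hw.
  change (Rabs (g w - g z) < g z) in Hw; apply Rabs_def2 in Hw; lra.
Qed.

(** The two sides of the front are treated together, [sgn] being 1 behind it and
    -1 ahead of it. *)
Lemma region_open (f : R -> R) (z : R * R) (sgn : R) :
  (forall y, continuous (fun y => f (clamp y)) y) ->
  duct z -> 0 < sgn * (fst z - f (snd z)) ->
  locally z (fun z : R * R => duct z /\ 0 < sgn * (fst z - f (snd z))).
Proof.
  intros Cf Hd Hs.
  assert (C1 : continuous (fun z : R * R => fst z) z) by apply continuous_fst.
  assert (C2 : continuous (fun z : R * R => snd z) z) by apply continuous_snd.
  destruct Hd as [[H1 H2] [H3 H4]].
  assert (L : forall g : R * R -> R, continuous g z -> 0 < g z ->
    locally z (fun z : R * R => 0 < g z)) by (intros; apply locally_pos; assumption).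
  assert (L1 := L (fun z : R * R => fst z - (-1)) ltac:(cont ltac:(assumption)) ltac:(simpl; lra)).
  assert (L2 := L (fun z : R * R => 1 - fst z) ltac:(cont ltac:(assumption)) ltac:(simpl; lra)).
  assert (L3 := L (fun z : R * R => snd z) C2 H3).
  assert (L4 := L (fun z : R * R => 1 - snd z) ltac:(cont ltac:(assumption)) ltac:(simpl; lra)).
  assert (L5 : locally z (fun z : R * R => 0 < sgn * (fst z - f (clamp (snd z))))).
  { apply L.
    - apply (cont_mult (fun _ => sgn)); [apply cont_const|].
      apply (cont_minus (fun z : R * R => fst z)); [exact C1|].
      apply (continuous_comp (fun z : R * R => snd z) (fun y => f (clamp y)));
        [exact C2 | apply Cf].
    - rewrite clamp_id by lra; exact Hs. }
  generalize (filter_and _ _ L1 (filter_and _ _ L2 (filter_and _ _ L3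
    (filter_and _ _ L4 L5)))).
  apply filter_imp; intros w (W1 & W2 & W3 & W4 & W5).
  rewrite clamp_id in W5 by lra.
  unfold duct; repeat split; lra.
Qed.

Lemma Dplus_open f : (forall y, continuous (fun y => f (clamp y)) y) ->
  forall z, Dplus f z -> locally z (Dplus f).
Proof.
  intros Cf z [Hd Hz].
  generalize (region_open f z 1 Cf Hd ltac:(lra)); apply filter_imp.
  intros w [H1 H2]; split; [exact H1 | lra].
Qed.

Lemma Dminus_open f : (forall y, continuous (fun y => f (clamp y)) y) ->
  forall z, Dminus f z -> locally z (Dminus f).
Proof.
  intros Cf z [Hd Hz].
  generalize (region_open f z (-1) Cf Hd ltac:(lra)); apply filter_imp.
  intros w [H1 H2]; split; [exact H1 | lra].
Qed.

Lemma Dplus_closure f z : Dplus f z -> Dplus_bar f z.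
Proof. intros [[? ?] ?]; split; lra. Qed.

Lemma Dminus_closure f z : Dminus f z -> Dminus_bar f z.
Proof. intros [[? ?] ?]; split; lra. Qed.

(** The Bernoulli law is needed on the front, where it holds by continuity. *)
Lemma bernoulli_on_closure gamma b0 (A Abar : R * R -> Prop) X U :
  1 < gamma -> continuous2 X ->
  (forall z, A z -> Abar z) ->
  (forall s y, 0 < s < 1 -> 0 < y < 1 -> A (X s y, y)) ->
  (forall s y, 0 <= s <= 1 -> 0 <= y <= 1 -> Abar (X s y, y)) ->
  C1_flow A Abar U -> (forall z, Abar z -> positive_state (U z)) ->
  (forall x y, A (x, y) -> euler_at gamma b0 U x y) ->
  forall s y, 0 <= s <= 1 -> 0 <= y <= 1 -> bernoulli gamma (U (X s y, y)) = b0.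
Proof.
  intros Hg CX HA HX HXb ((Cp & _) & (Cu & _) & (Cv & _) & (Cr & _)) Hpos HE s y Hs Hy.
  rewrite bernoulli_energy by auto.
  assert (CE : continuous_on Abar (fun z => energy gamma (U z))).
  { unfold energy; apply continuous_on_plus; apply continuous_on_mult;
      try apply continuous_on_const.
    - apply continuous_on_plus; apply continuous_on_mult; assumption.
    - apply continuous_on_mult; [assumption|].
      apply continuous_on_comp with (h := Rinv); [assumption|].
      intros z Hz; apply continuous_Rinv; destruct (Hpos z Hz); lra. }
  assert (CP := pull_continuous Abar X (fun z => energy gamma (U z)) CX HXb CE).
  assert (E := continuous2_closed_eq _ b0 CP).
  specialize (E ltac:(intros s' y' Hs' Hy'; unfold pull; rewrite !clamp_id by lra;
    rewrite <- bernoulli_energy by auto; apply (HE _ _ (HX s' y' Hs' Hy'))) s y Hs Hy).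
  unfold pull in E; rewrite !clamp_id in E by lra; exact E.
Qed.

(** * The flow behind the front *)

(** Vanishing of the Jacobian makes p and w constant along horizontal segments,
    so p = p1 everywhere, in particular on the front. The strength of the shock is
    a strictly decreasing function of the square of the slope [k] of the front, and
    [k] vanishes at the walls, so it vanishes everywhere. Then w = 0, and the
    equations of mass and momentum make u and the density constant along
    horizontal segments. *)
Lemma downstream_rigidity gamma p0 u0 r0 p1 f df Up :
  1 < gamma -> 0 < p0 -> 0 < u0 -> 0 < r0 ->
  let S0 := State p0 u0 0 r0 in
  C2_unit f df ->
  (forall y, unit_itv y -> -1 < f y < 1) ->
  C1_flow (Dplus f) (Dplus_bar f) Up ->
  (forall z, Dplus_bar f z -> positive_state (Up z)) ->
  (forall z, Dplus_bar f z -> subsonic gamma (Up z)) ->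
  (forall x y, Dplus f (x, y) -> euler_at gamma (bernoulli gamma S0) Up x y) ->
  (forall x y, y = 0 \/ y = 1 -> Dplus_bar f (x, y) -> vely (Up (x, y)) = 0) ->
  (forall y, unit_itv y -> pres (Up (1, y)) = p1) ->
  (forall y, unit_itv y ->
     rankine_hugoniot (df y) S0 (Up (f y, y)) /\ entropy_condition S0 (Up (f y, y))) ->
  positive_velx_behind f Up ->
  p1 = p_plus gamma p0 u0 r0 /\ (forall y, unit_itv y -> f y = f 0) /\
  (forall z, Dplus_bar f z -> Up z = state_behind gamma p0 u0 r0).
Proof.
  intros Hg Hp0 Hu0 Hr0 S0 (Df & ddf & Ddf & _) Hf HC1 Hpos Hsub HE Hwall Hexit Hfront Hu.
  destruct (D_in_clamp f df Df) as [Ca Da].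
  destruct (D_in_clamp df ddf Ddf) as [Ck Dk].
  set (a := fun y => f (clamp y)) in *; set (k := fun y => df (clamp y)) in *.
  set (dk := fun y => ddf (clamp y)) in *.
  pose (X := fun s y => a y + s * (1 - a y)).
  assert (Cs : forall s : R, continuous (fun s : R => s) s) by (intros; apply continuous_id).
  assert (CX : continuous2 X) by (unfold X; cont2).
  assert (Ha : forall y, -1 < a y < 1) by (intros; apply Hf, clamp_range).
  assert (HO : forall z, Dplus f z -> locally z (Dplus f)) by (apply Dplus_open; exact Ca).
  assert (HAi : forall s y, 0 < s < 1 -> 0 < y < 1 -> Dplus f (X s y, y)).
  { intros s y Hs Hy; specialize (Ha y); unfold X.
    assert (Ey : a y = f y) by (unfold a; rewrite clamp_id by lra; reflexivity).
    split; [split|]; simpl; try rewrite <- Ey; nra. }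
  assert (HAc : forall s y, 0 <= s <= 1 -> 0 <= y <= 1 -> Dplus_bar f (X s y, y)).
  { intros s y Hs Hy; specialize (Ha y); unfold X.
    assert (Ey : a y = f y) by (unfold a; rewrite clamp_id by lra; reflexivity).
    split; simpl; try rewrite <- Ey; nra. }
  assert (Chart : forall q qx qy, partials (Dplus f) (Dplus_bar f) q qx qy ->
    C1_square (pull X q) (fun s y => pull X qx s y * (1 - a (clamp y)))
      (fun s y => pull X qy s y
         + pull X qx s y * (k (clamp y) + clamp s * (0 - k (clamp y))))).
  { intros q qx qy Hq.
    apply (chart_C1_square (Dplus f) (Dplus_bar f) q qx qy a (fun _ => 1) k (fun _ => 0));
      auto; try (intros; apply continuous_const); intros; try apply derive_const.
    apply Dplus_closure; assumption. }
  assert (Bern := bernoulli_on_closure gamma (bernoulli gamma S0) (Dplus f) (Dplus_bar f)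
    X Up Hg CX (Dplus_closure f) HAi HAc HC1 Hpos HE).
  destruct HC1 as (Hp & Hvx & Hvy & Hr).
  assert (Hw : C1_up_to (Dplus f) (Dplus_bar f) (fun z => vely (Up z) * / velx (Up z))).
  { apply C1_up_to_mult; [exact Hvy|].
    apply (C1_up_to_comp (Dplus f) (Dplus_bar f) (fun z => velx (Up z)) Rinv
      (fun t => - 1 / t ^ 2)); [apply Dplus_closure | | | exact Hvx].
    - intros z Hz; apply (is_derive_inv (fun t => t));
        [apply (is_derive_id (K := R_AbsRing)) | specialize (Hu z Hz); lra].
    - intros z Hz; apply (ex_derive_continuous (fun t : R => - 1 / t ^ 2)).
      specialize (Hu z Hz); auto_derive; simpl; nra. }
  destruct Hp as (Cp & px & py & Cpx & Cpy & Dp).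
  destruct Hvx as (Cu & ux & uy & Cux & Cuy & Du).
  destruct Hvy as (Cv & vx & vy & Cvx & Cvy & Dv).
  destruct Hr as (Cr & rx & ry & Crx & Cry & Dr).
  destruct Hw as (Cw & wx & wy & Cwx & Cwy & Dw).
  assert (SP := Chart _ px py (conj Cp (conj Cpx (conj Cpy Dp)))).
  assert (SU := Chart _ ux uy (conj Cu (conj Cux (conj Cuy Du)))).
  assert (SR := Chart _ rx ry (conj Cr (conj Crx (conj Cry Dr)))).
  assert (SW := Chart _ wx wy (conj Cw (conj Cwx (conj Cwy Dw)))).
  assert (Pull : forall q s y, 0 <= s <= 1 -> 0 <= y <= 1 -> pull X q s y = q (X s y, y)).
  { intros; unfold pull; rewrite !clamp_id by assumption; reflexivity. }
  assert (Pt : forall z, Dplus f z ->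
    0 <= px z * wy z - py z * wx z /\
    (px z * wy z - py z * wx z = 0 ->
      (px z = 0 /\ py z = 0 /\ wx z = 0 /\ wy z = 0) /\
      (vely (Up z) = 0 -> ux z = 0 /\ rx z = 0))).
  { intros [x y] Hz.
    destruct (Dp x y Hz) as [Dp1 Dp2], (Du x y Hz) as [Du1 Du2], (Dv x y Hz) as [Dv1 Dv2],
      (Dr x y Hz) as [Dr1 Dr2], (Dw x y Hz) as [Dw1 Dw2].
    destruct (primitive_form gamma (bernoulli gamma S0) (Dplus f) Up x y
      (px (x, y)) (py (x, y)) (ux (x, y)) (uy (x, y)) (vx (x, y)) (vy (x, y))
      (rx (x, y)) (ry (x, y)) Hg HO (fun z H => Hpos z (Dplus_closure f z H)) HE Hz
      Dp1 Dp2 Du1 Du2 Dv1 Dv2 Dr1 Dr2) as (E1 & E2 & E3 & E4).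
    assert (Hzb := Dplus_closure f _ Hz).
    destruct (Hpos _ Hzb) as [Pp Pr]; assert (Pu := Hu _ Hzb).
    assert (Ps := subsonic_bound gamma _ Hg (Hpos _ Hzb) (Hsub _ Hzb)).
    assert (Ew : forall (q1 q2 : R -> R) (t d1 d2 d : R), q2 t <> 0 ->
      is_derive q1 t d1 -> is_derive q2 t d2 -> is_derive (fun s => q1 s * / q2 s) t d ->
      d = d1 * / q2 t + q1 t * (- d2 / q2 t ^ 2)).
    { intros q1 q2 t d1 d2 d H D1 D2 D.
      apply is_derive_unique in D; rewrite <- D; apply is_derive_unique.
      apply (derive_mult q1 (fun s => / q2 s)); [exact D1|].
      apply (is_derive_inv q2); assumption. }
    assert (Wx : wx (x, y) = vx (x, y) * / velx (Up (x, y))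
      + vely (Up (x, y)) * (- ux (x, y) / velx (Up (x, y)) ^ 2))
      by exact (Ew _ _ _ _ _ _ (Rgt_not_eq _ _ Pu) Dv1 Du1 Dw1).
    assert (Wy : wy (x, y) = vy (x, y) * / velx (Up (x, y))
      + vely (Up (x, y)) * (- uy (x, y) / velx (Up (x, y)) ^ 2))
      by exact (Ew _ _ _ _ _ _ (Rgt_not_eq _ _ Pu) Dv2 Du2 Dw2).
    destruct (slope_gradient gamma _ _ _ _ _ _ _ _ _ _ Pp Hg (Rgt_not_eq _ _ Pu) E2 E3 E4)
      as [G1 G2].
    rewrite <- Wx, <- Wy in G2; rewrite <- Wy in G1.
    destruct (pressure_slope_jacobian gamma _ _ _ _ _ _ _ _ Pp Hg Pr (Rgt_not_eq _ _ Pu)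
      Ps G1 G2) as [J1 J2].
    split; [exact J1|]; intros J; destruct (J2 J) as (Zpx & Zpy & Zwx & Zwy).
    split; [repeat split; assumption|].
    intros Zv; rewrite Zv in *; rewrite Zwx in Wx; rewrite Zwy in Wy.
    rewrite Zpx in E2.
    assert (Zvy : vy (x, y) = 0).
    { apply (Rmult_eq_reg_r (/ velx (Up (x, y)))); [lra | apply Rinv_neq_0_compat; lra]. }
    assert (Zux : ux (x, y) = 0).
    { apply (Rmult_eq_reg_l (dens (Up (x, y)) * velx (Up (x, y)))); nra. }
    split; [exact Zux|].
    rewrite Zux, Zvy in E1.
    apply (Rmult_eq_reg_r (velx (Up (x, y)))); lra. }
  set (m := r0 * u0).
  assert (Hm : 0 < m) by (unfold m; nra).
  assert (Hc : 0 < 2 / (gamma + 1) < 1).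
  { split; [apply Rdiv_lt_0_compat; lra|].
    apply (Rmult_lt_reg_r (gamma + 1)); [lra|].
    unfold Rdiv; rewrite Rmult_assoc, Rinv_l; lra. }
  destruct (polar_slope_derivative m u0 (gamma * p0) (2 / (gamma + 1)) Hm Hu0 ltac:(nra) Hc)
    as (Hq & Cq & dw & Cdw & Ddw).
  set (q := fun k => 2 / (gamma + 1) * (m * u0 / (1 + k ^ 2) - gamma * p0)) in *.
  change (forall k, q k < m * u0) in Hq; change (forall k, continuous q k) in Cq.
  change (forall k, is_derive (fun k => k * q k / (m * u0 - q k)) k (dw k)) in Ddw.
  assert (X0 : forall y, X 0 y = a y) by (intros; unfold X; ring).
  assert (X1 : forall y, X 1 y = 1) by (intros; unfold X; ring).
  assert (Front : forall y, 0 <= y <= 1 ->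
    pres (Up (X 0 y, y)) = p0 + q (k y) /\ velx (Up (X 0 y, y)) = u0 - q (k y) / m /\
    vely (Up (X 0 y, y)) = k y * q (k y) / m /\
    dens (Up (X 0 y, y)) * (velx (Up (X 0 y, y)) - k y * vely (Up (X 0 y, y))) = m /\
    0 < q (k y)).
  { intros y Hy.
    assert (Ey : clamp y = y) by (apply clamp_id; exact Hy).
    destruct (Hfront y Hy) as [F1 F2].
    replace (f y) with (X 0 y) in F1, F2 by (rewrite X0; unfold a; rewrite Ey; reflexivity).
    replace (df y) with (k y) in F1 by (unfold k; rewrite Ey; reflexivity).
    apply (state_behind_front gamma p0 u0 r0 (k y) (Up (X 0 y, y)) Hg Hp0 Hu0 Hr0);
      auto.
    - apply Hpos, HAc; lra.
    - symmetry; apply Bern; lra. }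
  assert (Kwall : forall y, y = 0 \/ y = 1 -> k y = 0).
  { intros y Hy; assert (Hy' : 0 <= y <= 1) by (destruct Hy; lra).
    destruct (Front y Hy') as (_ & _ & F & _ & F0).
    rewrite (Hwall (X 0 y) y Hy) in F by (apply HAc; lra).
    assert (Z : k y * q (k y) = 0).
    { apply (Rmult_eq_reg_r (/ m)); [unfold Rdiv in F; lra | apply Rinv_neq_0_compat; lra]. }
    apply Rmult_integral in Z; lra. }
  assert (Jz : forall s y, 0 < s < 1 -> 0 < y < 1 ->
    px (X s y, y) * wy (X s y, y) - py (X s y, y) * wx (X s y, y) = 0).
  { assert (Jeq : forall s y, 0 < s < 1 -> 0 < y < 1 ->
      pull X px s y * (1 - a (clamp y)) *
        (pull X wy s y + pull X wx s y * (k (clamp y) + clamp s * (0 - k (clamp y))))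
      - (pull X py s y + pull X px s y * (k (clamp y) + clamp s * (0 - k (clamp y))))
        * (pull X wx s y * (1 - a (clamp y)))
      = (1 - a y) * (px (X s y, y) * wy (X s y, y) - py (X s y, y) * wx (X s y, y))).
    { intros s y Hs Hy; rewrite !Pull, !clamp_id by lra; ring. }
    intros s y Hs Hy.
    assert (Z := elliptic_rigidity _ _ _ _ _ _ k dk (fun c => p0 + q c)
      (fun c => c * q c / (m * u0 - q c)) dw p1 SP SW).
    specialize (Ha y).
    apply (Rmult_eq_reg_l (1 - a y)); [|lra]; rewrite Rmult_0_r, <- Jeq by assumption.
    apply Z; auto; clear Z.
    - intros s' Hs'; rewrite !Pull by lra.
      rewrite (Hwall (X s' 0) 0), (Hwall (X s' 1) 1) by (auto; apply HAc; lra).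
      split; ring.
    - intros y' Hy'; rewrite Pull by lra; rewrite X1; apply Hexit, Hy'.
    - intros y' Hy'; rewrite !Pull by lra.
      destruct (Front y' Hy') as (F1 & F2 & F3 & _).
      split; [exact F1|]; rewrite F2, F3; specialize (Hq (k y')); field; split; [apply Rgt_not_eq|]; lra.
    - intros c; apply cont_plus; [apply cont_const | apply Cq].
    - intros s' y' Hs' Hy'; rewrite Jeq by assumption.
      apply Rmult_le_pos; [unfold a; specialize (Hf (clamp y') (clamp_range y')); lra|].
      apply Pt, HAi; assumption. }
  assert (Hpar : forall s y, 0 < s < 1 -> 0 < y < 1 ->
    px (X s y, y) = 0 /\ wx (X s y, y) = 0).
  { intros s y Hs Hy; destruct (Pt _ (HAi s y Hs Hy)) as [_ H].
    destruct (H (Jz s y Hs Hy)) as [(? & ? & ? & ?) _]; split; assumption. }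
  assert (Pconst : forall s y, 0 <= s <= 1 -> 0 <= y <= 1 -> pres (Up (X s y, y)) = p1).
  { intros s y Hs Hy; rewrite <- (Hexit y Hy), <- (X1 y).
    rewrite <- (Pull (fun z => pres (Up z)) s y), <- (Pull (fun z => pres (Up z)) 1 y) by lra.
    apply (C1_square_constant_s _ _ _ SP); auto; try lra.
    intros s' y' Hs' Hy'; rewrite Pull by lra.
    destruct (Hpar s' y' Hs' Hy') as [-> _]; ring. }
  assert (Kzero : forall y, 0 <= y <= 1 -> k y = 0).
  { intros y Hy.
    destruct (Front y Hy) as (F1 & _), (Front 0 ltac:(lra)) as (F0 & _).
    rewrite Pconst in F0, F1 by lra; rewrite (Kwall 0) in F0 by auto.
    assert (Eq : q (k y) = q 0) by lra; unfold q in Eq.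
    apply Rmult_eq_reg_l in Eq; [|lra].
    replace (m * u0 / (1 + 0 ^ 2)) with (m * u0) in Eq by (field; lra).
    assert (HN : 0 < 1 + k y ^ 2) by nra.
    assert (Eq2 : m * u0 = m * u0 * (1 + k y ^ 2)).
    { replace (m * u0) with (m * u0 / (1 + k y ^ 2) * (1 + k y ^ 2)) at 1 by (field; lra).
      replace (m * u0 / (1 + k y ^ 2)) with (m * u0) by lra; reflexivity. }
    assert (0 < m * u0) by nra.
    assert (Z : k y ^ 2 = 0) by (apply (Rmult_eq_reg_l (m * u0)); lra).
    simpl in Z; rewrite Rmult_1_r in Z; apply Rmult_integral in Z; lra. }
  assert (Vzero : forall s y, 0 <= s <= 1 -> 0 <= y <= 1 -> vely (Up (X s y, y)) = 0).
  { intros s y Hs Hy.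
    assert (Hus := Hu _ (HAc s y Hs Hy)).
    apply (Rmult_eq_reg_r (/ velx (Up (X s y, y)))); [|apply Rinv_neq_0_compat; lra].
    rewrite Rmult_0_l.
    rewrite <- (Pull (fun z => vely (Up z) * / velx (Up z)) s y) by lra.
    rewrite (C1_square_constant_s _ _ _ SW) with (s' := 0); auto; try lra.
    - rewrite Pull by lra; destruct (Front y Hy) as (_ & _ & -> & _).
      rewrite Kzero by assumption; unfold Rdiv; ring.
    - intros s' y' Hs' Hy'; rewrite Pull by lra.
      destruct (Hpar s' y' Hs' Hy') as [_ ->]; ring. }
  assert (Hux : forall s y, 0 < s < 1 -> 0 < y < 1 ->
    ux (X s y, y) = 0 /\ rx (X s y, y) = 0).
  { intros s y Hs Hy; destruct (Pt _ (HAi s y Hs Hy)) as [_ H].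
    apply (H (Jz s y Hs Hy)), Vzero; lra. }
  assert (Ep1 : p1 = p_plus gamma p0 u0 r0).
  { rewrite p_plus_normal_shock by assumption.
    destruct (Front 0 ltac:(lra)) as (F0 & _).
    rewrite Pconst, Kzero in F0 by lra; rewrite F0; unfold q, m; field; lra. }
  assert (Eq0 : q 0 = p_plus gamma p0 u0 r0 - p0).
  { destruct (Front 0 ltac:(lra)) as (F0 & _).
    rewrite Pconst, Kzero in F0 by lra; lra. }
  assert (Uconst : forall s y, 0 <= s <= 1 -> 0 <= y <= 1 ->
    velx (Up (X s y, y)) = u_plus gamma p0 u0 r0).
  { intros s y Hs Hy.
    rewrite <- (Pull (fun z => velx (Up z)) s y) by lra.
    rewrite (C1_square_constant_s _ _ _ SU) with (s' := 0); auto; try lra.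
    - rewrite Pull by lra; destruct (Front y Hy) as (_ & -> & _).
      rewrite Kzero, Eq0 by assumption; reflexivity.
    - intros s' y' Hs' Hy'; rewrite Pull by lra.
      destruct (Hux s' y' Hs' Hy') as [-> _]; ring. }
  assert (HU : 0 < u_plus gamma p0 u0 r0).
  { rewrite <- (Uconst 0 0) by lra; apply Hu, HAc; lra. }
  assert (Rconst : forall s y, 0 <= s <= 1 -> 0 <= y <= 1 ->
    dens (Up (X s y, y)) = rho_plus gamma p0 u0 r0).
  { intros s y Hs Hy.
    rewrite <- (Pull (fun z => dens (Up z)) s y) by lra.
    rewrite (C1_square_constant_s _ _ _ SR) with (s' := 0); auto; try lra.
    - rewrite Pull by lra; destruct (Front y Hy) as (_ & _ & _ & F & _).
      rewrite Kzero, Uconst in F by lra.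
      apply (Rmult_eq_reg_r (u_plus gamma p0 u0 r0)); [|lra].
      rewrite rho_plus_normal_shock by assumption; fold m; lra.
    - intros s' y' Hs' Hy'; rewrite Pull by lra.
      destruct (Hux s' y' Hs' Hy') as [_ ->]; ring. }
  split; [exact Ep1|]; split.
  - intros y Hy.
    assert (E : a y = a 0).
    { apply (zero_derivative_constant a 0 1); auto; try lra.
      intros z Hz; eapply derive_eq; [apply Da, Hz|].
      fold (k z); apply Kzero; lra. }
    unfold a in E; rewrite !clamp_id in E by (try lra; apply Hy); exact E.
  - intros [x y] [Hx Hy]; simpl in Hx, Hy.
    assert (Ey : a y = f y) by (unfold a; rewrite clamp_id by lra; reflexivity).
    specialize (Ha y); rewrite Ey in Ha.
    pose (s := (x - f y) / (1 - f y)).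
    assert (Hs : 0 <= s <= 1).
    { unfold s; split.
      - apply Rmult_le_pos; [lra | apply Rlt_le, Rinv_0_lt_compat; lra].
      - apply (Rmult_le_reg_r (1 - f y)); [lra|].
        unfold Rdiv; rewrite Rmult_assoc, Rinv_l; lra. }
    assert (Ex : x = X s y) by (unfold X, s; rewrite Ey; field; lra).
    rewrite Ex.
    specialize (Pconst s y Hs Hy); specialize (Vzero s y Hs Hy).
    specialize (Uconst s y Hs Hy); specialize (Rconst s y Hs Hy).
    unfold state_behind.
    rewrite <- Ep1, <- Pconst, <- Vzero, <- Uconst, <- Rconst; destruct (Up (X s y, y)); reflexivity.
Qed.

(** * A smooth truncation *)

Definition pospart2 (t : R) : R := Rmax 0 t ^ 2.

Lemma pospart2_derive t : is_derive pospart2 t (2 * Rmax 0 t).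
Proof.
  apply derive_of_bound; intros eps He; exists eps; split; [exact He|].
  intros h Hh; apply Rle_trans with (Rabs h * Rabs h).
  - rewrite <- Rabs_mult; rewrite (Rabs_pos_eq (h * h)) by nra.
    unfold pospart2, Rmax.
    destruct (Rle_dec 0 (t + h)), (Rle_dec 0 t); apply Rabs_le; nra.
  - apply Rmult_le_compat_r; [apply Rabs_pos | lra].
Qed.

(** A concave function of class C^1 that equals [r] for r <= c and is constant for
    r >= c + d; its derivative is [soft_cut']. Composed with the front, it gives a
    curve that follows the front up to the abscissa [c] and then turns vertical,
    with slopes between 0 and that of the front. *)
Definition soft_cut (c d r : R) : R := r - (pospart2 (r - c) - pospart2 (r - (c + d))) / (2 * d).
Definition soft_cut' (c d r : R) : R := 1 - (Rmax 0 (r - c) - Rmax 0 (r - (c + d))) / d.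

Lemma Rmax0_continuous t : continuous (fun t => Rmax 0 t) t.
Proof.
  apply filterlim_locally; intros eps; exists eps; intros s Hs.
  change (Rabs (s - t) < eps) in Hs; change (Rabs (Rmax 0 s - Rmax 0 t) < eps).
  eapply Rle_lt_trans; [|exact Hs].
  unfold Rmax; destruct (Rle_dec 0 s), (Rle_dec 0 t); unfold Rabs;
    repeat destruct Rcase_abs; lra.
Qed.

Lemma soft_cut_derive c d r : 0 < d -> is_derive (soft_cut c d) r (soft_cut' c d r).
Proof.
  intros Hd; unfold soft_cut, soft_cut'.
  assert (K : forall e, is_derive (fun r => pospart2 (r - e)) r (2 * Rmax 0 (r - e))).
  { intros e; eapply derive_eq.
    - apply (is_derive_comp pospart2 (fun r => r - e)); [apply pospart2_derive|].
      apply (derive_minus (fun r => r) (fun _ => e) r 1 0);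
        [apply (is_derive_id (K := R_AbsRing)) | apply derive_const].
    - unfold scal; simpl; unfold mult; simpl; ring. }
  eapply derive_eq.
  - apply (derive_minus (fun r => r)
      (fun r => (pospart2 (r - c) - pospart2 (r - (c + d))) * / (2 * d)) r 1
      ((2 * Rmax 0 (r - c) - 2 * Rmax 0 (r - (c + d))) * / (2 * d)
        + (pospart2 (r - c) - pospart2 (r - (c + d))) * 0));
      [apply (is_derive_id (K := R_AbsRing))|].
    apply (derive_mult (fun r => pospart2 (r - c) - pospart2 (r - (c + d)))
      (fun _ => / (2 * d))); [|apply derive_const].
    apply derive_minus; apply K.
  - simpl; field; lra.
Qed.

Lemma soft_cut'_continuous c d r : continuous (soft_cut' c d) r.
Proof.
  unfold soft_cut', Rdiv.
  assert (K : forall e, continuous (fun r => Rmax 0 (r - e)) r).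
  { intros e; apply (continuous_comp (fun r => r - e) (fun t => Rmax 0 t)).
    - apply (cont_minus (fun r : R => r)); [apply continuous_id | apply cont_const].
    - apply Rmax0_continuous. }
  cont ltac:(apply K).
Qed.

Lemma soft_cut_bounds c d r : 0 < d ->
  soft_cut c d r <= r /\ soft_cut c d r <= c + d / 2 /\
  Rmin r c <= soft_cut c d r /\
  0 <= soft_cut' c d r <= 1 /\ (c + d <= r -> soft_cut' c d r = 0).
Proof.
  intros Hd; unfold soft_cut, soft_cut', pospart2.
  destruct (Rle_dec r c) as [H1|H1].
  { rewrite !Rmax_left, Rmin_left by lra.
    replace (r - (0 ^ 2 - 0 ^ 2) / (2 * d)) with r by (field; lra).
    replace (1 - (0 - 0) / d) with 1 by (field; lra).
    repeat split; lra. }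
  rewrite (Rmax_right 0 (r - c)), Rmin_right by lra.
  destruct (Rle_dec r (c + d)) as [H2|H2].
  - rewrite !Rmax_left by lra.
    set (t := (r - c) / d).
    assert (Et : r = c + t * d) by (unfold t; field; lra).
    assert (Ht : 0 <= t <= 1).
    { split; apply (Rmult_le_reg_r d); try lra; unfold t;
      unfold Rdiv; rewrite Rmult_assoc, Rinv_l; lra. }
    replace (r - ((r - c) ^ 2 - 0 ^ 2) / (2 * d)) with (c + d * (t - t ^ 2 / 2))
      by (rewrite Et; field; lra).
    replace (1 - (r - c - 0) / d) with (1 - t) by (rewrite Et; field; lra).
    assert (0 <= d * (t - t ^ 2 / 2) <= d / 2) by (split; nra).
    assert (c + d <= r -> 1 - t = 0) by (intros; nra).
    repeat split; try nra; assumption.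
  - rewrite (Rmax_right 0 (r - (c + d))) by lra.
    replace (r - ((r - c) ^ 2 - (r - (c + d)) ^ 2) / (2 * d)) with (c + d / 2)
      by (field; lra).
    replace (1 - (r - c - (r - (c + d))) / d) with 0 by (field; lra).
    repeat split; lra.
Qed.

(** * The relative flux *)

(** Up to the factor p0^(1/gamma), the power p^(1/gamma). Its product with the
    velocity is divergence-free, by the last equation of [primitive_form]. *)
Definition isentrope (gamma p0 p : R) : R := Rpower (p / p0) (/ gamma).

Lemma Rpower_derive a x : 0 < x -> is_derive (fun x => Rpower x a) x (a * Rpower x (a - 1)).
Proof. intros Hx; apply is_derive_Reals, derivable_pt_lim_power, Hx. Qed.

Lemma isentrope_derive gamma p0 p : 1 < gamma -> 0 < p0 -> 0 < p ->
  is_derive (isentrope gamma p0) p (isentrope gamma p0 p / (gamma * p)).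
Proof.
  intros Hg Hp0 Hp; unfold isentrope.
  assert (Hr : 0 < p / p0) by (apply Rdiv_lt_0_compat; assumption).
  eapply derive_eq.
  - apply (is_derive_comp (fun x => Rpower x (/ gamma)) (fun p => p * / p0));
      [apply Rpower_derive, Hr|].
    apply (derive_mult (fun p => p) (fun _ => / p0) p 1 0);
      [apply (is_derive_id (K := R_AbsRing)) | apply derive_const].
  - replace (/ gamma - 1) with (/ gamma + - (1)) by ring.
    unfold Rdiv in *; rewrite Rpower_plus, Rpower_Ropp, Rpower_1 by exact Hr.
    unfold scal; simpl; unfold mult; simpl; field; repeat split; lra.
Qed.

(** The convex remainder of the isentropic relation: the tangent of r^(1/gamma) at
    r = 1 minus r^(1/gamma), suitably scaled. It is equivalent to
    (r - 1)^2 / (2 gamma) at r = 1. *)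
Definition pressure_gap (gamma r : R) : R :=
  (r - 1 - gamma * (Rpower r (/ gamma) - 1)) / (gamma - 1).

(** The difference of the two sides vanishes at 1 together with its derivative,
    and its second derivative there is (1 - theta) / gamma > 0; so the derivative
    has the sign of r - 1 near 1. *)
Lemma pressure_gap_quadratic gamma theta : 1 < gamma -> theta < 1 ->
  exists e, 0 < e /\ forall r, 0 < r -> Rabs (r - 1) < e ->
    theta * (r - 1) ^ 2 / (2 * gamma) <= pressure_gap gamma r.
Proof.
  intros Hg Ht.
  pose (F := fun r => pressure_gap gamma r - theta * (r - 1) ^ 2 / (2 * gamma)).
  pose (dF := fun r => (1 - Rpower r (/ gamma - 1)) / (gamma - 1) - theta * (r - 1) / gamma).
  assert (DF : forall r, 0 < r -> is_derive F r (dF r)).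
  { intros r Hr; unfold F, dF, pressure_gap.
    assert (K := Rpower_derive (/ gamma) r Hr).
    apply (derive_ext (fun r => (r - 1 - gamma * (Rpower r (/ gamma) - 1)) * / (gamma - 1)
      - theta * / (2 * gamma) * ((r - 1) * (r - 1)))).
    { intros t; field; lra. }
    assert (I : is_derive (fun r : R => r) r 1) by apply (is_derive_id (K := R_AbsRing)).
    eapply derive_eq; [deriv ltac:(eassumption)|]; simpl; field; lra. }
  assert (D2 : is_derive dF 1 ((1 - theta) / gamma)).
  { unfold dF.
    assert (K := Rpower_derive (/ gamma - 1) 1 Rlt_0_1).
    rewrite Rpower_1_l in K || (unfold Rpower at 2 in K; rewrite ln_1, Rmult_0_r, exp_0 in K).
    apply (derive_ext (fun r => (1 - Rpower r (/ gamma - 1)) * / (gamma - 1)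
      - theta * / gamma * (r - 1))).
    { intros t; field; lra. }
    assert (I : is_derive (fun r : R => r) 1 1) by apply (is_derive_id (K := R_AbsRing)).
    eapply derive_eq; [deriv ltac:(eassumption)|]; simpl; field; lra. }
  assert (P1 : forall a, Rpower 1 a = 1).
  { intros a; unfold Rpower; rewrite ln_1, Rmult_0_r; apply exp_0. }
  assert (Z1 : dF 1 = 0) by (unfold dF; rewrite P1; field; lra).
  assert (Z0 : F 1 = 0) by (unfold F, pressure_gap; rewrite P1; field; lra).
  apply is_derive_Reals in D2.
  assert (Hpos : 0 < (1 - theta) / gamma) by (apply Rdiv_lt_0_compat; lra).
  destruct (D2 _ Hpos) as [d Hd].
  assert (Sgn : forall r, Rabs (r - 1) < d -> 0 <= dF r * (r - 1)).
  { intros r Hr; destruct (Req_dec r 1) as [->|Hne]; [lra|].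
    assert (Hh : r - 1 <> 0) by lra.
    specialize (Hd (r - 1) Hh Hr).
    replace (1 + (r - 1)) with r in Hd by ring; rewrite Z1, Rminus_0_r in Hd.
    apply Rabs_def2 in Hd.
    replace (dF r * (r - 1)) with (dF r / (r - 1) * (r - 1) ^ 2) by (field; exact Hh).
    apply Rmult_le_pos; [lra | apply pow2_ge_0]. }
  exists d; split; [apply cond_pos|].
  intros r Hr Hrd.
  destruct (MVT_gen F 1 r dF) as (c & Hc & Heq).
  - intros x Hx; apply DF; revert Hx; unfold Rmin, Rmax; destruct (Rle_dec 1 r); lra.
  - intros x Hx; apply continuity_pt_filterlim.
    apply (derive_continuous F x (dF x)), DF.
    revert Hx; unfold Rmin, Rmax; destruct (Rle_dec 1 r); lra.
  - assert (Hcd : Rabs (c - 1) < d).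
    { eapply Rle_lt_trans; [|exact Hrd]; revert Hc; unfold Rmin, Rmax;
      destruct (Rle_dec 1 r); intros; unfold Rabs; repeat destruct Rcase_abs; lra. }
    specialize (Sgn c Hcd).
    assert (0 <= dF c * (r - 1)).
    { revert Hc; unfold Rmin, Rmax; destruct (Rle_dec 1 r); intros Hc.
      - destruct (Req_dec c 1) as [E|E]; [rewrite E, Z1; lra|].
        assert (0 <= dF c) by (apply (Rmult_le_reg_r (c - 1)); lra).
        apply Rmult_le_pos; lra.
      - destruct (Req_dec c 1) as [E|E]; [rewrite E, Z1; lra|].
        assert (0 <= - dF c) by (apply (Rmult_le_reg_r (1 - c)); lra).
        nra. }
    rewrite <- Heq, Z0 in H; unfold F in H; lra.
Qed.

(** A combination of the fluxes of mass, entropy and x-momentum, with coefficients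
    such that the flux vanishes to second order at (p0, u0, 0, r0) along the states
    that satisfy the Bernoulli law. It plays the role of a relative entropy flux. *)
Definition rel_flux_x (gamma p0 u0 r0 : R) (s : state) : R :=
  gamma / (gamma - 1) * p0 * / r0 * (dens s * velx s)
  - gamma / (gamma - 1) * p0 * (velx s * isentrope gamma p0 (pres s))
  - u0 * (dens s * (velx s * velx s) - u0 * (dens s * velx s) + (pres s - p0)).

Definition rel_flux_y (gamma p0 u0 r0 : R) (s : state) : R :=
  gamma / (gamma - 1) * p0 * / r0 * (dens s * vely s)
  - gamma / (gamma - 1) * p0 * (vely s * isentrope gamma p0 (pres s))
  - u0 * (dens s * velx s * vely s - u0 * (dens s * vely s)).

(** The exact form of the flux in the direction (1, -k) once the Bernoulli law has
    been used to eliminate the enthalpy. All terms are of second order at the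
    reference state. *)
Lemma rel_flux_quadratic gamma p0 u0 r0 s k :
  1 < gamma -> 0 < p0 -> 0 < r0 -> positive_state s ->
  energy gamma s = energy gamma (State p0 u0 0 r0) ->
  rel_flux_x gamma p0 u0 r0 s - k * rel_flux_y gamma p0 u0 r0 s
  = dens s * (velx s - k * vely s) / 2 * ((velx s - u0) ^ 2 + vely s ^ 2)
    + (velx s - k * vely s) * p0 * pressure_gap gamma (pres s / p0)
    + (velx s - u0 - k * vely s) * (pres s - p0).
Proof.
  intros Hg Hp0 Hr0 [Hp Hr] HE; unfold energy in HE; simpl in HE.
  unfold rel_flux_x, rel_flux_y, pressure_gap; fold (isentrope gamma p0 (pres s)).
  set (R := isentrope gamma p0 (pres s)).
  destruct s as [p u v r]; simpl in *.
  assert (E0 : gamma / (gamma - 1) * p0 * / r0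
    = 1 / 2 * (u * u + v * v) + gamma / (gamma - 1) * (p * / r) - 1 / 2 * (u0 * u0)) by lra.
  rewrite E0; field; repeat split; lra.
Qed.

(** With n = u - k v and t = u - u0 - k v, the Cauchy-Schwarz inequality bounds
    t^2 by (1 + k^2) ((u - u0)^2 + v^2). So [Q] dominates a quadratic form in t and
    the pressure difference [pi], whose discriminant is negative when gamma p0 (1 + k^2) < theta r n^2, i.e.
    when the direction is space-like with a margin. *)
Lemma quadratic_positive gamma p0 u0 r u v k pi b theta :
  0 < p0 -> 1 < gamma -> 0 < r -> 0 < u - k * v -> 0 < theta ->
  theta * (pi / p0) ^ 2 / (2 * gamma) <= b ->
  gamma * p0 * (1 + k ^ 2) < theta * (r * (u - k * v) ^ 2) ->
  let Q := r * (u - k * v) / 2 * ((u - u0) ^ 2 + v ^ 2) + (u - k * v) * p0 * b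
    + (u - u0 - k * v) * pi in
  0 <= Q /\ (Q = 0 -> pi = 0 /\ u = u0 /\ v = 0).
Proof.
  intros Hp0 Hg Hr Hn Ht Hb Hc Q.
  set (n := u - k * v) in *; set (N := 1 + k ^ 2) in *.
  set (t := u - u0 - k * v) in *; set (D := (u - u0) ^ 2 + v ^ 2) in *.
  assert (HN : 1 <= N) by (unfold N; nra).
  assert (Ht2 : t ^ 2 <= N * D).
  { unfold t, N, D; pose proof (pow2_ge_0 (k * (u - u0) + v)); nra. }
  set (al := r * n / (2 * N)); set (be := n * theta / (2 * gamma * p0)).
  assert (Hrn : 0 < r * n) by nra.
  assert (Hal : 0 < al) by (apply Rdiv_lt_0_compat; lra).
  assert (Hgp : 0 < gamma * p0) by nra.
  assert (Hab : 1 < 4 * al * be).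
  { replace (4 * al * be) with (theta * (r * n ^ 2) / (gamma * p0 * N))
      by (unfold al, be; field; lra).
    apply (Rmult_lt_reg_r (gamma * p0 * N)); [nra|].
    unfold Rdiv; rewrite (Rmult_assoc _ (/ _)), Rinv_l; nra. }
  assert (B1 : be * pi ^ 2 <= n * p0 * b).
  { replace (be * pi ^ 2) with (n * p0 * (theta * (pi / p0) ^ 2 / (2 * gamma)))
      by (unfold be; field; lra).
    apply Rmult_le_compat_l; [nra | exact Hb]. }
  assert (B2 : al * t ^ 2 <= r * n / 2 * D).
  { replace (r * n / 2 * D) with (al * (N * D)) by (unfold al; field; lra).
    apply Rmult_le_compat_l; lra. }
  assert (B3 : 4 * al * (al * t ^ 2 + be * pi ^ 2 + t * pi)
    = (2 * al * t + pi) ^ 2 + (4 * al * be - 1) * pi ^ 2) by ring.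
  assert (B4 : 0 <= (4 * al * be - 1) * pi ^ 2) by (apply Rmult_le_pos; nra).
  pose proof (pow2_ge_0 (2 * al * t + pi)) as B5.
  assert (B6 : 0 <= al * t ^ 2 + be * pi ^ 2 + t * pi).
  { apply (Rmult_le_reg_l (4 * al)); lra. }
  assert (B7 : al * t ^ 2 + be * pi ^ 2 + t * pi <= Q) by (unfold Q; lra).
  split; [lra|]; intros HQ.
  assert (Z : (4 * al * be - 1) * pi ^ 2 = 0) by nra.
  assert (Zpi : pi = 0).
  { apply Rmult_integral in Z; destruct Z as [Z|Z]; [lra|].
    simpl in Z; rewrite Rmult_1_r in Z; apply Rmult_integral in Z; lra. }
  split; [exact Zpi|].
  assert (Hb0 : 0 <= n * p0 * b).
  { eapply Rle_trans; [|exact B1]; rewrite Zpi; right; ring. }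
  assert (HD : r * n / 2 * D <= 0) by (unfold Q in HQ; rewrite Zpi in HQ; lra).
  assert (HD2 : D <= 0) by (apply (Rmult_le_reg_l (r * n / 2)); lra).
  unfold D in HD2.
  pose proof (pow2_ge_0 (u - u0)); pose proof (pow2_ge_0 v).
  assert (Zu : (u - u0) ^ 2 = 0) by lra.
  assert (Zv : v ^ 2 = 0) by lra.
  assert (Sq : forall z, z ^ 2 = 0 -> z = 0).
  { intros z Hz; simpl in Hz; rewrite Rmult_1_r in Hz; apply Rmult_integral in Hz; lra. }
  apply Sq in Zu; apply Sq in Zv; split; lra.
Qed.

Definition near (e p0 u0 r0 : R) (s : state) : Prop :=
  Rabs (pres s - p0) < e /\ Rabs (velx s - u0) < e /\ Rabs (vely s) < e /\
  Rabs (dens s - r0) < e.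

Lemma eventually_positive (F : R -> R) :
  continuous F 0 -> 0 < F 0 -> locally 0 (fun e => 0 < F e).
Proof. intros; apply locally_pos; assumption. Qed.

(** In both properties a margin proportional to [m] is left for the distance between
    [s] and the reference state; as the slopes are bounded by [K], a neighbourhood
    of fixed size is sufficient. The first one transfers the space-like character of
    the front from the nearby state that borders it to the reference state. *)
Lemma stable_neighbourhood gamma p0 u0 r0 K m :
  1 < gamma -> 0 < p0 -> 0 < u0 -> 0 < r0 -> 0 <= K -> 0 < m ->
  exists e, 0 < e /\
  (forall s k, positive_state s -> near e p0 u0 r0 s -> Rabs k <= K ->
    (1 + k ^ 2) * (gamma * pres s + 2 * m) <= dens s * (velx s - k * vely s) ^ 2 ->
    (1 + k ^ 2) * (gamma * p0 + m) <= r0 * u0 ^ 2) /\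
  (forall s k, positive_state s -> near e p0 u0 r0 s -> Rabs k <= K ->
    energy gamma s = energy gamma (State p0 u0 0 r0) ->
    (1 + k ^ 2) * (gamma * p0 + m) <= r0 * u0 ^ 2 ->
    0 <= rel_flux_x gamma p0 u0 r0 s - k * rel_flux_y gamma p0 u0 r0 s /\
    (rel_flux_x gamma p0 u0 r0 s - k * rel_flux_y gamma p0 u0 r0 s = 0 ->
     s = State p0 u0 0 r0)).
Proof.
  intros Hg Hp0 Hu0 Hr0 HK Hm.
  assert (Hgp : 0 < gamma * p0) by nra.
  (* Half of the margin m absorbs the distance to the reference state, and theta < 1
     uses a part of the rest, so that the inequality of [pressure_gap_quadratic]
     is available. *)
  set (theta := (gamma * p0 + m / 4) / (gamma * p0 + m / 2)).
  assert (Hth : 0 < theta) by (apply Rdiv_lt_0_compat; lra).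
  assert (Hth2 : theta * (gamma * p0 + m / 2) = gamma * p0 + m / 4)
    by (unfold theta; field; lra).
  assert (Hth1 : theta < 1) by nra.
  destruct (pressure_gap_quadratic gamma theta Hg Hth1) as (eb & Heb & Hgap).
  assert (Cid : forall x : R, continuous (fun x : R => x) x) by (intros; apply continuous_id).
  assert (L1 := eventually_positive (fun e => (r0 - e) * ((u0 - (1 + K) * e) * (u0 - (1 + K) * e))
    - (r0 * (u0 * u0) - m / 2)) ltac:(cont ltac:(apply Cid)) ltac:(simpl; ring_simplify; lra)).
  assert (L2 := eventually_positive (fun e => r0 * (u0 * u0) + m / 2
    - (r0 + e) * ((u0 + (1 + K) * e) * (u0 + (1 + K) * e)))
    ltac:(cont ltac:(apply Cid)) ltac:(simpl; ring_simplify; lra)).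
  assert (L3 := eventually_positive (fun e => m / 2 - gamma * e)
    ltac:(cont ltac:(apply Cid)) ltac:(simpl; lra)).
  assert (L4 := eventually_positive (fun e => u0 - (1 + K) * e)
    ltac:(cont ltac:(apply Cid)) ltac:(simpl; lra)).
  assert (L5 := eventually_positive (fun e => r0 - e)
    ltac:(cont ltac:(apply Cid)) ltac:(simpl; lra)).
  assert (L6 := eventually_positive (fun e => p0 * eb - e)
    ltac:(cont ltac:(apply Cid)) ltac:(simpl; nra)).
  destruct (filter_and _ _ L1 (filter_and _ _ L2 (filter_and _ _ L3 (filter_and _ _ L4
    (filter_and _ _ L5 L6))))) as [d Hd].
  pose proof (cond_pos d) as Hd0.
  exists (d / 2); split; [lra|].
  destruct (Hd (d / 2)) as (E1 & E2 & E3 & E4 & E5 & E6).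
  { change (Rabs (d / 2 - 0) < d); rewrite Rminus_0_r, Rabs_pos_eq; lra. }
  clear L1 L2 L3 L4 L5 L6 Hd; set (e := d / 2) in *.
  assert (He : 0 < e) by (unfold e; lra).
  assert (Hn : forall s k, near e p0 u0 r0 s -> Rabs k <= K ->
    u0 - (1 + K) * e < velx s - k * vely s < u0 + (1 + K) * e).
  { intros s k (_ & N2 & N3 & _) Hk.
    assert (Rabs (k * vely s) <= K * e).
    { rewrite Rabs_mult; apply Rmult_le_compat; auto using Rabs_pos; lra. }
    apply Rabs_def2 in N2.
    assert (- (K * e) <= k * vely s <= K * e) by (apply Rabs_le_between; assumption).
    lra. }
  split.
  - intros s k [Hp Hr] N Hk Hs.
    destruct (Hn s k N Hk) as [B1 B2].
    destruct N as (N1 & _ & _ & N4); apply Rabs_def2 in N1; apply Rabs_def2 in N4.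
    set (n := velx s - k * vely s) in *.
    assert (HN : 1 <= 1 + k ^ 2) by nra.
    assert (U : dens s * n ^ 2 <= r0 * u0 ^ 2 + m / 2).
    { apply Rle_trans with ((r0 + e) * ((u0 + (1 + K) * e) * (u0 + (1 + K) * e))); [|simpl; lra].
      apply Rmult_le_compat; try lra; [apply pow2_ge_0|].
      simpl; rewrite Rmult_1_r; apply Rmult_le_compat; lra. }
    assert (V : (1 + k ^ 2) * (gamma * p0 + m + m / 2) <= (1 + k ^ 2) * (gamma * pres s + 2 * m)).
    { apply Rmult_le_compat_l; [lra|].
      assert (gamma * (p0 - pres s) <= gamma * e) by (apply Rmult_le_compat_l; lra). lra. }
    assert (m / 2 <= (1 + k ^ 2) * (m / 2)) by nra.
    lra.
  - intros s k Hps N Hk HE Hs.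
    destruct (Hn s k N Hk) as [B1 B2].
    destruct Hps as [Hp Hr].
    rewrite (rel_flux_quadratic gamma p0 u0 r0 s k Hg Hp0 Hr0 (conj Hp Hr) HE).
    destruct N as (N1 & _ & _ & N4); apply Rabs_def2 in N4.
    assert (HN : 1 <= 1 + k ^ 2) by nra.
    assert (Hpr : Rabs (pres s / p0 - 1) < eb).
    { replace (pres s / p0 - 1) with ((pres s - p0) / p0) by (field; lra).
      unfold Rdiv; rewrite Rabs_mult, (Rabs_pos_eq (/ p0))
        by (apply Rlt_le, Rinv_0_lt_compat; lra).
      apply (Rmult_lt_reg_r p0); [lra|]; rewrite Rmult_assoc, Rinv_l; lra. }
    assert (Hgap' := Hgap (pres s / p0) ltac:(apply Rdiv_lt_0_compat; lra) Hpr).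
    replace (pres s / p0 - 1) with ((pres s - p0) / p0) in Hgap' by (field; lra).
    assert (U : r0 * u0 ^ 2 - m / 2 <= dens s * (velx s - k * vely s) ^ 2).
    { apply Rle_trans with ((r0 - e) * ((u0 - (1 + K) * e) * (u0 - (1 + K) * e))); [simpl; lra|].
      apply Rmult_le_compat; try lra; [nra|].
      simpl; rewrite Rmult_1_r; apply Rmult_le_compat; lra. }
    assert (Hc : gamma * p0 * (1 + k ^ 2) < theta * (dens s * (velx s - k * vely s) ^ 2)).
    { apply Rlt_le_trans with (theta * ((1 + k ^ 2) * (gamma * p0 + m / 2))).
      - replace (theta * ((1 + k ^ 2) * (gamma * p0 + m / 2)))
          with ((1 + k ^ 2) * (theta * (gamma * p0 + m / 2))) by ring.
        rewrite Hth2; nra.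
      - apply Rmult_le_compat_l; [lra|].
        assert (m / 2 <= (1 + k ^ 2) * (m / 2)) by nra.
        lra. }
    destruct (quadratic_positive gamma p0 u0 (dens s) (velx s) (vely s) k (pres s - p0)
      (pressure_gap gamma (pres s / p0)) theta) as [Q1 Q2]; auto; try lra.
    split; [exact Q1|]; intros Z; destruct (Q2 Z) as (Zp & Zu & Zv).
    destruct s as [p u v r]; simpl in *; unfold energy in HE; simpl in HE.
    assert (Ep : p = p0) by lra; subst.
    assert (Er : / r = / r0).
    { apply (Rmult_eq_reg_l (gamma / (gamma - 1) * p0)); [lra|].
      apply Rgt_not_eq, Rmult_lt_0_compat; [apply Rdiv_lt_0_compat|]; lra. }
    apply Rinv_eq_reg in Er; rewrite Er; reflexivity.
Qed.

(** The divergence is the combination, with the coefficients of the flux, of the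
    mass, x-momentum and entropy equations. *)
Lemma rel_flux_divergence gamma p0 u0 r0 b0 (A : R * R -> Prop) U (x y dFx dFy : R) :
  1 < gamma -> 0 < p0 -> 0 < r0 -> (forall z, A z -> locally z A) ->
  (forall z, A z -> positive_state (U z)) ->
  (forall x y, A (x, y) -> euler_at gamma b0 U x y) ->
  A (x, y) ->
  (exists px ux vx rx : R, is_derive (fun s : R => pres (U (s, y))) x px /\
    is_derive (fun s : R => velx (U (s, y))) x ux /\ is_derive (fun s : R => vely (U (s, y))) x vx /\
    is_derive (fun s : R => dens (U (s, y))) x rx) ->
  (exists py uy vy ry : R, is_derive (fun s : R => pres (U (x, s))) y py /\
    is_derive (fun s : R => velx (U (x, s))) y uy /\ is_derive (fun s : R => vely (U (x, s))) y vy /\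
    is_derive (fun s : R => dens (U (x, s))) y ry) ->
  is_derive (fun s : R => rel_flux_x gamma p0 u0 r0 (U (s, y))) x dFx ->
  is_derive (fun s : R => rel_flux_y gamma p0 u0 r0 (U (x, s))) y dFy ->
  dFx + dFy = 0.
Proof.
  intros Hg Hp0 Hr0 HO Hpos HE HA (px & ux & vx & rx & Dp & Du & Dv & Dr)
    (py & uy & vy & ry & Dp' & Du' & Dv' & Dr') DFx DFy.
  destruct (primitive_form gamma b0 A U x y px py ux uy vx vy rx ry Hg HO Hpos HE HA
    Dp Dp' Du Du' Dv Dv' Dr Dr') as (E1 & E2 & _ & E4).
  destruct (Hpos _ HA) as [Pp Pr].
  set (R0 := isentrope gamma p0 (pres (U (x, y)))).
  assert (DI : forall (P : R -> R) (t dp : R), 0 < P t -> is_derive P t dp ->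
    is_derive (fun t : R => isentrope gamma p0 (P t)) t
      (dp * (isentrope gamma p0 (P t) / (gamma * P t)))).
  { intros P t dp Hpt D.
    apply (is_derive_comp (isentrope gamma p0) P); [apply isentrope_derive; assumption | exact D]. }
  assert (FX : forall (P Q V D : R -> R) (t dp dq dv dd : R), 0 < P t ->
    is_derive P t dp -> is_derive Q t dq -> is_derive V t dv -> is_derive D t dd ->
    is_derive (fun t : R => rel_flux_x gamma p0 u0 r0 (State (P t) (Q t) (V t) (D t))) t
    (gamma / (gamma - 1) * p0 * / r0 * (dd * Q t + D t * dq)
     - gamma / (gamma - 1) * p0 * (dq * isentrope gamma p0 (P t)
         + Q t * (dp * (isentrope gamma p0 (P t) / (gamma * P t))))
     - u0 * (dd * (Q t * Q t) + D t * (2 * Q t * dq) - u0 * (dd * Q t + D t * dq) + dp)) /\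
    is_derive (fun t : R => rel_flux_y gamma p0 u0 r0 (State (P t) (Q t) (V t) (D t))) t
    (gamma / (gamma - 1) * p0 * / r0 * (dd * V t + D t * dv)
     - gamma / (gamma - 1) * p0 * (dv * isentrope gamma p0 (P t)
         + V t * (dp * (isentrope gamma p0 (P t) / (gamma * P t))))
     - u0 * (dd * Q t * V t + D t * dq * V t + D t * Q t * dv
         - u0 * (dd * V t + D t * dv)))).
  { intros P Q V D t dp dq dv dd HP DP DQ DV DD.
    assert (DI' := DI P t dp HP DP).
    split; unfold rel_flux_x, rel_flux_y; simpl;
      (eapply derive_eq; [deriv ltac:(eassumption) | simpl; ring]). }
  destruct (FX (fun s : R => pres (U (s, y))) (fun s : R => velx (U (s, y)))
    (fun s : R => vely (U (s, y))) (fun s : R => dens (U (s, y))) x px ux vx rx Pp Dp Du Dv Dr)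
    as [FX1 _].
  destruct (FX (fun s : R => pres (U (x, s))) (fun s : R => velx (U (x, s)))
    (fun s : R => vely (U (x, s))) (fun s : R => dens (U (x, s))) y py uy vy ry Pp Dp' Du' Dv' Dr')
    as [_ FY1].
  assert (Eta : forall s, State (pres s) (velx s) (vely s) (dens s) = s)
    by (intros []; reflexivity).
  apply (derive_ext _ (fun s : R => rel_flux_x gamma p0 u0 r0 (U (s, y)))) in FX1;
    [|intros; rewrite Eta; reflexivity].
  apply (derive_ext _ (fun s : R => rel_flux_y gamma p0 u0 r0 (U (x, s)))) in FY1;
    [|intros; rewrite Eta; reflexivity].
  apply is_derive_unique in DFx; apply is_derive_unique in DFy.
  apply is_derive_unique in FX1; apply is_derive_unique in FY1.
  rewrite <- DFx, <- DFy, FX1, FY1; fold R0.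
  match type of E1 with ?e1 = _ => match type of E2 with ?e2 = _ =>
  match type of E4 with ?e4 = _ =>
    transitivity (gamma / (gamma - 1) * p0 * / r0 * e1
      - gamma / (gamma - 1) * p0 * (R0 / (gamma * pres (U (x, y)))) * e4
      - u0 * (velx (U (x, y)) * e1 + e2 - u0 * e1)) end end end.
  - field; repeat split; lra.
  - rewrite E1, E2, E4; ring.
Qed.

(** * The flow ahead of the front *)

Lemma Rmin_continuous (g : R -> R) : (forall y, continuous g y) ->
  continuous2 (fun s y => Rmin (2 * s - 1) (g y)).
Proof.
  intros Hg.
  assert (Cid : forall s : R, continuous (fun s : R => s) s) by (intros; apply continuous_id).
  assert (C : continuous2 (fun s y => 2 * s - 1 - Rmax 0 (2 * s - 1 - g y))).
  { apply (continuous2_minus (fun s y => 2 * s - 1)); [cont2|].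
    intros x y; apply (continuity_1d_2d_pt_comp (fun t => Rmax 0 t)
      (fun s y => 2 * s - 1 - g y)).
    - apply continuity_pt_filterlim, Rmax0_continuous.
    - assert (K : continuous2 (fun s y => 2 * s - 1 - g y)) by cont2; apply K. }
  intros x y; refine (continuity_2d_pt_ext _ _ x y _ (C x y)).
  intros u v; unfold Rmin, Rmax; destruct (Rle_dec (2 * u - 1) (g v));
    destruct (Rle_dec 0 (2 * u - 1 - g v)); lra.
Qed.

(** Uniform continuity in the parametrisation (s, y) |-> (min (2 s - 1, f y), y) of the
    closed region. Here the abscissa x = 2 s - 1 does not involve y, so a horizontal
    distance is a distance in s up to a fixed factor. *)
Lemma horizontal_modulus f q e :
  (forall y, continuous (fun y => f (clamp y)) y) ->
  (forall y, unit_itv y -> -1 < f y < 1) ->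
  continuous_on (Dminus_bar f) q -> 0 < e ->
  exists d, 0 < d /\ forall x x' y, Dminus_bar f (x, y) -> Dminus_bar f (x', y) ->
    Rabs (x - x') < d -> Rabs (q (x, y) - q (x', y)) < e.
Proof.
  intros Cf Hf Cq He.
  pose (X := fun s y => Rmin (2 * s - 1) (f (clamp y))).
  assert (HX : forall s y, 0 <= s <= 1 -> 0 <= y <= 1 -> Dminus_bar f (X s y, y)).
  { intros s y Hs Hy; unfold X; rewrite (clamp_id y Hy); specialize (Hf y Hy).
    split; simpl; [split; [apply Rmin_glb; lra | apply Rmin_r] | exact Hy]. }
  assert (CQ := pull_continuous (Dminus_bar f) X q (Rmin_continuous _ Cf) HX Cq).
  destruct (uniform_continuity_2d (pull X q) 0 1 0 1 (fun u v _ _ => CQ u v) (mkposreal e He))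
    as [d Hd]; simpl in Hd.
  exists (2 * d); split; [pose proof (cond_pos d); lra|].
  intros x x' y [Hx Hy] [Hx' _] Hxx; simpl in *.
  specialize (Hf y Hy).
  specialize (Hd ((x' + 1) / 2) y ((x + 1) / 2) y ltac:(lra) Hy ltac:(lra) Hy).
  assert (E : forall z, -1 <= z <= f y -> pull X q ((z + 1) / 2) y = q (z, y)).
  { intros z Hz; unfold pull, X; rewrite !(clamp_id y Hy), clamp_id by lra.
    replace (2 * ((z + 1) / 2) - 1) with z by field.
    rewrite Rmin_left by lra; reflexivity. }
  rewrite !E in Hd by assumption; apply Hd.
  - replace ((x + 1) / 2 - (x' + 1) / 2) with ((x - x') * / 2) by field.
    rewrite Rabs_mult, (Rabs_pos_eq (/ 2)) by lra; lra.
  - rewrite Rminus_eq_0, Rabs_R0; apply cond_pos.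
Qed.

Lemma rel_flux_C1 gamma p0 u0 r0 (A Abar : R * R -> Prop) U :
  1 < gamma -> 0 < p0 -> (forall z, A z -> Abar z) ->
  (forall z, Abar z -> positive_state (U z)) -> C1_flow A Abar U ->
  C1_up_to A Abar (fun z => rel_flux_x gamma p0 u0 r0 (U z)) /\
  C1_up_to A Abar (fun z => rel_flux_y gamma p0 u0 r0 (U z)).
Proof.
  intros Hg Hp0 HA Hpos (Cp & Cu & Cv & Cr).
  assert (CI : C1_up_to A Abar (fun z => isentrope gamma p0 (pres (U z)))).
  { apply (C1_up_to_comp A Abar (fun z => pres (U z)) (isentrope gamma p0)
      (fun p => isentrope gamma p0 p * / (gamma * p))); auto.
    - intros z Hz; apply isentrope_derive; auto; apply Hpos, Hz.
    - intros z Hz; destruct (Hpos z Hz) as [Hp _].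
      apply cont_mult.
      + eapply derive_continuous, isentrope_derive; auto.
      + apply (continuous_comp (fun p => gamma * p) Rinv).
        * apply cont_mult; [apply cont_const | apply continuous_id].
        * apply continuous_Rinv; nra. }
  unfold rel_flux_x, rel_flux_y; split;
  repeat lazymatch goal with
  | |- C1_up_to _ _ (fun _ => ?c) => apply C1_up_to_const
  | |- C1_up_to _ _ (fun z => @?q z - @?r z) => apply (C1_up_to_minus A Abar q r)
  | |- C1_up_to _ _ (fun z => @?q z + @?r z) => apply (C1_up_to_plus A Abar q r)
  | |- C1_up_to _ _ (fun z => @?q z * @?r z) => apply (C1_up_to_mult A Abar q r)
  | |- _ => assumption
  end.
Qed.

(** Apply [flux_conservation] to the relative flux below the curve x = g(y), with
    g obtained from f by a truncation between a + d/2 and a + d. The flux through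
    the entry is zero, so it is zero through all the curves x = -1 + s (1 + g(y)).
    Their slopes are fractions of that of the front, and are non-zero only where
    f < a + d; so they are space-like, the integrand is non-negative, and it
    vanishes. These curves sweep a region that contains
    x <= min (f, a + d/2). *)
Lemma upstream_step gamma p0 u0 r0 f df Um a d m :
  1 < gamma -> 0 < p0 -> 0 < u0 -> 0 < r0 -> -1 <= a -> 0 < d ->
  let S0 := State p0 u0 0 r0 in
  (forall y, continuous (fun y => f (clamp y)) y) ->
  (forall y, 0 < y < 1 -> is_derive (fun y => f (clamp y)) y (df (clamp y))) ->
  (forall y, continuous (fun y => df (clamp y)) y) ->
  (forall y, unit_itv y -> -1 < f y < 1) ->
  C1_flow (Dminus f) (Dminus_bar f) Um ->
  (forall z, Dminus_bar f z -> positive_state (Um z)) ->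
  (forall x y, Dminus f (x, y) -> euler_at gamma (bernoulli gamma S0) Um x y) ->
  (forall y, unit_itv y -> Um (-1, y) = S0) ->
  (forall x y, y = 0 \/ y = 1 -> Dminus_bar f (x, y) -> vely (Um (x, y)) = 0) ->
  (forall x y k, Dminus_bar f (x, y) -> x < a + d -> Rabs k <= Rabs (df y) ->
    (1 + k ^ 2) * (gamma * p0 + m) <= r0 * u0 ^ 2 ->
    0 <= rel_flux_x gamma p0 u0 r0 (Um (x, y)) - k * rel_flux_y gamma p0 u0 r0 (Um (x, y)) /\
    (rel_flux_x gamma p0 u0 r0 (Um (x, y)) - k * rel_flux_y gamma p0 u0 r0 (Um (x, y)) = 0 ->
     Um (x, y) = S0)) ->
  gamma * p0 + m <= r0 * u0 ^ 2 -> 0 <= gamma * p0 + m ->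
  (forall y, unit_itv y -> f y < a + d ->
    (1 + df y ^ 2) * (gamma * p0 + m) <= r0 * u0 ^ 2) ->
  forall x y, Dminus_bar f (x, y) -> x <= a + d / 2 -> Um (x, y) = S0.
Proof.
  intros Hg Hp0 Hu0 Hr0 Ha Hd S0 Ca Da Ck Hf HC1 Hpos HE Hin Hwall Hquad HM HM0 Hsp.
  set (c := a + d / 2); set (w := d / 2).
  assert (Hw : 0 < w) by (unfold w; lra).
  pose (g := fun y => soft_cut c w (f (clamp y))).
  pose (dg := fun y => soft_cut' c w (f (clamp y)) * df (clamp y)).
  assert (HG := fun r => soft_cut_bounds c w r Hw).
  assert (Cg : forall y, continuous g y).
  { intros y; apply (continuous_comp (fun y => f (clamp y)) (soft_cut c w)); [apply Ca|].
    eapply derive_continuous, soft_cut_derive, Hw. }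
  assert (Cdg : forall y, continuous dg y).
  { intros y; apply cont_mult; [|apply Ck].
    apply (continuous_comp (fun y => f (clamp y)) (soft_cut' c w));
      [apply Ca | apply soft_cut'_continuous]. }
  assert (Dg : forall y, 0 < y < 1 -> is_derive g y (dg y)).
  { intros y Hy; eapply derive_eq.
    - apply (is_derive_comp (soft_cut c w) (fun y => f (clamp y)));
        [apply soft_cut_derive, Hw | apply Da, Hy].
    - unfold dg, scal; simpl; unfold mult; simpl; ring. }
  assert (Hg1 : forall y, 0 <= y <= 1 -> -1 < g y <= f y /\ g y < a + d).
  { intros y Hy; unfold g; rewrite (clamp_id y Hy).
    specialize (Hf y Hy); destruct (HG (f y)) as (G1 & G2 & G3 & _).
    assert (-1 < Rmin (f y) c) by (apply Rmin_glb_lt; [lra | unfold c; lra]).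
    split; [split; lra|]; unfold c, w in *; lra. }
  pose (X := fun s y => -1 + s * (g y - -1)).
  assert (HAi : forall s y, 0 < s < 1 -> 0 < y < 1 -> Dminus f (X s y, y)).
  { intros s y Hs Hy; destruct (Hg1 y ltac:(lra)) as [G1 _]; specialize (Hf y ltac:(unfold unit_itv; lra)).
    unfold X; split; [split|]; simpl; nra. }
  assert (HAc : forall s y, 0 <= s <= 1 -> 0 <= y <= 1 -> Dminus_bar f (X s y, y)).
  { intros s y Hs Hy; destruct (Hg1 y Hy) as [G1 _].
    unfold X; split; simpl; nra. }
  assert (HO := Dminus_open f Ca).
  destruct (rel_flux_C1 gamma p0 u0 r0 (Dminus f) (Dminus_bar f) Um Hg Hp0
    (Dminus_closure f) Hpos HC1) as [CFx CFy].
  destruct CFx as (Cfx & fxx & fxy & Cfxx & Cfxy & Dfx).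
  destruct CFy as (Cfy & fyx & fyy & Cfyx & Cfyy & Dfy).
  set (Fx := fun z => rel_flux_x gamma p0 u0 r0 (Um z)) in *.
  set (Fy := fun z => rel_flux_y gamma p0 u0 r0 (Um z)) in *.
  assert (Chart : forall q qx qy, partials (Dminus f) (Dminus_bar f) q qx qy ->
    C1_square (pull X q) (fun s y => pull X qx s y * (g (clamp y) - -1))
      (fun s y => pull X qy s y
         + pull X qx s y * (0 + clamp s * (dg (clamp y) - 0)))).
  { intros q qx qy Hq.
    apply (chart_C1_square (Dminus f) (Dminus_bar f) q qx qy (fun _ => -1) g (fun _ => 0) dg);
      auto; try (intros; apply continuous_const); intros; try apply derive_const.
    apply Dminus_closure; assumption. }
  assert (SX := Chart _ _ _ (conj Cfx (conj Cfxx (conj Cfxy Dfx)))).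
  assert (SY := Chart _ _ _ (conj Cfy (conj Cfyx (conj Cfyy Dfy)))).
  assert (Pull : forall q s y, 0 <= s <= 1 -> 0 <= y <= 1 -> pull X q s y = q (X s y, y)).
  { intros; unfold pull; rewrite !clamp_id by assumption; reflexivity. }
  assert (Div : forall z, Dminus f z -> fxx z + fyy z = 0).
  { intros [x y] Hz.
    destruct HC1 as ((_ & px & py & _ & _ & Dp) & (_ & ux & uy & _ & _ & Du) &
      (_ & vx & vy & _ & _ & Dv) & (_ & rx & ry & _ & _ & Dr)).
    apply (rel_flux_divergence gamma p0 u0 r0 (bernoulli gamma S0) (Dminus f) Um x y); auto.
    - intros z Hz'; apply Hpos, Dminus_closure, Hz'.
    - exists (px (x, y)), (ux (x, y)), (vx (x, y)), (rx (x, y)).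
      refine (conj _ (conj _ (conj _ _))); [apply Dp | apply Du | apply Dv | apply Dr]; exact Hz.
    - exists (py (x, y)), (uy (x, y)), (vy (x, y)), (ry (x, y)).
      refine (conj _ (conj _ (conj _ _))); [apply Dp | apply Du | apply Dv | apply Dr]; exact Hz.
    - apply Dfx, Hz.
    - apply Dfy, Hz. }
  assert (Zero : forall s, 0 <= s <= 1 ->
    RInt (fun y => pull X Fx s y - s * dg y * pull X Fy s y) 0 1 = 0).
  { intros s Hs.
    rewrite (flux_conservation _ _ _ _ _ _ g dg SX SY); auto.
    - rewrite (RInt_ext _ (fun _ => 0)).
      + rewrite RInt_const; unfold scal; simpl; unfold mult; simpl; ring.
      + intros y Hy; rewrite Rmin_left, Rmax_right in Hy by lra.
        rewrite Pull by lra; replace (X 0 y) with (-1) by (unfold X; ring).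
        unfold Fx; rewrite Hin by (unfold unit_itv; lra).
        unfold rel_flux_x, isentrope, Rdiv; simpl; rewrite Rinv_r by lra.
        unfold Rpower; rewrite ln_1, Rmult_0_r, exp_0; field; lra.
    - intros s' y Hs' Hy; rewrite !Pull, !clamp_id by lra.
      specialize (Div _ (HAi s' y Hs' Hy)).
      replace (fyy (X s' y, y)) with (- fxx (X s' y, y)) by lra; ring.
    - intros s' Hs'; rewrite !Pull by lra; unfold Fy, rel_flux_y.
      rewrite (Hwall (X s' 0) 0), (Hwall (X s' 1) 1) by (auto; apply HAc; lra).
      split; ring. }
  assert (Key : forall s y, 0 <= s <= 1 -> 0 <= y <= 1 -> Um (X s y, y) = S0).
  { intros s y Hs Hy.
    assert (Q : forall y, 0 <= y <= 1 ->
      0 <= pull X Fx s y - s * dg y * pull X Fy s y /\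
      (pull X Fx s y - s * dg y * pull X Fy s y = 0 -> Um (X s y, y) = S0)).
    { clear y Hy; intros y Hy; rewrite !Pull by assumption; unfold Fx, Fy.
      destruct (Hg1 y Hy) as [G1 G2].
      destruct (HG (f y)) as (_ & _ & _ & G4 & G5).
      assert (Edg : dg y = soft_cut' c w (f y) * df y) by (unfold dg; rewrite (clamp_id y Hy); reflexivity).
      assert (Hlam : 0 <= s * soft_cut' c w (f y) <= 1) by nra.
      apply Hquad; [apply HAc; assumption | unfold X; nra | |].
      - rewrite Edg, <- Rmult_assoc, Rabs_mult, (Rabs_pos_eq (s * soft_cut' c w (f y))) by lra.
        pose proof (Rabs_pos (df y)); nra.
      - rewrite Edg, <- Rmult_assoc.
        destruct (Rle_dec (c + w) (f y)) as [Hfy|Hfy].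
        + rewrite (G5 Hfy); simpl; lra.
        + eapply Rle_trans; [|apply (Hsp y Hy); unfold c, w in *; lra].
          apply Rmult_le_compat_r; [exact HM0|].
          apply Rplus_le_compat_l; rewrite Rpow_mult_distr.
          pose proof (pow2_ge_0 (df y)).
          assert ((s * soft_cut' c w (f y)) ^ 2 <= 1) by nra.
          nra. }
    apply (Q y Hy).
    apply (integral_zero_pointwise (fun y => pull X Fx s y - s * dg y * pull X Fy s y)); auto.
    - intros x.
      assert (CX := proj1 SX); assert (CY := proj1 SY).
      cont ltac:(first [apply continuous2_snd; assumption | apply Cdg]).
    - intros x Hx; apply Q; lra. }
  intros x y [Hx Hy] Hxc; simpl in Hx, Hy.
  destruct (Hg1 y Hy) as [G1 _].
  assert (Hxg : x <= g y).
  { unfold g; rewrite (clamp_id y Hy); destruct (HG (f y)) as (_ & _ & G3 & _).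
    eapply Rle_trans; [|exact G3]; apply Rmin_glb; [lra | exact Hxc]. }
  set (s := (x + 1) / (g y + 1)).
  assert (Hs : 0 <= s <= 1).
  { unfold s; split.
    - apply Rmult_le_pos; [lra | apply Rlt_le, Rinv_0_lt_compat; lra].
    - apply (Rmult_le_reg_r (g y + 1)); [lra|].
      unfold Rdiv; rewrite Rmult_assoc, Rinv_l; lra. }
  replace x with (X s y) by (unfold X, s; field; lra).
  apply Key; assumption.
Qed.

(** If the flow equals U0 for x <= a, then by uniform continuity it is close to U0
    for x < a + d with d independent of [a]; this is all that [upstream_step] needs
    to reach a + d/2. *)
Lemma upstream_rigidity gamma p0 u0 r0 f df Um Up :
  1 < gamma -> 0 < p0 -> 0 < u0 -> 0 < r0 -> gamma * p0 < r0 * u0 ^ 2 ->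
  let S0 := State p0 u0 0 r0 in
  C2_unit f df ->
  (forall y, unit_itv y -> -1 < f y < 1) ->
  C1_flow (Dminus f) (Dminus_bar f) Um ->
  C1_flow (Dplus f) (Dplus_bar f) Up ->
  (forall z, Dminus_bar f z -> positive_state (Um z)) ->
  (forall z, Dplus_bar f z -> positive_state (Up z)) ->
  (forall x y, Dminus f (x, y) -> euler_at gamma (bernoulli gamma S0) Um x y) ->
  (forall x y, Dplus f (x, y) -> euler_at gamma (bernoulli gamma S0) Up x y) ->
  (forall y, unit_itv y -> Um (-1, y) = S0) ->
  (forall x y, y = 0 \/ y = 1 -> Dminus_bar f (x, y) -> vely (Um (x, y)) = 0) ->
  (forall y, unit_itv y ->
     rankine_hugoniot (df y) (Um (f y, y)) (Up (f y, y)) /\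
     entropy_condition (Um (f y, y)) (Up (f y, y))) ->
  forall z, Dminus_bar f z -> Um z = S0.
Proof.
  intros Hg Hp0 Hu0 Hr0 HM S0 (Df & ddf & Ddf & _) Hf HCm HCp Hpm Hpp HEm HEp Hin Hwall Hfront.
  destruct (D_in_clamp f df Df) as [Ca Da].
  destruct (D_in_clamp df ddf Ddf) as [Ck _].
  destruct (bounded01 _ Ck) as (K & HK0 & HK).
  assert (Cid : forall s : R, continuous (fun s : R => s) s) by (intros; apply continuous_id).
  pose (Xm := fun s y => -1 + s * (f (clamp y) - -1)).
  assert (Bm : forall z, Dminus_bar f z -> bernoulli gamma (Um z) = bernoulli gamma S0).
  { assert (B := bernoulli_on_closure gamma (bernoulli gamma S0) (Dminus f) (Dminus_bar f) Xm Um Hg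
      ltac:(unfold Xm; cont2) (Dminus_closure f)).
    intros [x y] [Hx Hy]; simpl in Hx, Hy; specialize (Hf y Hy) as Hfy.
    set (s := (x + 1) / (f y + 1)).
    assert (Hs : 0 <= s <= 1).
    { unfold s; split.
      - apply Rmult_le_pos; [lra | apply Rlt_le, Rinv_0_lt_compat; lra].
      - apply (Rmult_le_reg_r (f y + 1)); [lra|].
        unfold Rdiv; rewrite Rmult_assoc, Rinv_l; lra. }
    replace x with (Xm s y) by (unfold Xm, s; rewrite (clamp_id y Hy); field; lra).
    apply B; auto.
    - intros s' y' Hs' Hy'; specialize (Hf y' ltac:(unfold unit_itv; lra)).
      unfold Xm; rewrite clamp_id by lra; split; [split|]; simpl; nra.
    - intros s' y' Hs' Hy'; specialize (Hf y' Hy').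
      unfold Xm; rewrite clamp_id by lra; split; simpl; nra. }
  assert (Bp : forall y, unit_itv y -> bernoulli gamma (Up (f y, y)) = bernoulli gamma S0).
  { intros y Hy; pose (X := fun s y => f (clamp y) + s * (1 - f (clamp y))).
    replace (f y) with (X 0 y) by (unfold X; rewrite (clamp_id y Hy); ring).
    apply (bernoulli_on_closure gamma (bernoulli gamma S0) (Dplus f) (Dplus_bar f) X Up Hg); auto;
      try lra.
    - unfold X; cont2.
    - apply Dplus_closure.
    - intros s' y' Hs' Hy'; specialize (Hf y' ltac:(unfold unit_itv; lra)).
      unfold X; rewrite clamp_id by lra; split; [split|]; simpl; nra.
    - intros s' y' Hs' Hy'; specialize (Hf y' Hy').
      unfold X; rewrite clamp_id by lra; split; simpl; nra. }
  (* A positive lower bound of the jump gives the front a uniform space-like margin. *)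
  assert (Jump : exists j, 0 < j /\ forall y, unit_itv y ->
    j <= pres (Up (f y, y)) - pres (Um (f y, y))).
  { pose (X := fun (s : R) y => f (clamp y)).
    assert (CX : continuous2 X) by (unfold X; cont2).
    assert (C1 := pull_continuous (Dminus_bar f) X (fun z => pres (Um z)) CX
      ltac:(intros s y Hs Hy; unfold X; rewrite (clamp_id y Hy); specialize (Hf y Hy);
        split; simpl; lra) (proj1 (proj1 HCm))).
    assert (C2 := pull_continuous (Dplus_bar f) X (fun z => pres (Up z)) CX
      ltac:(intros s y Hs Hy; unfold X; rewrite (clamp_id y Hy); specialize (Hf y Hy);
        split; simpl; lra) (proj1 (proj1 HCp))).
    pose (h := fun y => pull X (fun z => pres (Up z)) 0 y - pull X (fun z => pres (Um z)) 0 y).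
    assert (Eh : forall y, unit_itv y -> h y = pres (Up (f y, y)) - pres (Um (f y, y))).
    { intros y Hy; unfold h, pull, X; rewrite !(clamp_id y Hy); reflexivity. }
    destruct (continuity_ab_min h 0 1) as (y0 & Hmin & Hy0); [lra| |].
    - intros y _; apply continuity_pt_filterlim; apply (cont_minus (U := R_UniformSpace));
        apply continuous2_snd; assumption.
    - exists (h y0); split.
      + rewrite Eh by exact Hy0; destruct (Hfront y0 Hy0) as [_ F]; exact F.
      + intros y Hy; rewrite <- Eh by exact Hy; apply Hmin, Hy. }
  destruct Jump as (j & Hj & HJ).
  (* Since gamma + 1 >= 2, [shock_strength] gives the margin j >= 2 m on the front;
     the second bound covers the parts of the curves that are vertical. *)
  set (m := Rmin (j / 2) (r0 * u0 ^ 2 - gamma * p0)).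
  assert (Hm : 0 < m) by (apply Rmin_pos; lra).
  assert (Hm1 : m <= j / 2) by apply Rmin_l.
  assert (Hm2 : m <= r0 * u0 ^ 2 - gamma * p0) by apply Rmin_r.
  destruct (stable_neighbourhood gamma p0 u0 r0 K m Hg Hp0 Hu0 Hr0 HK0 Hm) as (e & He & N1 & N2).
  assert (Mod := fun q Cq => horizontal_modulus f q e Ca Hf Cq He).
  destruct HCm as (Hcp & Hcu & Hcv & Hcr).
  destruct (Mod _ (proj1 Hcp)) as (d1 & Hd1 & M1).
  destruct (Mod _ (proj1 Hcu)) as (d2 & Hd2 & M2).
  destruct (Mod _ (proj1 Hcv)) as (d3 & Hd3 & M3).
  destruct (Mod _ (proj1 Hcr)) as (d4 & Hd4 & M4).
  set (d := Rmin (Rmin d1 d2) (Rmin d3 d4)).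
  assert (Hd : 0 < d) by (repeat apply Rmin_pos; assumption).
  assert (Hdd : d <= d1 /\ d <= d2 /\ d <= d3 /\ d <= d4).
  { unfold d; repeat split; eapply Rle_trans;
      [apply Rmin_l | apply Rmin_l | apply Rmin_l | apply Rmin_r
      | apply Rmin_r | apply Rmin_l | apply Rmin_r | apply Rmin_r]. }
  assert (Step : forall a, -1 <= a ->
    (forall x y, Dminus_bar f (x, y) -> x <= a -> Um (x, y) = S0) ->
    forall x y, Dminus_bar f (x, y) -> x <= a + d / 2 -> Um (x, y) = S0).
  { intros a Ha IH.
    assert (Near : forall x y, Dminus_bar f (x, y) -> x < a + d -> near e p0 u0 r0 (Um (x, y))).
    { intros x y Hz Hx.
      assert (Hz' : Dminus_bar f (Rmin x a, y)).
      { destruct Hz as [H1 H2]; split; simpl in *; [split|exact H2].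
        - apply Rmin_glb; lra.
        - eapply Rle_trans; [apply Rmin_l | lra]. }
      assert (E := IH _ y Hz' (Rmin_r x a)).
      assert (Hxx : Rabs (x - Rmin x a) < d).
      { unfold Rmin; destruct (Rle_dec x a); apply Rabs_def1; lra. }
      specialize (M1 x (Rmin x a) y Hz Hz' ltac:(lra)).
      specialize (M2 x (Rmin x a) y Hz Hz' ltac:(lra)).
      specialize (M3 x (Rmin x a) y Hz Hz' ltac:(lra)).
      specialize (M4 x (Rmin x a) y Hz Hz' ltac:(lra)).
      rewrite E in M1, M2, M3, M4; simpl in M1, M2, M3, M4.
      rewrite Rminus_0_r in M3; repeat split; assumption. }
    assert (Kf : forall y, unit_itv y -> Rabs (df y) <= K).
    { intros y Hy; specialize (HK y Hy); rewrite (clamp_id y Hy) in HK; exact HK. }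
    apply (upstream_step gamma p0 u0 r0 f df Um a d m); auto; try lra.
    - exact (conj Hcp (conj Hcu (conj Hcv Hcr))).
    - intros x y k Hz Hx Hk Hs.
      apply N2; auto.
      + eapply Rle_trans; [exact Hk | apply Kf, Hz].
      + rewrite <- !bernoulli_energy; auto; split; assumption.
    - nra.
    - intros y Hy Hfy; specialize (Hf y Hy) as Hfb.
      assert (Hz : Dminus_bar f (f y, y)) by (split; simpl; [lra | exact Hy]).
      assert (Hz' : Dplus_bar f (f y, y)) by (split; simpl; [lra | exact Hy]).
      apply (N1 (Um (f y, y)) (df y)); auto.
      destruct (Hfront y Hy) as [F1 F2].
      rewrite (shock_strength gamma (df y) _ _ Hg (Hpm _ Hz) (Hpp _ Hz') F1 F2)
        by (rewrite Bm, Bp by assumption; reflexivity).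
      apply Rmult_le_compat_l; [nra|].
      specialize (HJ y Hy); unfold jump; nra. }
  assert (All : forall (n : nat) x y, Dminus_bar f (x, y) -> x <= -1 + INR n * (d / 2) ->
    Um (x, y) = S0).
  { induction n as [|n IH].
    - intros x y [H1 H2] Hx; simpl in *.
      replace x with (-1) by lra; apply Hin, H2.
    - rewrite S_INR; intros x y Hz Hx.
      apply (Step (-1 + INR n * (d / 2))); auto; [|lra].
      pose proof (pos_INR n); nra. }
  intros [x y] Hz.
  destruct (INR_unbounded (2 / (d / 2))) as [n Hn].
  apply (All n); auto.
  assert (2 <= INR n * (d / 2)).
  { apply (Rmult_lt_compat_r (d / 2)) in Hn; [|lra].
    unfold Rdiv in Hn at 1; rewrite Rmult_assoc, Rinv_l in Hn by lra; lra. }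
  destruct Hz as [[H1 H2] H3]; simpl in *; specialize (Hf y H3); lra.
Qed.

(** * The special solution and the theorem *)

Lemma constant_flow_C1 A Abar s : C1_flow A Abar (fun _ => s).
Proof. refine (conj _ (conj _ (conj _ _))); apply C1_up_to_const. Qed.

Lemma constant_flow_euler gamma s x y : euler_at gamma (bernoulli gamma s) (fun _ => s) x y.
Proof.
  unfold euler_at, divergence; rewrite !Derive_const, Rplus_0_r; auto.
Qed.

Lemma special_solution_exists gamma p0 u0 r0 :
  1 < gamma -> 0 < p0 -> 0 < u0 -> 0 < r0 ->
  1 < u0 / sqrt (gamma * p0 / r0) ->
  transonic_shock_solution gamma (State p0 u0 0 r0) (p_plus gamma p0 u0 r0)
    (fun _ => 0) (fun _ => State p0 u0 0 r0) (fun _ => state_behind gamma p0 u0 r0) /\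
  positive_velx_behind (fun _ => 0) (fun _ => state_behind gamma p0 u0 r0).
Proof.
  intros Hg Hp Hu Hr HM0.
  assert (HM := supersonic_bound gamma p0 u0 r0 Hg Hp Hu Hr HM0).
  destruct (normal_shock gamma p0 u0 r0 Hg Hp Hu Hr HM) as (Hq & Ez & Em & Hup & Er & Hrp).
  assert (Hpp : 0 < p_plus gamma p0 u0 r0) by lra.
  set (S0 := State p0 u0 0 r0); set (S1 := state_behind gamma p0 u0 r0).
  assert (P0 : positive_state S0) by (split; assumption).
  assert (P1 : positive_state S1) by (split; assumption).
  assert (EB : bernoulli gamma S1 = bernoulli gamma S0).
  { rewrite !bernoulli_formula by assumption; unfold S0, S1, state_behind; simpl.
    set (P := p_plus gamma p0 u0 r0) in *; set (V := u_plus gamma p0 u0 r0) in *.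
    set (D := rho_plus gamma p0 u0 r0) in *.
    assert (Hm : 0 < r0 * u0) by nra.
    assert (ED : / D = V / (r0 * u0)) by (rewrite <- Er; field; lra).
    assert (EV : V = u0 - (P - p0) / (r0 * u0)) by reflexivity.
    rewrite ED, EV.
    assert (EP : P = p0 + 2 / (gamma + 1) * (r0 * u0 * u0 - gamma * p0)).
    { apply p_plus_normal_shock; assumption. }
    rewrite EP; field; repeat split; lra. }
  split; [|intros z _; exact Hup].
  exists (fun _ => 0); cbv zeta.
  split.
  { split; [intros y _; apply Dconst|].
    exists (fun _ => 0); split; [intros y _; apply Dconst|].
    apply continuous_on_forall; intros; apply continuous_const. }
  split; [intros; lra|].
  do 2 (split; [apply constant_flow_C1|]).
  do 2 (split; [intros; assumption|]).
  split.
  { intros z _; unfold supersonic, mach, sonic_speed, S0; simpl.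
    replace (u0 * (u0 * 1) + 0 * (0 * 1)) with (u0 ^ 2) by ring.
    rewrite sqrt_pow2 by lra; exact HM0. }
  split.
  { intros z _; unfold subsonic, mach, sonic_speed, S1, state_behind; simpl.
    set (P := p_plus gamma p0 u0 r0) in *; set (V := u_plus gamma p0 u0 r0) in *.
    set (D := rho_plus gamma p0 u0 r0) in *.
    replace (V * (V * 1) + 0 * (0 * 1)) with (V ^ 2) by ring.
    rewrite sqrt_pow2 by lra.
    assert (Hc : 0 < gamma * P / D) by (apply Rdiv_lt_0_compat; nra).
    assert (Hs := sqrt_lt_R0 _ Hc).
    apply (Rmult_lt_reg_r (sqrt (gamma * P / D))); [exact Hs|].
    unfold Rdiv at 1; rewrite Rmult_assoc, Rinv_l, Rmult_1_r, Rmult_1_l by lra.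
    rewrite <- (sqrt_pow2 V) by lra.
    apply sqrt_lt_1_alt; split; [apply pow2_ge_0|].
    apply (Rmult_lt_reg_l D); [exact Hrp|].
    replace (D * (gamma * P / D)) with (gamma * P) by (field; lra).
    replace (D * V ^ 2) with (D * V * V) by ring.
    rewrite Er, Em, Ez; nra. }
  split; [intros; apply constant_flow_euler|].
  split; [intros; rewrite <- EB; apply constant_flow_euler|].
  split; [reflexivity|].
  do 2 (split; [reflexivity|]).
  split; [reflexivity|].
  intros y _; split; [|exact Hq].
  unfold rankine_hugoniot, jump, mass_x, mass_y, momx_x, momx_y, momy_x, momy_y, S0, S1,
    state_behind; simpl.
  set (P := p_plus gamma p0 u0 r0) in *; set (V := u_plus gamma p0 u0 r0) in *.
  set (D := rho_plus gamma p0 u0 r0) in *.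
  repeat split; try lra.
  replace (D * (V * (V * 1))) with (D * V * V) by ring.
  rewrite Er, Em; ring.
Qed.

Lemma transonic_shock_rigidity gamma p0 u0 r0 p1 f Um Up :
  1 < gamma -> 0 < p0 -> 0 < u0 -> 0 < r0 ->
  1 < u0 / sqrt (gamma * p0 / r0) ->
  transonic_shock_solution gamma (State p0 u0 0 r0) p1 f Um Up ->
  positive_velx_behind f Up ->
  p1 = p_plus gamma p0 u0 r0 /\ is_special_solution gamma p0 u0 r0 (f 0) f Um Up.
Proof.
  intros Hg Hp Hu Hr HM (df & Hf2 & Hf & HCm & HCp & Hpm & Hpp & _ & Hsub & HEm & HEp
    & Hin & Hwm & Hwp & Hex & Hfront) Hup.
  assert (HM' := supersonic_bound gamma p0 u0 r0 Hg Hp Hu Hr HM).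
  assert (Hm : forall z, Dminus_bar f z -> Um z = State p0 u0 0 r0).
  { apply (upstream_rigidity gamma p0 u0 r0 f df Um Up); auto. }
  assert (Hfront' : forall y, unit_itv y ->
    rankine_hugoniot (df y) (State p0 u0 0 r0) (Up (f y, y)) /\
    entropy_condition (State p0 u0 0 r0) (Up (f y, y))).
  { intros y Hy; rewrite <- (Hm (f y, y)); [apply Hfront, Hy|].
    specialize (Hf y Hy); split; simpl; [lra | exact Hy]. }
  destruct (downstream_rigidity gamma p0 u0 r0 p1 f df Up) as (E1 & E2 & E3); auto.
  repeat split; assumption.
Qed.

Theorem theorem2p1 :
  forall (gamma p0 u0 rho0 p1 : R),
  1 < gamma ->
  0 < p0 -> 0 < u0 -> 0 < rho0 ->
  1 < u0 / sqrt (gamma * p0 / rho0) ->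
  ((exists (f : R -> R) (Um Up : flow),
      transonic_shock_solution gamma (State p0 u0 0 rho0) p1 f Um Up /\
      positive_velx_behind f Up)
   <-> p1 = p_plus gamma p0 u0 rho0)
  /\
  (p1 = p_plus gamma p0 u0 rho0 ->
   forall (f : R -> R) (Um Up : flow) (t : R),
   -1 < t < 1 ->
   transonic_shock_solution gamma (State p0 u0 0 rho0) p1 f Um Up ->
   positive_velx_behind f Up ->
   f 0 = t ->
   is_special_solution gamma p0 u0 rho0 t f Um Up).
Proof.
  intros gamma p0 u0 rho0 p1 Hg Hp Hu Hr HM; split; [split|].
  - intros (f & Um & Up & HS & HU).
    apply (transonic_shock_rigidity gamma p0 u0 rho0 p1 f Um Up Hg Hp Hu Hr HM HS HU).
  - intros ->; do 3 eexists.
    apply (special_solution_exists gamma p0 u0 rho0 Hg Hp Hu Hr HM).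
  - intros _ f Um Up t _ HS HU <-.
    apply (transonic_shock_rigidity gamma p0 u0 rho0 p1 f Um Up Hg Hp Hu Hr HM HS HU).
Qed.
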